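(* Let $k$ be an algebraically closed field of characteristic zero and let $n\ge 2$. Let $P_{n,\tau}=\mathrm{PGL}_n\rtimes\langle\tau\rangle$, where $\tau$ has order two and acts on $\mathrm{PGL}_n$ by $\tau(h)=(h^{-1})^t$. Let $A$ be a central simple algebra of degree $n$ with involution $\sigma$ and with associated $P_{n,\tau}$-variety $X$. Then the $P_{n,\tau}$-action on $X$ has a stabilizer in general position, say $S$. Moreover: (a) $\sigma$ is of the first kind if and only if $S\neq 1$. (b) $\sigma$ is of the second kind (i.e., is unitary) if and only if $S=1$ (i.e., the action of $P_{n,\tau}$ on $X$ is generically free). (c) $\sigma$ is orthogonal if and only if $S$ is conjugate in $P_{n,\tau}$ to $\{1,\tau\}$. (d) $\sigma$ is symplectic if and only if $S$ is conjugate in $P_{n,\tau}$ to $\{1,\tau g_0\}$, where $g_0$ is the image in $\mathrm{PGL}_n$ of the matrix $\begin{pmatrix}0&I\\-I&0\end{pmatrix}$, with $I$ the identity matrix of order $\frac n2$.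
   Context: Conventions: A central simple algebra is a simple $k$-algebra that is finite-dimensional over its center, such that the center is a finitely generated field extension of $k$; it has degree $n$ if its dimension over its center is $n^2$. All algebra homomorphisms and involutions are $k$-linear; an involution is an anti-automorphism $\sigma$ with $\sigma^2=\mathrm{id}$. It is of the first kind if it is the identity on the center, and otherwise of the second kind (unitary); involutions of the first kind are either orthogonal or symplectic in the usual sense (symplectic ones exist only for $n$ even; the element $g_0$ in (d) is only defined for $n$ even). $a^t$ denotes the transpose of a matrix $a$, and for $h\in\mathrm{PGL}_n$, $h^t$ denotes the class of the transpose of a matrix representing $h$. $\mathrm{PGL}_n$ is identified with the subgroup $\mathrm{PGL}_n\times 1$ of $P_{n,\tau}$. ''In general position'' means in some dense open subset. A $G$-variety is generically free if points in general position have trivial stabilizer in $G$. An action of a linear algebraic group $G$ on a variety $X$ has a stabilizer in general position if there is a subgroup $S$ of $G$ such that for $x\in X$ in general position the stabilizer of $x$ in $G$ is conjugate to $S$ ($S$ is defined only up to conjugacy). For an irreducible, generically free $\mathrm{PGL}_n$-variety $X$, $k_n(X)$ denotes the set of $\mathrm{PGL}_n$-equivariant rational maps $X\dashrightarrow \mathrm{M}_n=\mathrm{M}_n(k)$ ($\mathrm{PGL}_n$ acting on $\mathrm{M}_n$ by conjugation); it is a central simple algebra of degree $n$ (known fact). If $X$ is an irreducible $P_{n,\tau}$-variety which is generically free as a $\mathrm{PGL}_n$-variety, $\sigma_{X,\tau}$ is the involution of $k_n(X)$ given by $\sigma_{X,\tau}(f)(x)=f(\tau x)^t$ for $x\in X$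 in general position. The $P_{n,\tau}$-variety associated to $(A,\sigma)$ is an irreducible $P_{n,\tau}$-variety $X$, generically free as a $\mathrm{PGL}_n$-variety, such that $(A,\sigma)\cong(k_n(X),\sigma_{X,\tau})$ as algebras with involution; it exists and is unique up to birational isomorphism of $P_{n,\tau}$-varieties. *)

(* Defs.v *)
From HB Require Import structures.
From mathcomp Require Import all_boot all_order all_algebra.
From mathcomp Require Import generic_quotient.
From mathcomp Require Import boolp classical_sets topology.
From mathcomp Require mpoly.

Set Implicit Arguments.
Unset Strict Implicit.
Unset Printing Implicit Defensive.

Import GRing.Theory.
Local Open Scope classical_set_scope.
Local Open Scope ring_scope.
Local Open Scope quotient_scope.

(* Classical varieties are spaces with functions: topological spaces with, for
   each open [U], the set of [k]-valued functions that are regular on [U].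
   Functions are total on the carrier; only their values on [U] matter. *)

Record funspace (k : Type) := FunSpace {
  carrier :> topologicalType;
  regular : set carrier -> set (carrier -> k) }.
Arguments FunSpace {k} carrier regular.
Arguments regular {k} f.

(* [T] with the coarsest topology in which the members of [B] are open *)
Definition generated_topology (T : choiceType) (B : set (set T)) : Type := T.

HB.instance Definition _ (T : choiceType) (B : set (set T)) :=
  Choice.on (generated_topology B).
HB.instance Definition _ (T : choiceType) (B : set (set T)) :=
  @isSubBaseTopological.Build (generated_topology B) (set T) B id.

Section Spaces.
Variable k : fieldType.

Definition polyval (a b : nat) (p : mpoly.mpoly (a * b) k) (x : 'M[k]_(a, b)) : k :=
  mpoly.meval (fun i => mxvec x ord0 i) p.

Definition affine_space (a b : nat) : funspace k :=
  FunSpace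
    (@generated_topology 'M[k]_(a, b)
       [set U | exists p, U = [set x | polyval p x != 0]])
    (fun U => [set f | forall x, U x -> exists p q, polyval q x != 0 /\
       forall y, U y -> polyval q y != 0 -> f y = polyval p y / polyval q y]).

(* The structure induced on [T] by a map [i] (in practice injective). *)
Definition induced (X : funspace k) (T : choiceType) (i : T -> X) : funspace k :=
  FunSpace
    (@generated_topology T [set V | exists2 U : set X, open U & V = i @^-1` U])
    (fun V => [set f | forall t, V t -> exists U : set X, exists g : X -> k,
       [/\ open U, regular X U g, U (i t) &
           forall s, V s -> U (i s) -> f s = g (i s)]]).

Definition sub_funspace (X : funspace k) (Z : set X) : funspace k :=
  @induced X Z (fun z => val z).

(* The quotient structure on [T] along a map [p] (in practice surjective). *)
Definition coinduced (X : funspace k) (T : choiceType) (p : X -> T) : funspace k :=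
  FunSpace
    (@generated_topology T [set V | open (p @^-1` V)])
    (fun V => [set f : T -> k | regular X (p @^-1` V) (f \o p)]).

Definition tensors (X Y : funspace k) (U : set X) (V : set Y) :
    set (X * Y -> k) :=
  [set h | exists (r : nat) (u : 'I_r -> X -> k) (v : 'I_r -> Y -> k),
     [/\ forall i, regular X U (u i), forall i, regular Y V (v i) &
         forall xy, h xy = \sum_(i < r) u i xy.1 * v i xy.2]].

(* The product of (pre)varieties: its topology is not the product topology;
   it is generated by the sets [{h != 0}] in [U x V], for [h] in the image of
   [O(U) (x) O(V)]. *)
Definition prod_funspace (X Y : funspace k) : funspace k :=
  FunSpace
    (@generated_topology (X * Y)%type
       [set W | exists (U : set X) (V : set Y) (h : X * Y -> k),
          [/\ open U, open V, tensors U V h &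
              W = [set xy | [/\ U xy.1, V xy.2 & h xy != 0]]]])
    (fun W => [set f | forall xy, W xy ->
       exists (U : set X) (V : set Y) (p q : X * Y -> k),
       [/\ open U /\ U xy.1, open V /\ V xy.2,
           tensors U V p /\ tensors U V q, q xy != 0 &
           forall st, W st -> U st.1 -> V st.2 -> q st != 0 ->
             f st = p st / q st]]).

Definition two_points : funspace k := FunSpace bool (fun _ => setT).

Definition morphism (X Y : funspace k) (f : X -> Y) : Prop :=
  continuous f /\
  forall (V : set Y) (h : Y -> k),
    open V -> regular Y V h -> regular X (f @^-1` V) (h \o f).

Definition isomorphic (X Y : funspace k) : Prop :=
  exists (f : X -> Y) (g : Y -> X),
    [/\ morphism f, morphism g, cancel f g & cancel g f].

Definition affine_variety (X : funspace k) : Prop :=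
  exists (N : nat) (Z : set (affine_space 1 N)),
    closed Z /\ isomorphic X (sub_funspace Z).

Record variety (X : funspace k) : Prop := {
  regular_restrict : forall (U V : set X) (f g : X -> k),
    open U -> open V -> V `<=` U -> regular X U f ->
    (forall x, V x -> f x = g x) -> regular X V g;
  regular_glue : forall (U : set X) (f : X -> k), open U ->
    (forall x, U x ->
       exists V : set X, [/\ open V, V x, V `<=` U & regular X V f]) ->
    regular X U f;
  affine_cover : exists (r : nat) (U : 'I_r -> set X),
    [/\ forall i, open (U i), forall x, exists i, U i x &
        forall i, affine_variety (sub_funspace (U i))];
  separated : closed ([set xy | xy.1 = xy.2] : set (prod_funspace X X)) }.

Definition irreducible (X : funspace k) : Prop :=
  (exists x : X, True) /\
  forall U V : set X, open U -> open V -> U !=set0 -> V !=set0 ->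
    U `&` V !=set0.

Definition in_general_position (X : funspace k) (Q : X -> Prop) : Prop :=
  exists U : set X, [/\ open U, dense U & forall x, U x -> Q x].

(* A rational map is represented by a total function that is a morphism on
   some dense open set; two representatives define the same rational map when
   they agree in general position. *)
Definition rational_map (X Y : funspace k) (f : X -> Y) : Prop :=
  exists U : set X,
    [/\ open U, dense U & @morphism (sub_funspace U) Y (fun z => f (val z))].

Definition rational_eq (X : funspace k) (T : Type) (f g : X -> T) : Prop :=
  in_general_position (fun x => f x = g x).

End Spaces.

Section Groups.
Variables (k : fieldType) (n : nat).

Record GL : Type := MkGL { GL_mx :> 'M[k]_n; GL_unit : GL_mx \in unitmx }.
HB.instance Definition _ := [isSub for GL_mx].
HB.instance Definition _ := [Choice of GL by <:].

Fact GL_one_subproof : (1%:M : 'M[k]_n) \in unitmx.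
Proof. exact: unitmx1. Qed.
Definition GL_one : GL := MkGL GL_one_subproof.

Fact GL_mul_subproof (g h : GL) : g *m h \in unitmx.
Proof. by rewrite unitmx_mul (GL_unit g) (GL_unit h). Qed.
Definition GL_mul (g h : GL) : GL := MkGL (GL_mul_subproof g h).

Fact GL_inv_subproof (g : GL) : invmx g \in unitmx.
Proof. by rewrite unitmx_inv (GL_unit g). Qed.
Definition GL_inv (g : GL) : GL := MkGL (GL_inv_subproof g).

Fact GL_tr_subproof (g : GL) : g^T \in unitmx.
Proof. by rewrite unitmx_tr (GL_unit g). Qed.
Definition GL_tr (g : GL) : GL := MkGL (GL_tr_subproof g).

Definition proportional (g h : GL) : bool :=
  `[< exists2 c : k, c != 0 & GL_mx g = c *: GL_mx h >].

Fact proportional_equiv : equiv_class_of proportional.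
Proof.
split=> [g|g h|h g l].
- by apply/asboolP; exists 1; rewrite ?oner_eq0 ?scale1r.
- by apply/asboolP/asboolP => -[c c0 e]; exists c^-1;
    rewrite ?invr_eq0 // e scalerA mulVf ?scale1r.
- move=> /asboolP[c c0 e] /asboolP[d d0 e']; apply/asboolP.
  by exists (c * d); rewrite ?mulf_neq0 // e e' scalerA.
Qed.
Canonical proportional_equivRel := EquivRelPack proportional_equiv.

Definition PGL : Type := {eq_quot proportional}.
HB.instance Definition _ := Choice.on PGL.
HB.instance Definition _ := EqQuotient.on PGL.

Definition to_PGL (g : GL) : PGL := \pi_PGL g.

Definition PGL_one : PGL := to_PGL GL_one.
Definition PGL_mul (x y : PGL) : PGL := to_PGL (GL_mul (repr x) (repr y)).
Definition PGL_inv (x : PGL) : PGL := to_PGL (GL_inv (repr x)).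
Definition PGL_tau (x : PGL) : PGL := to_PGL (GL_tr (GL_inv (repr x))).

Lemma to_PGLP (g h : GL) :
  to_PGL g = to_PGL h <-> exists2 c : k, c != 0 & GL_mx g = c *: GL_mx h.
Proof.
split=> [/eqP|e].
  by rewrite /to_PGL eqmodE => /asboolP.
by apply/eqP; rewrite /to_PGL eqmodE; apply/asboolP.
Qed.

Lemma to_PGLK (x : PGL) : to_PGL (repr x) = x.
Proof. exact: reprK. Qed.

Lemma to_PGL_repr (g : GL) :
  exists2 c : k, c != 0 & GL_mx (repr (to_PGL g)) = c *: GL_mx g.
Proof. by apply/to_PGLP; rewrite to_PGLK. Qed.

Lemma to_PGL_mul (g h : GL) : PGL_mul (to_PGL g) (to_PGL h) = to_PGL (GL_mul g h).
Proof.
apply/to_PGLP => /=.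
have [c c0 ->] := to_PGL_repr g; have [d d0 ->] := to_PGL_repr h.
exists (c * d); first by rewrite mulf_neq0.
by rewrite -scalemxAl -scalemxAr scalerA.
Qed.

Lemma to_PGL_inv (g : GL) : PGL_inv (to_PGL g) = to_PGL (GL_inv g).
Proof.
apply/to_PGLP => /=; have [c c0 ->] := to_PGL_repr g.
exists c^-1; first by rewrite invr_eq0.
by rewrite invmxZ // unitmxZ ?unitfE // (GL_unit g).
Qed.

Lemma to_PGL_tau (g : GL) : PGL_tau (to_PGL g) = to_PGL (GL_tr (GL_inv g)).
Proof.
apply/to_PGLP => /=; have [c c0 ->] := to_PGL_repr g.
exists c^-1; first by rewrite invr_eq0.
by rewrite invmxZ ?unitmxZ ?unitfE ?(GL_unit g) // linearZ.
Qed.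

Lemma PGL_mulA : associative PGL_mul.
Proof.
move=> x y z; rewrite -[x]to_PGLK -[y]to_PGLK -[z]to_PGLK !to_PGL_mul.
by congr to_PGL; apply/val_inj; rewrite /= mulmxA.
Qed.

Lemma PGL_mul1 : left_id PGL_one PGL_mul.
Proof.
move=> x; rewrite -[x]to_PGLK to_PGL_mul.
by congr to_PGL; apply/val_inj; rewrite /= mul1mx.
Qed.

Lemma PGL_mulr1 : right_id PGL_one PGL_mul.
Proof.
move=> x; rewrite -[x]to_PGLK to_PGL_mul.
by congr to_PGL; apply/val_inj; rewrite /= mulmx1.
Qed.

Lemma PGL_mulV : left_inverse PGL_one PGL_inv PGL_mul.
Proof.
move=> x; rewrite -[x]to_PGLK to_PGL_inv to_PGL_mul.
by congr to_PGL; apply/val_inj; rewrite /= mulVmx // (GL_unit (repr x)).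
Qed.

Lemma PGL_mulrV : right_inverse PGL_one PGL_inv PGL_mul.
Proof.
move=> x; rewrite -[x]to_PGLK to_PGL_inv to_PGL_mul.
by congr to_PGL; apply/val_inj; rewrite /= mulmxV // (GL_unit (repr x)).
Qed.

Lemma PGL_tauK : involutive PGL_tau.
Proof.
move=> x; rewrite -[x]to_PGLK !to_PGL_tau.
by congr to_PGL; apply/val_inj; rewrite /= trmx_inv trmxK invmxK.
Qed.

Lemma PGL_tauM : {morph PGL_tau : x y / PGL_mul x y}.
Proof.
move=> x y; rewrite -[x]to_PGLK -[y]to_PGLK !(to_PGL_mul, to_PGL_tau).
congr to_PGL; apply/val_inj; rewrite /= -trmx_mul; congr (_^T).
move: (GL_unit (repr x)) (GL_unit (repr y)) => ux uy.
have uxy : repr x *m repr y \in unitmx by rewrite unitmx_mul ux.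
apply: (can_inj (mulKmx uxy)).
by rewrite mulmxV // -mulmxA (mulmxA _ (invmx _)) mulmxV // mul1mx mulmxV.
Qed.

HB.instance Definition _ :=
  isGroup.Build PGL PGL_mulA PGL_mul1 PGL_mulr1 PGL_mulV PGL_mulrV.

(* [(h, b)] stands for [h tau^b]. *)
Definition Ptau : Type := (PGL * bool)%type.
HB.instance Definition _ := Choice.on Ptau.

Definition PGL_tau_pow (b : bool) (h : PGL) : PGL := if b then PGL_tau h else h.

Definition Ptau_one : Ptau := (1%g, false).
Definition Ptau_mul (x y : Ptau) : Ptau :=
  ((x.1 * PGL_tau_pow x.2 y.1)%g, x.2 (+) y.2).
Definition Ptau_inv (x : Ptau) : Ptau := (PGL_tau_pow x.2 (x.1^-1)%g, x.2).

Lemma PGL_tau_powM b : {morph PGL_tau_pow b : x y / (x * y)%g}.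
Proof. by case: b => // x y; apply: PGL_tauM. Qed.

Lemma PGL_tau_pow1 b : PGL_tau_pow b 1%g = 1%g.
Proof.
by apply: (mulgI (PGL_tau_pow b 1%g)); rewrite -PGL_tau_powM !mulg1.
Qed.

Lemma PGL_tau_pow_add b c h :
  PGL_tau_pow b (PGL_tau_pow c h) = PGL_tau_pow (b (+) c) h.
Proof. by case: b; case: c => //=; rewrite PGL_tauK. Qed.

Lemma Ptau_mulA : associative Ptau_mul.
Proof.
move=> [x b] [y c] [z d]; rewrite /Ptau_mul /= PGL_tau_powM PGL_tau_pow_add.
by rewrite mulgA addbA.
Qed.

Lemma Ptau_mul1 : left_id Ptau_one Ptau_mul.
Proof. by move=> [x b]; rewrite /Ptau_mul /= mul1g. Qed.

Lemma Ptau_mulr1 : right_id Ptau_one Ptau_mul.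
Proof. by move=> [x b]; rewrite /Ptau_mul /= PGL_tau_pow1 mulg1 addbF. Qed.

Lemma Ptau_mulV : left_inverse Ptau_one Ptau_inv Ptau_mul.
Proof.
by move=> [x b]; rewrite /Ptau_mul /= -PGL_tau_powM mulVg PGL_tau_pow1 addbb.
Qed.

Lemma Ptau_mulrV : right_inverse Ptau_one Ptau_inv Ptau_mul.
Proof.
by move=> [x b]; rewrite /Ptau_mul /= PGL_tau_pow_add addbb /= mulgV.
Qed.

HB.instance Definition _ :=
  isGroup.Build Ptau Ptau_mulA Ptau_mul1 Ptau_mulr1 Ptau_mulV Ptau_mulrV.

Definition Ptau_of_PGL (h : PGL) : Ptau := (h, false).
Definition tau : Ptau := (1%g, true).

Lemma tau_conj (h : PGL) :
  (tau * Ptau_of_PGL h * tau^-1)%g = Ptau_of_PGL (PGL_tau h).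
Proof.
rewrite /Ptau_of_PGL; congr (_, _).
change ((1 * PGL_tau h * PGL_tau_pow true (PGL_tau_pow true 1^-1))%g = PGL_tau h).
by rewrite PGL_tau_pow_add /= mul1g invg1 mulg1.
Qed.

(* Algebraic group structure: [GL_n] is open in [M_n], [PGL_n] is the quotient
   of [GL_n], and [P_{n,tau}] is the disjoint union of two copies of [PGL_n]. *)
Definition GL_space : funspace k := induced (X := affine_space k n n) GL_mx.
Definition PGL_space : funspace k := coinduced (X := GL_space) to_PGL.
Definition Ptau_space : funspace k := prod_funspace PGL_space (two_points k).

Definition conjugate_sets (S S' : set Ptau) : Prop :=
  exists g : Ptau, S' = [set (g * s * g^-1)%g | s in S].

End Groups.

Section SymplecticElement.
Variables (k : fieldType) (m n : nat) (e : (m + m)%N = n).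

Definition g0_mx : 'M[k]_n :=
  castmx (e, e) (block_mx 0 1%:M (- 1%:M) 0 : 'M[k]_(m + m)).

Fact g0_unit : g0_mx \in unitmx.
Proof.
rewrite /g0_mx; case: _ / e; rewrite castmx_id.
apply: (proj1 (mulmx1_unit (B := block_mx 0 (- 1%:M) 1%:M 0) _)).
rewrite mulmx_block !mul0mx !mulmx0 !mul1mx mulNmx mul1mx opprK.
by rewrite !add0r !addr0 scalar_mx_block.
Qed.

Definition g0 : PGL k n := to_PGL (MkGL g0_unit).

End SymplecticElement.

Section Actions.
Variables (k : fieldType) (n : nat) (X : funspace k).
Variable act : Ptau k n -> X -> X.

Record irreducible_Ptau_variety : Prop := {
  Ptau_variety : variety X;
  Ptau_irreducible : irreducible X;
  Ptau_act1 : forall x, act 1%g x = x;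
  Ptau_actM : forall g h x, act (g * h)%g x = act g (act h x);
  Ptau_act_morphism :
    @morphism k (prod_funspace (Ptau_space k n) X) X (fun gx => act gx.1 gx.2) }.

Definition stabilizer (x : X) : set (Ptau k n) := [set g | act g x = x].

Definition generically_free (H : set (Ptau k n)) : Prop :=
  in_general_position (fun x => H `&` stabilizer x = [set 1%g]).

Definition PGL_in_Ptau : set (Ptau k n) := range (@Ptau_of_PGL k n).

Definition subgroup (S : set (Ptau k n)) : Prop :=
  S 1%g /\ forall g h, S g -> S h -> S (g * h^-1)%g.

Definition stabilizer_in_general_position (S : set (Ptau k n)) : Prop :=
  subgroup S /\
  in_general_position (fun x => conjugate_sets S (stabilizer x)).

(* [k_n(X)], as the set of representatives of [PGL_n]-equivariant rational maps
   from [X] to [M_n]; elements of [k_n(X)] are classes for [rational_eq]. *)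
Definition kn : set (X -> 'M[k]_n) :=
  [set f : X -> 'M[k]_n | rational_map (Y := affine_space k n n) f /\
     forall g : GL k n, in_general_position (fun x =>
       f (act (Ptau_of_PGL (to_PGL g)) x) = g *m f x *m invmx g)].

Definition sigma_X (f : X -> 'M[k]_n) : X -> 'M[k]_n :=
  fun x => (f (act (tau k n) x))^T.

End Actions.

Section Algebras.
Variables (k : fieldType) (A : algType k).

Definition center : set A := [set z | forall a, z * a = a * z].

Definition simple : Prop :=
  forall I : set A, I 0 -> (forall a b, I a -> I b -> I (a - b)) ->
    (forall a b, I a -> I (b * a) /\ I (a * b)) -> I = [set 0] \/ I = setT.

Definition dim_over_center (d : nat) : Prop :=
  exists b : 'I_d -> A, forall a, exists! z : {ffun 'I_d -> A},
    (forall i, center (z i)) /\ a = \sum_(i < d) z i * b i.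

(* [F] is a subfield, containing [k], of the center. *)
Definition central_subfield (F : set A) : Prop :=
  [/\ F `<=` center, forall c : k, F (c *: 1),
      forall a b, F a -> F b -> F (a - b) /\ F (a * b) &
      forall a, F a -> a != 0 -> exists2 b, F b & a * b = 1].

Definition center_finitely_generated : Prop :=
  central_subfield center /\
  exists2 s : seq A, [set` s] `<=` center &
    forall F, central_subfield F -> [set` s] `<=` F -> F = center.

Definition central_simple (n : nat) : Prop :=
  [/\ simple, dim_over_center (n ^ 2)%N & center_finitely_generated].

Variable sigma : {linear A -> A}.

Definition involution : Prop :=
  (forall a b, sigma (a * b) = sigma b * sigma a) /\ involutive sigma.

Definition first_kind : Prop := forall z, center z -> sigma z = z.
Definition second_kind : Prop := ~ first_kind.

(* [rho] exhibits [L] as a splitting field of [A]: it maps the center to [L],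
   and makes [M_n(L)] the scalar extension of [A] from its center to [L]
   (for [A] central simple of degree [n], surjectivity is enough). *)
Definition splitting (n : nat) (L : fieldType) (rho : {rmorphism A -> 'M[L]_n}) :
    Prop :=
  (forall z, center z -> is_scalar_mx (rho z)) /\
  (forall m : 'M[L]_n, exists (r : nat) (c : 'I_r -> L) (a : 'I_r -> A),
     m = \sum_(i < r) c i *: rho (a i)).

(* Over some splitting field, [sigma] becomes the involution adjoint to a
   nondegenerate bilinear form whose Gram matrix satisfies [Q]. *)
Definition adjoint_to_form (n : nat)
    (Q : forall L : fieldType, 'M[L]_n -> Prop) : Prop :=
  exists (L : fieldType) (rho : {rmorphism A -> 'M[L]_n}) (B : 'M[L]_n),
    [/\ splitting rho, B \in unitmx, Q L B &
        forall a, rho (sigma a) = invmx B *m (rho a)^T *m B].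

Definition orthogonal_involution (n : nat) : Prop :=
  first_kind /\ @adjoint_to_form n (fun L B => B^T = B).

Definition symplectic_involution (n : nat) : Prop :=
  first_kind /\
  @adjoint_to_form n (fun L B => forall v : 'rV[L]_n, v *m B *m v^T = 0).

End Algebras.

(* [phi] chooses, for each [a], a representative of the rational map that
   corresponds to [a] under an isomorphism of [(A, sigma)] with
   [(k_n(X), sigma_X)], whose operations are pointwise. *)
Record isomorphic_to_kn (k : fieldType) (n : nat) (A : algType k)
    (sigma : A -> A) (X : funspace k) (act : Ptau k n -> X -> X)
    (phi : A -> X -> 'M[k]_n) : Prop := {
  iso_kn : forall a, kn act (phi a);
  iso_inj : forall a b, rational_eq (phi a) (phi b) -> a = b;
  iso_surj : forall f, kn act f -> exists a, rational_eq (phi a) f;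
  iso_one : in_general_position (fun x => phi 1 x = 1%:M);
  iso_add : forall a b, in_general_position (fun x =>
    phi (a + b) x = phi a x + phi b x);
  iso_scale : forall (c : k) a, in_general_position (fun x =>
    phi (c *: a) x = c *: phi a x);
  iso_mul : forall a b, in_general_position (fun x =>
    phi (a * b) x = phi a x *m phi b x);
  iso_sigma : forall a, rational_eq (phi (sigma a)) (sigma_X act (phi a)) }.

Definition associated_variety (k : fieldType) (n : nat) (A : algType k)
    (sigma : A -> A) (X : funspace k) (act : Ptau k n -> X -> X) : Prop :=
  [/\ irreducible_Ptau_variety act,
      generically_free act (@PGL_in_Ptau k n) &
      exists phi : A -> X -> 'M[k]_n,
        isomorphic_to_kn sigma act phi].

(* Main.v *)
(* Work in the function field K of X, and let rho : A -> M_n(K) be the inclusion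
   of k_n(X); by Artin-Whaples a basis b of A over its center Z = K^PGL_n is a
   basis of M_n(K) over K. Free action of PGL_n makes the generic stabilizer
   trivial or {1, S tau} with S^T = S or S^T = -S.

   If sigma moves z in Z, the invariant function z separates x from every
   h tau x, so the stabilizer is trivial. If sigma is the identity on Z, it
   extends to K-linear M_n(K), and Skolem-Noether gives B over K with
   sigma(a) = B^-1 a^T B and B^T = B or B^T = -B; evaluated at x this reads
   a(tau x) = h a(x) h^-1 with h = B(x)^T, for all a in A. Hence x and
   h^-1 tau x have the same image under all of A, and they coincide because K is
   generated by Z and the entries of rho(b): along an orbit, g is a linear
   function of the values of b at g x up to a scalar, so any u in K satisfies
   u(g x) Q(b(g x)) = P(b(g x)) with P, Q polynomials over K, and by semilinear
   descent one may take P, Q over K^PGL_n. So S tau with S = h^-1 fixes x.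

   The sign of B^T = +-B does not depend on the splitting field, as the trace
   of sigma over Z is +-n. *)
Require Import Defs.
From HB Require Import structures.
From mathcomp Require Import all_boot all_order all_algebra.
From mathcomp Require Import generic_quotient.
From mathcomp Require Import boolp classical_sets filter topology.
From mathcomp Require Import mpoly.

Set Implicit Arguments.
Unset Strict Implicit.
Unset Printing Implicit Defensive.

Import GRing.Theory.
Local Open Scope classical_set_scope.
Local Open Scope ring_scope.

(** Identities in $k_n(X)$ and in K, and equivariance under each fixed group element, hold only on
    dense open sets, whereas the element h = B(x)^T varies with x: nothing puts h^-1 tau x into a
    prescribed dense set. Two devices deal with this. An identity between functions regular at a
    point extends from a dense set to that point, so invariance may be used at a varying group
    element once regularity is known at both ends. And before x and y are compared, a single g in
    PGL_n moves both of them into a given open set; equality of g x and g y then gives x = y.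

    Only pairs y = h tau x are ever compared. On such pairs an invariant of PGL_n takes equal values
    because it is also fixed by tau, so no theorem on the separation of orbits by invariants is
    required.

    The linear formula that recovers g from the values of b at g x carries a scalar factor that may
    vanish for some g. The fractions are therefore multiplied by a determinant, and the relation to
    be descended is arranged to read 0 = 0 at such g. *)

(** * Topologies given by a subbase, and the Zariski topology on matrices *)

Section GeneratedTopology.
Variables (T : choiceType) (B : set (set T)).

Lemma generated_open (b : set T) : B b -> open (b : set (generated_topology B)).
Proof.
move=> Bb; exists [set b]; last by rewrite bigcup_set1.
by move=> _ ->; apply: (@finI_from1 _ _ _ id).
Qed.

Lemma generated_open_ind (P : set T -> Prop) :
  P setT -> (forall U V, P U -> P V -> P (U `&` V)) ->
  (forall F : set (set T), (forall U, F U -> P U) -> P (\bigcup_(U in F) U)) ->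
  (forall b, B b -> P b) ->
  forall U : set (generated_topology B), open U -> P U.
Proof.
move=> PT PI PU PB U [F FB <-]; apply: PU => V /FB [D DB <-].
rewrite bigcap_fset big_seq; elim/big_ind: _ => // b /DB; rewrite inE.
exact: PB.
Qed.

(** [N] plays the part of the neighbourhood filter of [t]: an open set around [t] contains a finite
    intersection of subbasic sets around [t], so only these have to be checked. *)
Lemma generated_open_nbhs (t : T) (N : set_system T) :
  N setT -> (forall U V, N U -> N V -> N (U `&` V)) ->
  (forall U V, U `<=` V -> N U -> N V) ->
  (forall b, B b -> b t -> N b) ->
  forall U : set (generated_topology B), open U -> U t -> N U.
Proof.
move=> NT NI NS NB; apply: generated_open_ind => //.
- by move=> U V NU NV [/NU ? /NV ?]; apply: NI.
- move=> F NF [U FU Ut]; apply: (NS U); last exact: (NF U).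
  by move=> x Ux; exists U.
Qed.

End GeneratedTopology.

Section InducedTopology.
Variable k : fieldType.

Lemma induced_openP (X : funspace k) (T : choiceType) (i : T -> X)
    (V : set (induced i)) :
  open V <-> exists2 U : set X, open U & V = i @^-1` U.
Proof.
split; last by move=> UV; apply: generated_open.
move: V; apply: generated_open_ind => //.
- by exists setT => //; exact: openT.
- move=> _ _ [U oU ->] [V oV ->]; exists (U `&` V) => //; exact: openI.
- move=> F FP; exists (\bigcup_(U in [set U | open U /\ F (i @^-1` U)]) U).
    by apply: bigcup_open => U [].
  apply/seteqP; split=> [t [V FV Vt]|t [U [_ FU] Ut]].
    by have [U oU eV] := FP V FV; subst V; exists U.
  by exists (i @^-1` U).
Qed.

Lemma coinduced_openP (X : funspace k) (T : choiceType) (p : X -> T)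
    (V : set (coinduced p)) :
  open V <-> open (p @^-1` V).
Proof.
split; last by move=> oV; apply: generated_open.
move: V; apply: generated_open_ind => //.
- by rewrite preimage_setT; exact: openT.
- by move=> U V oU oV; rewrite preimage_setI; exact: openI.
- by move=> F FP; rewrite preimage_bigcup; apply: bigcup_open.
Qed.

Lemma sub_open_image (X : funspace k) (U : set X) (V : set (sub_funspace U)) :
  open U -> open V -> open [set val z | z in V].
Proof.
move=> oU /induced_openP[W oW ->].
suff -> : [set val z | z in (fun z : U => val z) @^-1` W] = U `&` W.
  exact: openI.
apply/seteqP; split=> [_ [z Wz <-]|x [Ux Wx]]; first by split=> //; apply: set_valP.
by exists (SigSub (mem_set Ux)).
Qed.

Lemma polyvalD (a b : nat) p q (x : 'M[k]_(a, b)) :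
  polyval (p + q) x = polyval p x + polyval q x.
Proof. exact: mevalD. Qed.

Lemma polyvalM (a b : nat) p q (x : 'M[k]_(a, b)) :
  polyval (p * q) x = polyval p x * polyval q x.
Proof. exact: mevalM. Qed.

Lemma polyval1 (a b : nat) (x : 'M[k]_(a, b)) : polyval 1 x = 1.
Proof. exact: meval1. Qed.

Lemma polyvalX (a b : nat) i j (x : 'M[k]_(a, b)) :
  polyval 'X_(mxvec_index i j) x = x i j.
Proof. by rewrite /polyval mevalXU mxvecE. Qed.

(** Nonvanishing loci of single polynomials form a basis, since the loci of [p] and [q] meet in that
    of [p * q]. *)
Lemma affine_open_nbhs (a b : nat) (O : set (affine_space k a b)) x :
  open O -> O x ->
  exists p, polyval p x != 0 /\ forall y, polyval p y != 0 -> O y.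
Proof.
move=> oO Ox; pose N := [set V : set 'M[k]_(a, b) |
  exists p, polyval p x != 0 /\ forall y, polyval p y != 0 -> V y].
apply: (generated_open_nbhs (N := N) _ _ _ _ oO Ox).
- exists 1; split=> //; rewrite polyval1; exact: oner_neq0.
- move=> U V [p [px pU]] [q [qx qV]]; exists (p * q).
  rewrite polyvalM mulf_neq0 //; split=> // y.
  by rewrite polyvalM mulf_eq0 negb_or => /andP[/pU ? /qV].
- by move=> U V UV [p [px pU]]; exists p; split=> // y /pU /UV.
- by move=> _ [p ->] /= px; exists p.
Qed.

Lemma affine_open_D (a b : nat) p :
  open ([set x | polyval p x != 0] : set (affine_space k a b)).
Proof. by apply: generated_open; exists p. Qed.

End InducedTopology.

(** * Regular functions and rational maps *)

Section RegularFunctions.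
Variables (k : fieldType) (X : funspace k) (varX : variety X).

Definition local_fraction (N : nat) (V : set X) (c : X -> 'M[k]_(1, N))
    (h : X -> k) : Prop :=
  forall x, V x -> exists p q, polyval q (c x) != 0 /\
    forall y, V y -> polyval q (c y) != 0 -> h y = polyval p (c y) / polyval q (c y).

(** Replaces an affine piece of the cover, with its subtypes, by an injection [c] defined on all of
    [X]; regularity inside [U] then becomes a statement about polynomials in [c]. *)
Lemma affine_chart (x0 : X) :
  exists (U : set X) (N : nat) (c : X -> 'M[k]_(1, N)),
  [/\ open U, U x0, forall x y, U x -> U y -> c x = c y -> x = y,
      forall p, open [set x | U x /\ polyval p (c x) != 0] &
      forall (V : set X) (h : X -> k), open V -> V `<=` U ->
        (regular X V h <-> local_fraction V c h)].
Proof.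
have [r [Us [oU cU aU]]] := affine_cover varX.
have [i Ux0] := cU x0; move: (Us i) (oU i) Ux0 (aU i) => U {r Us oU cU aU i}.
move=> oU Ux0 [N [Z [_ [f [g [[fc fr] [gc gr] fK gK]]]]]].
pose inU x (Ux : U x) : sub_funspace U := SigSub (mem_set Ux).
(* The value 0 outside [U] is arbitrary; every later clause stays inside [U]. *)
pose c x : 'M[k]_(1, N) :=
  if pselect (U x) is left Ux then val (f (inU x Ux)) else 0.
have cE x (Ux : U x) : c x = val (f (inU x Ux)).
  rewrite /c; case: pselect => [Ux'|//]; congr (val (f _)); exact: val_inj.
have cvE (z : sub_funspace U) : c (val z) = val (f z).
  rewrite (cE _ (set_valP z)); congr (val (f _)); exact: val_inj.
exists U, N, c; split=> //.
- move=> x y Ux Uy; rewrite !cE => /val_inj /(congr1 g).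
  by rewrite !fK => /(congr1 val).
- move=> p.
  pose W : set (sub_funspace Z) := (fun z : Z => val z) @^-1` [set y | polyval p y != 0].
  have oW : open W by apply/induced_openP; exists [set y | polyval p y != 0] => //; exact: affine_open_D.
  have oV : open (f @^-1` W) by move/continuousP: fc; apply.
  have := sub_open_image oU oV; congr open; apply/seteqP; split=> [_ [z Wz <-]|x [Ux px]].
    by split; [exact: set_valP|rewrite cvE].
  by exists (inU x Ux) => //; rewrite /W /= -cE.
move=> V h oV VU.
pose V' : set (sub_funspace U) := (fun z : U => val z) @^-1` V.
have oV' : open V' by apply/induced_openP; exists V.
split=> [rh|rh].
- have rh' : regular (sub_funspace U) V' (h \o (fun z : U => val z)).
    by move=> t V't; exists V, h.
  have rz := gr _ _ oV' rh'.
  move=> x Vx; have Ux := VU _ Vx; pose t := f (inU x Ux).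
  have [|O [r [oO rr Ot rE]]] := rz t; first by rewrite /= fK.
  have [p [q [qt pqE]]] := rr _ Ot.
  have [p0 [p0t p0O]] := affine_open_nbhs oO Ot.
  (* The common factor [p0] shrinks the nonvanishing locus of the denominator into [O], where both
     local expressions are available. *)
  exists (p * p0), (q * p0).
  rewrite polyvalM mulf_neq0 ?cE //; split=> // y Vy.
  rewrite !polyvalM mulf_eq0 negb_or => /andP[qy p0y].
  have Uy := VU _ Vy; have := rE (f (inU y Uy)).
  rewrite /= fK /= => -> //; last by apply: p0O; rewrite -cE.
  rewrite -cE pqE //; last by apply: p0O.
  by rewrite invfM mulrACA divff // mulr1.
- have rz : regular (sub_funspace Z) (g @^-1` V') (h \o (fun z : U => val z) \o g).
    move=> t Vt; have [p [q [qt pqE]]] := rh _ Vt.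
    rewrite cvE gK in qt.
    exists [set y | polyval q y != 0], (fun y => polyval p y / polyval q y); split=> //.
    - exact: affine_open_D.
    - by move=> y qy; exists p, q.
    - by move=> s Vs qs; rewrite /= pqE // ?cvE gK.
  have oZ : open (g @^-1` V') by move/continuousP: gc; apply.
  have := fr _ _ oZ rz.
  have -> : f @^-1` (g @^-1` V') = V' by apply/seteqP; split=> t /=; rewrite fK.
  have -> : h \o (fun z : U => val z) \o g \o f = h \o (fun z : U => val z).
    by apply/funext => t /=; rewrite fK.
  move=> rU; apply: (regular_glue varX) => // x Vx.
  have [|W [s [oW rs Wx sE]]] := rU (inU x (VU _ Vx)); first exact: Vx.
  exists (V `&` W); split=> //; [exact: openI|].
  apply: (regular_restrict varX oW _ _ rs); [exact: openI|by move=> y []|].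
  by move=> y [Vy Wy]; rewrite -(sE (inU y (VU _ Vy))).
Qed.

Definition reg_at (x : X) (f : X -> k) : Prop :=
  exists V : set X, [/\ open V, V x & regular X V f].

Lemma regularP (V : set X) f :
  open V -> (regular X V f <-> forall x, V x -> reg_at x f).
Proof.
move=> oV; split=> [rf x Vx|rf]; first by exists V.
apply: (regular_glue varX) => // x /[dup] Vx /rf [W [oW Wx rW]].
have oVW : open (V `&` W) by exact: openI.
exists (V `&` W); split=> //.
by apply: (regular_restrict varX oW oVW _ rW) => // ? [].
Qed.

Lemma reg_at_near x f : reg_at x f -> \forall y \near x, reg_at y f.
Proof.
move=> [V [oV Vx rV]]; apply: (@filterS _ (nbhs x) _ V).
  by move=> y Vy; exists V.
by apply: open_nbhs_nbhs.
Qed.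

Lemma eq_reg_at x f g : (\forall y \near x, f y = g y) -> reg_at x f -> reg_at x g.
Proof.
rewrite {1}/prop_near1 {1}nbhsE => -[W [oW Wx] Wfg] [V [oV Vx rV]]; have oVW : open (V `&` W) by exact: openI.
exists (V `&` W); split=> //.
apply: (regular_restrict varX oV oVW _ rV); first by move=> ? [].
by move=> y [_ /Wfg].
Qed.

(** A common chart and a common denominator for two functions regular at [x0]. The last clause leads
    back from fractions to regularity, so closure under sums, products and inverses reduces to
    identities between fractions. *)
Lemma reg_at_fractions x0 (f1 f2 : X -> k) : reg_at x0 f1 -> reg_at x0 f2 ->
  exists (V : set X) (N : nat) (c : X -> 'M[k]_(1, N)) p1 p2 q,
  [/\ open V, V x0, forall p, open [set x | V x /\ polyval p (c x) != 0],
      forall x, V x -> [/\ polyval q (c x) != 0,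
        f1 x = polyval p1 (c x) / polyval q (c x) &
        f2 x = polyval p2 (c x) / polyval q (c x)] &
      forall (h : X -> k) p q', polyval q' (c x0) != 0 ->
         (forall x, V x -> polyval q' (c x) != 0 ->
            h x = polyval p (c x) / polyval q' (c x)) ->
         reg_at x0 h].
Proof.
move=> [V1 [oV1 V1x r1]] [V2 [oV2 V2x r2]].
have [U [N [c [oU Ux0 inj oD rE]]]] := affine_chart x0.
pose W := V1 `&` V2 `&` U.
have oW : open W by apply: openI => //; exact: openI.
have WU : W `<=` U by move=> ? [].
have Wx0 : W x0 by split.
have rW1 : regular X W f1.
  by apply: (regular_restrict varX oV1 _ _ r1) => // ? [[]].
have rW2 : regular X W f2.
  by apply: (regular_restrict varX oV2 _ _ r2) => // ? [[]].
have [p1 [q1 [q1x pq1]]] := (rE _ _ oW WU).1 rW1 _ Wx0.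
have [p2 [q2 [q2x pq2]]] := (rE _ _ oW WU).1 rW2 _ Wx0.
have oDW (V : set X) p : open V -> V `<=` U -> open [set x | V x /\ polyval p (c x) != 0].
  move=> oV VU; have := openI oV (oD p); congr open.
  by apply/seteqP; split=> x [? []] //; split=> //; [split=> //; exact: VU].
exists [set x | W x /\ polyval (q1 * q2) (c x) != 0], N, c, (p1 * q2), (p2 * q1), (q1 * q2).
have VU : [set x | W x /\ polyval (q1 * q2) (c x) != 0] `<=` U by move=> x [[]].
have oV : open [set x | W x /\ polyval (q1 * q2) (c x) != 0] by exact: oDW.
have Vx0 : W x0 /\ polyval (q1 * q2) (c x0) != 0.
  by split=> //; rewrite polyvalM mulf_neq0.
split=> //.
- by move=> p; apply: oDW.
- move=> x [Wx q12]; split=> //; move: q12; rewrite !polyvalM.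
    rewrite mulf_eq0 negb_or => /andP[q1' q2']; rewrite pq1 // invfM mulrACA divff //.
    by rewrite mulr1.
  rewrite mulf_eq0 negb_or => /andP[q1' q2']; rewrite pq2 // [polyval q1 _ * _]mulrC.
  by rewrite invfM mulrACA divff ?mulr1.
- move=> h p q qx0 hE.
  pose V' := [set x | (W x /\ polyval (q1 * q2) (c x) != 0) /\ polyval q (c x) != 0].
  have V'U : V' `<=` U by move=> x [/VU].
  have oV' : open V' by exact: oDW.
  exists V'; split=> //; apply/(rE _ _ oV' V'U) => x [Vx qx]; exists p, q.
  by split=> // y [Vy _]; exact: hE.
Qed.

Lemma reg_at_cst x c : reg_at x (fun _ => c).
Proof.
have [U [N [C [oU Ux0 inj oD rE]]]] := affine_chart x.
exists U; split=> //; apply/(rE _ _ oU) => // y _; exists c%:MP, 1.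
rewrite /polyval meval1 oner_neq0; split=> // z _ _.
by rewrite mevalC meval1 divr1.
Qed.

Lemma reg_atD x f g : reg_at x f -> reg_at x g -> reg_at x (fun y => f y + g y).
Proof.
move=> rf rg; have [V [N [c [p1 [p2 [q [oV Vx oD fg hP]]]]]]] := reg_at_fractions rf rg.
have [qx _ _] := fg _ Vx.
apply: (hP _ (p1 + p2) q) => // y /fg[qy -> ->].
by rewrite polyvalD mulrDl.
Qed.

Lemma reg_atM x f g : reg_at x f -> reg_at x g -> reg_at x (fun y => f y * g y).
Proof.
move=> rf rg; have [V [N [c [p1 [p2 [q [oV Vx oD fg hP]]]]]]] := reg_at_fractions rf rg.
have [qx _ _] := fg _ Vx.
apply: (hP _ (p1 * p2) (q * q)); first by rewrite polyvalM mulf_neq0.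
by move=> y /fg[qy -> ->]; rewrite !polyvalM invfM mulrACA.
Qed.

Lemma reg_at_neq0 x f : reg_at x f -> f x != 0 -> \forall y \near x, f y != 0.
Proof.
move=> rf fx; have [V [N [c [p1 [p2 [q [oV Vx oD fg hP]]]]]]] := reg_at_fractions rf rf.
apply: (@filterS _ (nbhs x) _ [set y | V y /\ polyval p1 (c y) != 0]).
  by move=> y [Vy py]; have [qy -> _] := fg _ Vy; rewrite mulf_neq0 ?invr_eq0.
apply: open_nbhs_nbhs; split=> //; split=> //.
by move: fx; have [qy -> _] := fg _ Vx; rewrite mulf_eq0 negb_or => /andP[].
Qed.

Lemma reg_atV x f : reg_at x f -> f x != 0 -> reg_at x (fun y => (f y)^-1).
Proof.
move=> rf fx; have [V [N [c [p1 [p2 [q [oV Vx oD fg hP]]]]]]] := reg_at_fractions rf rf.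
have px : polyval p1 (c x) != 0.
  by move: fx; have [qy -> _] := fg _ Vx; rewrite mulf_eq0 negb_or => /andP[].
by apply: (hP _ q p1) => // y /fg[qy -> _] _; rewrite invfM invrK mulrC.
Qed.

Lemma reg_at_sum (I : Type) (r : seq I) (P : pred I) x (f : I -> X -> k) :
  (forall i, reg_at x (f i)) -> reg_at x (fun y => \sum_(i <- r | P i) f i y).
Proof.
move=> rf; elim: r => [|i r IH].
  have -> : (fun y => \sum_(i <- [::] | P i) f i y) = fun=> 0.
    by apply/funext => y; rewrite big_nil.
  exact: reg_at_cst.
have -> : (fun y => \sum_(j <- i :: r | P j) f j y) =
    fun y => (if P i then f i y else 0) + \sum_(j <- r | P j) f j y.
  by apply/funext => y; rewrite big_cons; case: (P i); rewrite ?add0r.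
by apply: reg_atD => //; case: (P i) => //; exact: reg_at_cst.
Qed.

Lemma reg_at_prod (I : Type) (r : seq I) (P : pred I) x (f : I -> X -> k) :
  (forall i, reg_at x (f i)) -> reg_at x (fun y => \prod_(i <- r | P i) f i y).
Proof.
move=> rf; elim: r => [|i r IH].
  have -> : (fun y => \prod_(i <- [::] | P i) f i y) = fun=> 1.
    by apply/funext => y; rewrite big_nil.
  exact: reg_at_cst.
have -> : (fun y => \prod_(j <- i :: r | P j) f j y) =
    fun y => (if P i then f i y else 1) * \prod_(j <- r | P j) f j y.
  by apply/funext => y; rewrite big_cons; case: (P i); rewrite ?mul1r.
by apply: reg_atM => //; case: (P i) => //; exact: reg_at_cst.
Qed.

Lemma reg_at_polyval (a b : nat) x (f : X -> 'M[k]_(a, b)) p :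
  (forall i j, reg_at x (fun y => f y i j)) -> reg_at x (fun y => polyval p (f y)).
Proof.
move=> rf.
have -> : (fun y => polyval p (f y)) = fun y => \sum_(m <- msupp p) p@_m *
    \prod_(i < a * b) \prod_(l < m i) mxvec (f y) ord0 i.
  apply/funext => y; rewrite /polyval mevalE; apply: eq_bigr => m _.
  by congr (_ * _); apply: eq_bigr => i _; rewrite prodr_const card_ord.
apply: reg_at_sum => m; apply: reg_atM; first exact: reg_at_cst.
apply: reg_at_prod => i; apply: reg_at_prod => _.
by case/mxvec_indexP: i => i j; under eq_fun do rewrite mxvecE.
Qed.

(** The coordinates of an affine chart; equality of two points will be tested on these finitely many
    rational functions. *)
Lemma separating_chart (x0 : X) :
  exists (U : set X) (N : nat) (c : 'I_N -> X -> k),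
  [/\ open U, U x0, forall x i, U x -> reg_at x (c i) &
      forall x y, U x -> U y -> (forall i, c i x = c i y) -> x = y].
Proof.
have [U [N [c [oU Ux0 inj oD rE]]]] := affine_chart x0.
exists U, N, (fun i x => c x ord0 i); split=> //.
  move=> x i Ux; exists U; split=> //; apply/(rE _ _ oU) => // y _.
  exists 'X_(mxvec_index ord0 i), 1; rewrite polyval1 oner_neq0; split=> // z _ _.
  by rewrite polyvalX polyval1 divr1.
by move=> x y Ux Uy cxy; apply: inj => //; apply/rowP => i; exact: cxy.
Qed.

End RegularFunctions.

Section GeneralPosition.
Variables (k : fieldType) (X : funspace k).

Global Instance in_general_position_filter : Filter (@in_general_position k X).
Proof.
split.
- by exists setT; split=> //; [exact: openT|move=> O O0 _; rewrite setIT].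
- move=> P Q [U [oU dU UP]] [V [oV dV VQ]]; exists (U `&` V); split.
  + exact: openI.
  + by move=> O O0 oO; rewrite setIA; apply: dV; [apply: dU|apply: openI].
  + by move=> x [/UP ? /VQ].
- by move=> P Q PQ [U [oU dU UP]]; exists U; split=> // x /UP /PQ.
Qed.

Lemma general_position_ex (P : X -> Prop) :
  (exists x : X, True) -> in_general_position P -> exists x, P x.
Proof.
move=> [x _] [U [oU dU UP]]; have [|y [_ /UP]] := dU setT _ openT; first by exists x.
by exists y.
Qed.

Lemma general_position_ex2 (P Q : X -> Prop) : (exists x : X, True) ->
  in_general_position P -> in_general_position Q -> exists x, P x /\ Q x.
Proof.
move=> X0 gP gQ; apply: (general_position_ex X0).
by apply: filterS2 gP gQ => x.
Qed.

Lemma general_position_open (U : set X) :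
  irreducible X -> open U -> U !=set0 -> in_general_position U.
Proof.
by move=> [_ irr] oU U0; exists U; split=> // O O0 oO; apply: irr.
Qed.

Lemma general_position_openP (P : X -> Prop) : in_general_position P ->
  exists U : set X, [/\ open U, in_general_position U & forall x, U x -> P x].
Proof. by move=> [U [oU dU UP]]; exists U; split=> //; exists U. Qed.

Lemma general_position_preimage (s t : X -> X) (P : X -> Prop) :
  continuous s -> continuous t -> cancel s t -> cancel t s ->
  in_general_position P -> in_general_position (fun x => P (s x)).
Proof.
move=> /continuousP cs /continuousP ct st ts [U [oU dU UP]].
exists (s @^-1` U); split; [exact: cs| |by move=> x /UP].
move=> O [y Oy] oO; have [||z [Oz Uz]] := dU (t @^-1` O).
- by exists (s y); rewrite /preimage /= st.
- exact: ct.
- by exists (t z); split=> //; rewrite /preimage /= ts.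
Qed.

Definition rational (f : X -> k) : Prop := in_general_position (fun x => reg_at x f).

Hypothesis varX : variety X.

(** A nonzero value at a point of regularity persists on a neighbourhood, which meets every dense
    set. This is how generic identities reach individual points. *)
Lemma reg_at_eq0 x (f : X -> k) :
  reg_at x f -> in_general_position (fun y => f y = 0) -> f x = 0.
Proof.
move=> rf [U [oU dU U0]]; apply/eqP/negPn/negP => /(reg_at_neq0 varX rf).
rewrite /prop_near1 nbhsE => -[W [oW Wx] W0].
have [|y [/W0/eqP + /U0]] := dU W _ oW; first by exists x.
by [].
Qed.

Lemma reg_at_eq x (f g : X -> k) : reg_at x f -> reg_at x g ->
  in_general_position (fun y => f y = g y) -> f x = g x.
Proof.
move=> rf rg fg; apply/eqP; rewrite -subr_eq0; apply/eqP.
have E y : f y - g y = f y + -1 * g y by rewrite mulN1r.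
rewrite E; apply: (@reg_at_eq0 x (fun y => f y + -1 * g y)).
  by apply: reg_atD => //; apply: reg_atM => //; exact: reg_at_cst.
by apply: filterS fg => y fgy; rewrite -E fgy subrr.
Qed.

Lemma rational_cst c : rational (fun _ => c).
Proof. by apply: filterE => x; exact: reg_at_cst. Qed.

Lemma rationalD f g : rational f -> rational g -> rational (fun x => f x + g x).
Proof. by apply: filterS2 => x; exact: reg_atD. Qed.

Lemma rationalM f g : rational f -> rational g -> rational (fun x => f x * g x).
Proof. by apply: filterS2 => x; exact: reg_atM. Qed.

(** One nonzero value at a point of regularity gives a nonempty open set of nonzero values, dense by
    irreducibility. Hence nonzero germs are invertible. *)
Lemma rational_zero_or_neq0 f : irreducible X -> rational f ->
  in_general_position (fun x => f x = 0) \/ in_general_position (fun x => f x != 0).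
Proof.
move=> irrX rf; have [[x [rx fx]]|n0] := pselect (exists x, reg_at x f /\ f x != 0).
  right; have := reg_at_neq0 varX rx fx; rewrite /prop_near1 nbhsE => -[W [oW Wx] W0].
  apply: filterS W0 _; apply: general_position_open => //; by exists x.
left; apply: filterS rf => x rx; apply/eqP/negPn/negP => fx; apply: n0; by exists x.
Qed.

Lemma rationalV f : irreducible X -> rational f -> rational (fun x => (f x)^-1).
Proof.
move=> irrX rf; have [f0|] := rational_zero_or_neq0 irrX rf; last first.
  by apply: filterS2 rf => x rx fx; exact: reg_atV.
(* A generically zero [f] has generically zero inverse, by the convention [0^-1 = 0]. *)
have [U [oU gU U0]] := general_position_openP f0.
apply: filterS gU => x Ux; apply: eq_reg_at (reg_at_cst varX x 0) => //.
apply: (@filterS _ (nbhs x) _ U); last exact: open_nbhs_nbhs.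
by move=> y /U0 ->; rewrite invr0.
Qed.

Lemma rational_map_entries (a b : nat) (f : X -> 'M[k]_(a, b)) :
  rational_map (Y := affine_space k a b) f ->
  in_general_position (fun x => forall i j, reg_at x (fun y => f y i j)).
Proof.
move=> [U [oU dU [_ fr]]]; exists U; split=> // x Ux i j.
have rij : regular (affine_space k a b) setT (fun y : 'M[k]_(a, b) => y i j).
  move=> y _; exists 'X_(mxvec_index i j), 1; rewrite polyval1 oner_neq0; split=> // z _ _.
  by rewrite polyvalX polyval1 divr1.
have /(_ (SigSub (mem_set Ux)) I) := fr _ _ openT rij.
move=> [W [g [oW rg Wx fg]]]; have rxg : reg_at x g by exists W.
apply: eq_reg_at rxg => //; apply: (@filterS _ (nbhs x) _ (U `&` W)).
  by move=> y [Uy Wy]; rewrite -(fg (SigSub (mem_set Uy))).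
by apply: open_nbhs_nbhs; split=> //; exact: openI.
Qed.

Lemma rational_map_of_entries (a b : nat) (f : X -> 'M[k]_(a, b)) :
  in_general_position (fun x => forall i j, reg_at x (fun y => f y i j)) ->
  rational_map (Y := affine_space k a b) f.
Proof.
move=> [U [oU dU Ur]]; exists U; split=> //.
have oV (V : set (affine_space k a b)) : open V -> open [set x | U x /\ V (f x)].
  move=> oV; rewrite openE => x [Ux Vx].
  have [p [px pV]] := affine_open_nbhs oV Vx.
  have : \forall y \near x, polyval p (f y) != 0.
    by apply: reg_at_neq0 => //; apply: reg_at_polyval => //; exact: Ur.
  have : nbhs x U by exact: open_nbhs_nbhs.
  by apply: filterS2 => y Uy /pV.
split.
  apply/continuousP => V /oV oV'; apply/induced_openP; exists [set x | U x /\ V (f x)] => //.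
  apply/seteqP; split=> [z Vz|z [_]] //; split=> //; exact: set_valP.
move=> V h oV' rh t Vt; exists [set x | U x /\ V (f x)], (h \o f).
split=> //; [exact: oV| |by split=> //; exact: set_valP].
apply/regularP => //; first exact: oV.
move=> x [Ux Vx]; have [p [q [qx pqE]]] := rh _ Vx.
apply: (@eq_reg_at _ _ varX _ (fun y => polyval p (f y) * (polyval q (f y))^-1)).
  have : \forall y \near x, polyval q (f y) != 0.
    by apply: reg_at_neq0 => //; apply: reg_at_polyval => //; exact: Ur.
  have : nbhs x [set x | U x /\ V (f x)] by apply: open_nbhs_nbhs; split=> //; exact: oV.
  by apply: filterS2 => y [Uy Vy] qy; rewrite /= pqE.
apply: reg_atM => //; first by apply: reg_at_polyval => //; exact: Ur.
by apply: reg_atV => //; apply: reg_at_polyval => //; exact: Ur.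
Qed.

End GeneralPosition.

(** * Local fractions along a parametrisation *)

Section LocalFractions.
Variables (k : fieldType) (I : Type) (C : (I -> k) -> Prop) (i0 : I).

Record function_algebra : Prop := {
  fun_alg_cst : forall c, C (fun _ => c);
  fun_algD : forall f g, C f -> C g -> C (fun i => f i + g i);
  fun_algM : forall f g, C f -> C g -> C (fun i => f i * g i) }.

Hypothesis algC : function_algebra.

Lemma fun_alg_sum (J : Type) (r : seq J) (P : pred J) (f : J -> I -> k) :
  (forall j, C (f j)) -> C (fun i => \sum_(j <- r | P j) f j i).
Proof.
move=> Cf; elim: r => [|j r IH].
  by under eq_fun do rewrite big_nil; exact: fun_alg_cst.
under eq_fun do rewrite big_cons; case: (P j) => //.
exact: fun_algD.
Qed.

Lemma fun_alg_prod (J : Type) (r : seq J) (P : pred J) (f : J -> I -> k) :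
  (forall j, C (f j)) -> C (fun i => \prod_(j <- r | P j) f j i).
Proof.
move=> Cf; elim: r => [|j r IH].
  by under eq_fun do rewrite big_nil; exact: fun_alg_cst.
under eq_fun do rewrite big_cons; case: (P j) => //.
exact: fun_algM.
Qed.

Lemma fun_alg_polyval (a b : nat) (f : I -> 'M[k]_(a, b)) p :
  (forall r s, C (fun i => f i r s)) -> C (fun i => polyval p (f i)).
Proof.
move=> Cf.
have -> : (fun y => polyval p (f y)) = fun y => \sum_(m <- msupp p) p@_m *
    \prod_(i < a * b) \prod_(l < m i) mxvec (f y) ord0 i.
  apply/funext => y; rewrite /polyval mevalE; apply: eq_bigr => m _.
  by congr (_ * _); apply: eq_bigr => i _; rewrite prodr_const card_ord.
apply: fun_alg_sum => m; apply: fun_algM => //; first exact: fun_alg_cst.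
apply: fun_alg_prod => i; apply: fun_alg_prod => _.
by case/mxvec_indexP: i => i j; under eq_fun do rewrite mxvecE.
Qed.

Lemma fun_alg_det n (f : I -> 'M[k]_n) :
  (forall r s, C (fun i => f i r s)) -> C (fun i => \det (f i)).
Proof.
move=> Cf; rewrite /determinant; apply: fun_alg_sum => s.
apply: fun_algM => //; first exact: fun_alg_cst.
exact: fun_alg_prod.
Qed.

(** The index type carries no topology; the nonvanishing locus of one member of [C] serves as a
    neighbourhood of [i0]. *)
Definition C_near (P : I -> Prop) : Prop :=
  exists R, [/\ C R, R i0 != 0 & forall i, R i != 0 -> P i].

Lemma C_nearT (P : I -> Prop) : (forall i, P i) -> C_near P.
Proof.
by move=> PT; exists (fun=> 1); split=> //; [exact: fun_alg_cst|exact: oner_neq0].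
Qed.

Lemma C_near2 (P Q S : I -> Prop) :
  (forall i, P i -> Q i -> S i) -> C_near P -> C_near Q -> C_near S.
Proof.
move=> PQS [R [CR R0 RP]] [R' [CR' R'0 RQ]]; exists (fun i => R i * R' i).
split; [exact: fun_algM|by rewrite mulf_neq0|].
by move=> i; rewrite mulf_eq0 negb_or => /andP[/RP ? /RQ]; exact: PQS.
Qed.

Lemma C_near_neq0 f : C f -> f i0 != 0 -> C_near (fun i => f i != 0).
Proof. by move=> Cf f0; exists f; split. Qed.

Definition C_fraction (f : I -> k) : Prop :=
  exists P R, [/\ C P, C R, R i0 != 0 & forall i, R i != 0 -> f i * R i = P i].

Lemma C_fraction_fun f : C f -> C_fraction f.
Proof.
move=> Cf; exists f, (fun=> 1); split=> //; [exact: fun_alg_cst|exact: oner_neq0|].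
by move=> i _; rewrite mulr1.
Qed.

Lemma eq_C_fraction f g : C_near (fun i => f i = g i) -> C_fraction f -> C_fraction g.
Proof.
move=> [S [CS S0 fg]] [P [R [CP CR R0 fR]]].
exists (fun i => P i * S i), (fun i => R i * S i); split; try exact: fun_algM.
  by rewrite mulf_neq0.
move=> i; rewrite mulf_eq0 negb_or => /andP[Ri Si].
by rewrite mulrA -fg // fR.
Qed.

Lemma C_fractionD f g : C_fraction f -> C_fraction g -> C_fraction (fun i => f i + g i).
Proof.
move=> [P [R [CP CR R0 fR]]] [Q [S [CQ CS S0 gS]]].
exists (fun i => P i * S i + Q i * R i), (fun i => R i * S i); split.
- by apply: fun_algD => //; exact: fun_algM.
- exact: fun_algM.
- by rewrite mulf_neq0.
- move=> i; rewrite mulf_eq0 negb_or => /andP[Ri Si].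
  by rewrite mulrDl mulrA fR // [R i * S i]mulrC mulrA gS.
Qed.

Lemma C_fractionM f g : C_fraction f -> C_fraction g -> C_fraction (fun i => f i * g i).
Proof.
move=> [P [R [CP CR R0 fR]]] [Q [S [CQ CS S0 gS]]].
exists (fun i => P i * Q i), (fun i => R i * S i); split; try exact: fun_algM.
- by rewrite mulf_neq0.
- move=> i; rewrite mulf_eq0 negb_or => /andP[Ri Si].
  by rewrite mulrACA fR // gS.
Qed.

Lemma C_fraction_neq0 f : C_fraction f -> f i0 != 0 -> C_near (fun i => f i != 0).
Proof.
move=> [P [R [CP CR R0 fR]]] f0; exists (fun i => P i * R i); split.
- exact: fun_algM.
- by rewrite -fR // !mulf_neq0.
- move=> i; rewrite mulf_eq0 negb_or => /andP[Pi Ri].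
  by move: Pi; rewrite -fR // mulf_eq0 negb_or => /andP[].
Qed.

Lemma C_fractionV f : C_fraction f -> f i0 != 0 -> C_fraction (fun i => (f i)^-1).
Proof.
move=> [P [R [CP CR R0 fR]]] f0.
exists (fun i => R i * R i), (fun i => P i * R i); split; try exact: fun_algM.
  by rewrite -fR // !mulf_neq0.
move=> i; rewrite mulf_eq0 negb_or => /andP[Pi Ri]; rewrite mulrA -fR // mulKf //.
by move: Pi; rewrite -fR // mulf_eq0 negb_or => /andP[].
Qed.

(* Along the parametrisation [iota], near [i0], open conditions and regular
   functions on [Y] are expressed by fractions of members of [C]. For
   [P_{n,tau} x X], parametrised by matrices and points, this writes the action
   polynomially in the matrix without any structure theory of [PGL_n]. *)
Record locally_described (Y : funspace k) (iota : I -> Y) : Prop := {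
  described_open : forall U : set Y, open U -> U (iota i0) ->
    C_near (fun i => U (iota i));
  described_regular : forall (U : set Y) s, open U -> U (iota i0) ->
    regular Y U s -> C_fraction (fun i => s (iota i)) }.

Section Products.
Variables (Y Z : funspace k) (iota : I -> Y) (kappa : I -> Z).
Hypotheses (dY : locally_described iota) (dZ : locally_described kappa).

Lemma described_tensors (U : set Y) (V : set Z) h : open U -> open V ->
  U (iota i0) -> V (kappa i0) -> tensors U V h ->
  C_fraction (fun i => h (iota i, kappa i)).
Proof.
move=> oU oV Ui Vi [r [u [v [ru rv hE]]]]; under eq_fun do rewrite hE /=.
elim: r u v ru rv {h hE} => [|r IH] u v ru rv.
  by under eq_fun do rewrite big_ord0; apply/C_fraction_fun/fun_alg_cst.
under eq_fun do rewrite big_ord_recl; apply: C_fractionD; last by apply: (IH (fun i => u (lift ord0 i)) (fun i => v (lift ord0 i))).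
by apply: C_fractionM; [exact: (described_regular dY oU Ui (ru _))|exact: (described_regular dZ oV Vi (rv _))].
Qed.

(** The topology of the product is generated by nonvanishing loci of tensors, and its regular
    functions are locally quotients of tensors. A tensor is a sum of products of functions described
    on the factors, hence a fraction. *)
Lemma described_prod :
  @locally_described (prod_funspace Y Z) (fun i => (iota i, kappa i)).
Proof.
have dopen (W : set (prod_funspace Y Z)) : open W -> W (iota i0, kappa i0) ->
    C_near (fun i => W (iota i, kappa i)).
  move=> oW W0; pose N := [set W : set (Y * Z) | C_near (fun i => W (iota i, kappa i))].
  apply: (generated_open_nbhs (N := N) _ _ _ _ oW W0).
  - exact: C_nearT.
  - by move=> U V; apply: C_near2.
  - by move=> U V UV NU; apply: (C_near2 _ NU NU) => i /UV.
  - move=> _ [U [V [h [oU oV th ->]]]] /= [U0 V0 h0].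
    have nU := described_open dY oU U0; have nV := described_open dZ oV V0.
    have nh := C_fraction_neq0 (described_tensors oU oV U0 V0 th) h0.
    have nUV := C_near2 (fun _ => @conj _ _) nU nV.
    by apply: (C_near2 _ nUV nh) => i [].
split=> // W f oW W0 rf.
have [U [V [p [q [[oU U0] [oV V0] [tp tq] q0 fE]]]]] := rf _ W0.
have Fp := described_tensors oU oV U0 V0 tp.
have Fq := described_tensors oU oV U0 V0 tq.
apply: (eq_C_fraction _ (C_fractionM Fp (C_fractionV Fq q0))).
have nU := described_open dY oU U0; have nV := described_open dZ oV V0.
have nUV := C_near2 (fun _ => @conj _ _) nU nV.
have nWq := C_near2 (fun _ => @conj _ _) (dopen _ oW W0) (C_fraction_neq0 Fq q0).
by apply: (C_near2 _ nUV nWq) => i [Ui Vi] [Wi qi]; rewrite fE.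
Qed.

End Products.

(** The component is constant along the parametrisation: the two halves of P_{n,tau} are
    parametrised separately. *)
Lemma described_two_points b : @locally_described (two_points k) (fun _ => b).
Proof.
split=> [U _ Ub|U s _ _ _]; first exact: C_nearT.
by apply/C_fraction_fun/fun_alg_cst.
Qed.

(** Open sets and regular functions of the quotient are by definition those of [GL_space], which are
    induced from matrices. Matrices that are not invertible are sent to the class of the identity by
    [insubd]; the determinant excludes them near [i0]. *)
Lemma described_PGL (n : nat) (mx : I -> 'M[k]_n) :
  (forall r s, C (fun i => mx i r s)) -> mx i0 \in unitmx ->
  @locally_described (PGL_space k n) (fun i => to_PGL (insubd (GL_one k n) (mx i))).
Proof.
move=> Cmx u0; pose g i := insubd (GL_one k n) (mx i).
have gE i : mx i \in unitmx -> GL_mx (g i) = mx i.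
  by move=> ui; rewrite /g -[LHS]/(val _) insubdK.
have nu : C_near (fun i => mx i \in unitmx).
  have [|R] := C_near_neq0 (fun_alg_det Cmx); first by rewrite -unitfE -unitmxE.
  move=> [CR R0 RE]; exists R; split=> // i /RE; by rewrite -unitfE -unitmxE.
have nO (O : set (affine_space k n n)) : open O -> O (mx i0) -> C_near (fun i => O (mx i)).
  move=> oO O0; have [p [p0 pO]] := affine_open_nbhs oO O0.
  by exists (fun i => polyval p (mx i)); split=> //; [exact: fun_alg_polyval|move=> i /pO].
split=> [U /coinduced_openP/induced_openP[O oO UE] U0|U s oU U0 rs].
  have E i : mx i \in unitmx -> U (to_PGL (g i)) = O (mx i).
    by move=> ui; rewrite -(gE i) //; have /(congr1 (@^~ (g i))) := UE.
  have O0 : O (mx i0) by rewrite -E.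
  by apply: (C_near2 _ nu (nO _ oO O0)) => i ui; rewrite -E.
have U0' : ((@to_PGL k n) @^-1` U) (g i0) by [].
have [O [r [oO rr O0 sr]]] := rs _ U0'.
rewrite gE // in O0; have [p [q [q0 rE]]] := rr _ O0.
have Cp t : C (fun i => polyval t (mx i)) by exact: fun_alg_polyval.
apply: (@eq_C_fraction (fun i => polyval p (mx i) * (polyval q (mx i))^-1)); last first.
  apply: C_fractionM; first exact: C_fraction_fun.
  by apply: C_fractionV => //; exact: C_fraction_fun.
have [V oV VE] := (induced_openP _).1 ((coinduced_openP _).1 oU).
have E i : mx i \in unitmx -> U (to_PGL (g i)) = V (mx i).
  by move=> ui; rewrite -(gE i) //; have /(congr1 (@^~ (g i))) := VE.
have V0 : V (mx i0) by rewrite -E.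
have nq : C_near (fun i => polyval q (mx i) != 0) by exact: C_near_neq0.
have nuV := C_near2 (fun _ => @conj _ _) nu (nO _ oV V0).
have nOq := C_near2 (fun _ => @conj _ _) (nO _ oO O0) nq.
apply: (C_near2 _ nuV nOq) => i [ui Vi] [Oi qi].
rewrite -/(g i); have /= -> := sr (g i); rewrite ?gE //; first by rewrite rE.
by rewrite /preimage /= E.
Qed.

(** Functions are total and only their behaviour near the point matters for [reg_at], so the
    indicator function of an open neighbourhood is regular there. It turns membership in the
    neighbourhood into nonvanishing of a member of [C]. *)
Lemma described_variety (X : funspace k) (pt : I -> X) : variety X ->
  (forall v, reg_at (pt i0) v -> C (fun i => v (pt i))) ->
  locally_described pt.
Proof.
move=> varX Cv.
have ind (U : set X) : open U -> U (pt i0) -> C (fun i => (if `[< U (pt i) >] then 1 else 0)).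
  move=> oU U0; apply: (Cv (fun x => if `[< U x >] then 1 else 0)).
  apply: (eq_reg_at varX _ (reg_at_cst varX _ 1)).
  apply: (@filterS _ (nbhs (pt i0)) _ U); last by exact: open_nbhs_nbhs.
  by move=> y Uy; rewrite asboolT.
split=> [U oU U0|U s oU U0 rs].
  exists (fun i => if `[< U (pt i) >] then 1 else 0); split=> //; first exact: ind.
    by rewrite asboolT // oner_neq0.
  by move=> i; case: asboolP => //; rewrite eqxx.
by apply: C_fraction_fun; apply: Cv; exists U.
Qed.

End LocalFractions.

(** * The action of P_{n,tau} *)

Section JointFunctions.
Variables (k : fieldType) (n : nat) (X : funspace k) (x0 : X).

(** Polynomials in the matrix entries whose coefficients are functions regular at [x0]. The
    inductive form allows freezing the matrix, restricting to a line of matrices and substituting a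
    matrix of rational functions each to be treated by induction. *)
Inductive joint_function : ('M[k]_n * X -> k) -> Prop :=
| joint_entry r s : joint_function (fun i => i.1 r s)
| joint_reg v : reg_at x0 v -> joint_function (fun i => v i.2)
| joint_add f g : joint_function f -> joint_function g ->
    joint_function (fun i => f i + g i)
| joint_mul f g : joint_function f -> joint_function g ->
    joint_function (fun i => f i * g i).

Hypothesis varX : variety X.

Lemma joint_algebra : function_algebra joint_function.
Proof.
split; [|exact: joint_add|exact: joint_mul].
by move=> c; apply: (joint_reg (reg_at_cst varX x0 c)).
Qed.

Lemma joint_reg_at f (m : 'M[k]_n) : joint_function f -> reg_at x0 (fun x => f (m, x)).
Proof.
elim=> [r s|v //|g h _ rg _ rh|g h _ rg _ rh] /=.
- exact: reg_at_cst.
- exact: reg_atD.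
- exact: reg_atM.
Qed.

Lemma joint_line f (m1 m2 : 'M[k]_n) (x : X) : joint_function f ->
  exists p : {poly k}, forall t, f (m1 + t *: m2, x) = p.[t].
Proof.
elim=> [r s|v _|g h _ [p pE] _ [q qE]|g h _ [p pE] _ [q qE]] /=.
- exists ((m1 r s)%:P + (m2 r s)%:P * 'X) => t.
  by rewrite !mxE hornerD hornerMX !hornerC mulrC.
- by exists (v x)%:P => t; rewrite hornerC.
- by exists (p + q) => t; rewrite hornerD pE qE.
- by exists (p * q) => t; rewrite hornerM pE qE.
Qed.

End JointFunctions.

(** A root of [p - 1] is a point of value 1; it exists unless [p - 1] is a nonzero constant, and
    then [p] itself is constant. *)
Lemma poly_neq0_ex (k : closedFieldType) (p : {poly k}) :
  p != 0 -> exists t, p.[t] != 0.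
Proof.
move=> p0; have [sp|sp] := eqVneq (size (p - 1)) 1%N; last first.
  have [t /rootP] := closed_rootP _ sp.
  rewrite hornerD hornerN hornerC => /eqP; rewrite subr_eq0 => /eqP pt.
  by exists t; rewrite pt oner_eq0.
exists 0; move: p0; have [c _ pE] := size_poly1P _ (introT eqP sp).
have -> : p = (c + 1)%:P by rewrite polyCD -pE polyC1 subrK.
by rewrite polyC_eq0 hornerC.
Qed.

Section Action.
Variables (k : closedFieldType) (n : nat) (X : funspace k) (act : Ptau k n -> X -> X).
Hypothesis actP : irreducible_Ptau_variety act.

Let varX : variety X := Ptau_variety actP.
Let irrX : irreducible X := Ptau_irreducible actP.

Local Notation mxP m b := ((to_PGL (insubd (GL_one k n) m), b) : Ptau k n).

Lemma act_described (m0 : 'M[k]_n) (b : bool) (x0 : X) : m0 \in unitmx ->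
  locally_described (joint_function x0) (m0, x0)
    (fun i : 'M[k]_n * X => (mxP i.1 b, i.2) : prod_funspace (Ptau_space k n) X).
Proof.
move=> u0; have algC := joint_algebra n x0 varX.
apply: (described_prod algC).
  apply: (described_prod algC); last exact: described_two_points.
  by apply: described_PGL => //= r s; exact: joint_entry.
apply: described_variety => // v rv; exact: joint_reg.
Qed.

Lemma insubd_GL (m : 'M[k]_n) : m \in unitmx ->
  GL_mx (insubd (GL_one k n) m) = m.
Proof. by move=> um; rewrite -[LHS]/(val _) insubdK. Qed.

Lemma act_open_near (m0 : 'M[k]_n) b x0 (O : set X) : m0 \in unitmx -> open O ->
  O (act (mxP m0 b) x0) ->
  C_near (joint_function x0) (m0, x0) (fun i => O (act (mxP i.1 b) i.2)).
Proof.
move=> u0 oO O0; have [/continuousP ca _] := Ptau_act_morphism actP.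
exact: (described_open (act_described b x0 u0) (ca _ oO) O0).
Qed.

Lemma act_regular_fraction (m0 : 'M[k]_n) b x0 f : m0 \in unitmx ->
  reg_at (act (mxP m0 b) x0) f ->
  C_fraction (joint_function x0) (m0, x0) (fun i => f (act (mxP i.1 b) i.2)).
Proof.
move=> u0 [O [oO O0 rf]]; have [/continuousP ca ra] := Ptau_act_morphism actP.
exact: (described_regular (act_described b x0 u0) (ca _ oO) O0 (ra _ _ oO rf)).
Qed.

Lemma PtauE (g : Ptau k n) : exists2 m : 'M[k]_n, m \in unitmx & g = mxP m g.2.
Proof.
case: g => h b; exists (GL_mx (repr h)); first exact: (Defs.GL_unit (repr h)).
congr (_, _); rewrite -{1}[h]to_PGLK; congr to_PGL; apply: val_inj.
symmetry; apply: insubd_GL; exact: (Defs.GL_unit (repr h)).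
Qed.

(** Freezing the matrix in the joint description of the action turns a joint function into a
    function of the point, regular at [x]. *)
Lemma act_continuous g : continuous (act g).
Proof.
have [m um ->] := PtauE g; apply/continuousP => O oO.
rewrite openE => x Ox; have [R [CR R0 RO]] := act_open_near um oO Ox.
have := reg_at_neq0 varX (joint_reg_at varX m CR) R0.
by apply: filterS => y /RO.
Qed.

Lemma act_reg_at g x f : reg_at (act g x) f -> reg_at x (fun y => f (act g y)).
Proof.
have [m um ->] := PtauE g => rf.
have [P [R [CP CR R0 fR]]] := act_regular_fraction um rf.
have rR := joint_reg_at varX m CR.
apply: (@eq_reg_at _ _ varX _ (fun y => P (m, y) * (R (m, y))^-1)).
  have := reg_at_neq0 varX rR R0; apply: filterS => y Ry.
  by rewrite -fR // mulfK.
by apply: reg_atM => //; [exact: joint_reg_at|exact: reg_atV].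
Qed.

Lemma actK g : cancel (act g) (act g^-1%g).
Proof. by move=> x; rewrite -(Ptau_actM actP) mulVg (Ptau_act1 actP). Qed.

Lemma actVK g : cancel (act g^-1%g) (act g).
Proof. by move=> x; rewrite -(Ptau_actM actP) mulgV (Ptau_act1 actP). Qed.

Lemma general_position_act g P :
  in_general_position P -> in_general_position (fun x => P (act g x)).
Proof.
have c1 := @act_continuous g; have c2 := @act_continuous (g^-1%g).
exact: (general_position_preimage c1 c2 (actK g) (actVK g)).
Qed.

Lemma rational_act g f : rational f -> rational (fun x => f (act g x)).
Proof. by move=> /(general_position_act g); apply: filterS => x; exact: act_reg_at. Qed.

(* [PGL_n] is irreducible: a line through two invertible matrices lies
   generically in any two nonempty open subsets that it meets. *)
Lemma orbits_meet (O : set X) (h1 h2 : PGL k n) x y : open O ->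
  O (act (Ptau_of_PGL h1) x) -> O (act (Ptau_of_PGL h2) y) ->
  exists g : PGL k n, O (act (Ptau_of_PGL g) x) /\ O (act (Ptau_of_PGL g) y).
Proof.
move=> oO; have [/= m1 u1 e1] := PtauE (Ptau_of_PGL h1).
have [/= m2 u2 e2] := PtauE (Ptau_of_PGL h2); rewrite e1 e2 => Ox Oy.
have [R1 [C1 R10 RO1]] := act_open_near u1 oO Ox.
have [R2 [C2 R20 RO2]] := act_open_near u2 oO Oy.
(* Both polynomials run along the same line, from [m1] at 0 to [m2] at 1; the first is nonzero at 0,
   the second at 1. A common parameter with nonzero values then works even without checking
   invertibility, because [R1] and [R2] already speak of [insubd]. *)
have [p1 pE1] := joint_line m1 (m2 - m1) x C1.
have [p2 pE2] := joint_line m1 (m2 - m1) y C2.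
have p10 : p1 != 0.
  by apply: contra_neq R10 => p0; have := pE1 0; rewrite scale0r addr0 p0 horner0.
have p20 : p2 != 0.
  apply: contra_neq R20 => p0; have := pE2 1.
  by rewrite scale1r addrCA subrr addr0 p0 horner0.
have [t] := poly_neq0_ex (mulf_neq0 p10 p20).
rewrite hornerM -pE1 -pE2 mulf_eq0 negb_or => /andP[/RO1 /= O1 /RO2 /= O2].
by exists (to_PGL (insubd (GL_one k n) (m1 + t *: (m2 - m1)))).
Qed.

End Action.

(** * The function field *)

Section FunctionField.
Local Open Scope quotient_scope.
Variables (k : fieldType) (X : funspace k).

Record rational_function : Type :=
  RationalFunction { rat_fun :> X -> k; rat_funP : rational rat_fun }.
HB.instance Definition _ := gen_eqMixin rational_function.
HB.instance Definition _ := gen_choiceMixin rational_function.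

Definition rational_function_eq (f g : rational_function) : bool :=
  `[< rational_eq f g >].

Fact rational_function_equiv : equiv_class_of rational_function_eq.
Proof.
split=> [f|f g|g f h].
- by apply/asboolP; apply: filterE.
- by apply/asboolP/asboolP; apply: filterS.
- by move=> /asboolP fg /asboolP gh; apply/asboolP; apply: filterS2 fg gh => x ->.
Qed.
Canonical rational_function_equivRel := EquivRelPack rational_function_equiv.

(* The hypotheses are parameters of the type, so that the field structure can
   be canonical. *)
Definition function_field (varX : variety X) (irrX : irreducible X) : Type :=
  {eq_quot rational_function_eq}%qT.

Variables (varX : variety X) (irrX : irreducible X).
Local Notation K := (function_field varX irrX).

HB.instance Definition _ := Choice.on K.
HB.instance Definition _ := EqQuotient.on K.

(** Values of a chosen representative: an identity in K becomes an identity of values only in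
    general position. *)
Definition ev (u : K) : X -> k := repr u.

Lemma ev_rational u : rational (ev u).
Proof. exact: rat_funP. Qed.

Lemma ev_inj u v : in_general_position (fun x => ev u x = ev v x) -> u = v.
Proof.
rewrite -{2}[u]reprK -{2}[v]reprK => e; apply/eqP; rewrite eqmodE; exact/asboolP.
Qed.

(* [0] when [f] is not rational *)
Definition germ (f : X -> k) : K :=
  if pselect (rational f) is left rf then \pi_K (RationalFunction rf)
  else \pi_K (RationalFunction (rational_cst varX 0)).

Lemma ev_germ f : rational f -> in_general_position (fun x => ev (germ f) x = f x).
Proof.
move=> rf; rewrite /germ; case: pselect => // rf'.
have /eqP := reprK (\pi_K (RationalFunction rf') : K).
by rewrite eqmodE => /asboolP.
Qed.

Lemma ev_germ_inj f u : rational f ->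
  in_general_position (fun x => f x = ev u x) -> germ f = u.
Proof. by move=> /ev_germ e fu; apply: ev_inj; apply: filterS2 e fu => x ->. Qed.

Definition Kzero : K := germ (fun _ => 0).
Definition Kone : K := germ (fun _ => 1).
Definition Kadd (u v : K) : K := germ (fun x => ev u x + ev v x).
Definition Kmul (u v : K) : K := germ (fun x => ev u x * ev v x).
Definition Kopp (u : K) : K := germ (fun x => - ev u x).
Definition Kinv (u : K) : K := germ (fun x => (ev u x)^-1).

Let ev0 : in_general_position (fun x => ev Kzero x = 0).
Proof. exact/ev_germ/rational_cst. Qed.
Let ev1 : in_general_position (fun x => ev Kone x = 1).
Proof. exact/ev_germ/rational_cst. Qed.
Let evD u v : in_general_position (fun x => ev (Kadd u v) x = ev u x + ev v x).
Proof. by apply/ev_germ/rationalD => //; exact: ev_rational. Qed.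
Let evM u v : in_general_position (fun x => ev (Kmul u v) x = ev u x * ev v x).
Proof. by apply/ev_germ/rationalM => //; exact: ev_rational. Qed.
Let evN u : in_general_position (fun x => ev (Kopp u) x = - ev u x).
Proof.
apply: ev_germ; have := rationalM varX (rational_cst varX (-1)) (ev_rational u).
by under eq_fun do rewrite mulN1r.
Qed.
Let evV u : in_general_position (fun x => ev (Kinv u) x = (ev u x)^-1).
Proof. by apply/ev_germ/rationalV => //; exact: ev_rational. Qed.

Fact KaddA : associative Kadd.
Proof.
move=> u v w; apply: ev_inj; near=> x.
rewrite (near (evD u (Kadd v w)) x) // (near (evD v w) x) //.
by rewrite (near (evD (Kadd u v) w) x) // (near (evD u v) x) // addrA.
Unshelve. all: end_near. Qed.

Fact KaddC : commutative Kadd.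
Proof.
move=> u v; apply: ev_inj; near=> x.
by rewrite (near (evD u v) x) // (near (evD v u) x) // addrC.
Unshelve. all: end_near. Qed.

Fact Kadd0 : left_id Kzero Kadd.
Proof.
move=> u; apply: ev_inj; near=> x.
by rewrite (near (evD Kzero u) x) // (near ev0 x) // add0r.
Unshelve. all: end_near. Qed.

Fact KaddN : left_inverse Kzero Kopp Kadd.
Proof.
move=> u; apply: ev_inj; near=> x.
by rewrite (near (evD (Kopp u) u) x) // (near (evN u) x) // (near ev0 x) // addNr.
Unshelve. all: end_near. Qed.

HB.instance Definition _ := GRing.isZmodule.Build K KaddA KaddC Kadd0 KaddN.

Fact KmulA : associative Kmul.
Proof.
move=> u v w; apply: ev_inj; near=> x.
rewrite (near (evM u (Kmul v w)) x) // (near (evM v w) x) //.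
by rewrite (near (evM (Kmul u v) w) x) // (near (evM u v) x) // mulrA.
Unshelve. all: end_near. Qed.

Fact KmulC : commutative Kmul.
Proof.
move=> u v; apply: ev_inj; near=> x.
by rewrite (near (evM u v) x) // (near (evM v u) x) // mulrC.
Unshelve. all: end_near. Qed.

Fact Kmul1 : left_id Kone Kmul.
Proof.
move=> u; apply: ev_inj; near=> x.
by rewrite (near (evM Kone u) x) // (near ev1 x) // mul1r.
Unshelve. all: end_near. Qed.

Fact KmulDl : left_distributive Kmul Kadd.
Proof.
move=> u v w; apply: ev_inj; near=> x.
rewrite (near (evM (Kadd u v) w) x) // (near (evD u v) x) //.
rewrite (near (evD (Kmul u w) (Kmul v w)) x) // (near (evM u w) x) //.
by rewrite (near (evM v w) x) // mulrDl.
Unshelve. all: end_near. Qed.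

Fact Kone_neq0 : Kone != 0.
Proof.
apply/eqP => e; have /(general_position_ex irrX.1)[x [e1 e0]] :
    in_general_position (fun x => ev Kone x = 1 /\ ev Kone x = 0).
  by apply: filterI ev1 _; rewrite e.
by move/eqP: e1; rewrite e0 eq_sym oner_eq0.
Qed.

HB.instance Definition _ :=
  GRing.Zmodule_isComNzRing.Build K KmulA KmulC Kmul1 KmulDl Kone_neq0.

Fact KmulV (u : K) : u != 0 -> Kinv u * u = 1.
Proof.
move=> u0; have [e|n0] := rational_zero_or_neq0 varX irrX (ev_rational u).
  by case/eqP: u0; apply: ev_inj; apply: filterS2 e ev0 => x -> ->.
apply: ev_inj; near=> x.
rewrite (near (evM (Kinv u) u) x) // (near (evV u) x) // (near ev1 x) // mulVf //.
exact: (near n0 x).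
Unshelve. all: end_near. Qed.

Fact Kinv0 : Kinv 0 = 0.
Proof.
apply: ev_inj; near=> x.
by rewrite (near (evV 0) x) // (near ev0 x) // invr0.
Unshelve. all: end_near. Qed.

HB.instance Definition _ := GRing.ComNzRing_isField.Build K KmulV Kinv0.

Lemma ev_zero : in_general_position (fun x => ev (0 : K) x = 0).
Proof. exact: ev0. Qed.

Lemma ev_one : in_general_position (fun x => ev (1 : K) x = 1).
Proof. exact: ev1. Qed.

Lemma ev_add (u v : K) : in_general_position (fun x => ev (u + v) x = ev u x + ev v x).
Proof. exact: evD. Qed.

Lemma ev_mul (u v : K) : in_general_position (fun x => ev (u * v) x = ev u x * ev v x).
Proof. exact: evM. Qed.

Lemma ev_inv (u : K) : in_general_position (fun x => ev u^-1 x = (ev u x)^-1).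
Proof. exact: evV. Qed.

Lemma ev_opp (u : K) : in_general_position (fun x => ev (- u) x = - ev u x).
Proof. exact: evN. Qed.

Lemma ev_neq0 (u : K) : u != 0 -> in_general_position (fun x => ev u x != 0).
Proof.
move=> u0; have [e|//] := rational_zero_or_neq0 varX irrX (ev_rational u).
by case/eqP: u0; apply: ev_inj; apply: filterS2 e ev_zero => x -> ->.
Qed.

Lemma ev_sum (I : Type) (r : seq I) (P : pred I) (u : I -> K) :
  in_general_position (fun x => ev (\sum_(i <- r | P i) u i) x = \sum_(i <- r | P i) ev (u i) x).
Proof.
elim: r => [|i r IH].
  by rewrite big_nil; apply: filterS ev_zero => x ->; rewrite big_nil.
rewrite big_cons; case Pi: (P i).
  apply: filterS2 (ev_add (u i) (\sum_(j <- r | P j) u j)) IH => x -> ->.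
  by rewrite big_cons Pi.
by apply: filterS IH => x ->; rewrite big_cons Pi.
Qed.

Lemma general_position_forall (I : finType) (P : I -> X -> Prop) :
  (forall i, in_general_position (P i)) -> in_general_position (fun x => forall i, P i x).
Proof. by move=> gP; apply: (filter_forall _ gP). Qed.

Definition evmx (a b : nat) (M : 'M[K]_(a, b)) (x : X) : 'M[k]_(a, b) :=
  \matrix_(i, j) ev (M i j) x.

Lemma evmx_inj (a b : nat) (M N : 'M[K]_(a, b)) :
  in_general_position (fun x => evmx M x = evmx N x) -> M = N.
Proof.
move=> e; apply/matrixP => i j; apply: ev_inj; apply: filterS e => x /matrixP/(_ i j).
by rewrite !mxE.
Qed.

Lemma evmx_mul (a b c : nat) (M : 'M[K]_(a, b)) (N : 'M[K]_(b, c)) :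
  in_general_position (fun x => evmx (M *m N) x = evmx M x *m evmx N x).
Proof.
have : in_general_position (fun x => forall ij : 'I_a * 'I_c,
    evmx (M *m N) x ij.1 ij.2 = (evmx M x *m evmx N x) ij.1 ij.2).
  apply: general_position_forall => -[i j] /=.
  have h1 := ev_sum (index_enum 'I_b) xpredT (fun l => M i l * N l j).
  have h2 : in_general_position (fun x => forall l, ev (M i l * N l j) x = ev (M i l) x * ev (N l j) x).
    by apply: general_position_forall => l; exact: ev_mul.
  apply: filterS2 h1 h2 => x e1 e2; rewrite [LHS]mxE [RHS]mxE [X in ev X]mxE e1.
  by apply: eq_bigr => l _; rewrite e2 !mxE.
by apply: filterS => x e; apply/matrixP => i j; exact: (e (i, j)).
Qed.

Lemma evmx_sub (a b : nat) (M N : 'M[K]_(a, b)) :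
  in_general_position (fun x => evmx (M - N) x = evmx M x - evmx N x).
Proof.
have : in_general_position (fun x => forall ij : 'I_a * 'I_b,
    ev (M ij.1 ij.2 - N ij.1 ij.2) x = ev (M ij.1 ij.2) x - ev (N ij.1 ij.2) x).
  apply: general_position_forall => -[i j] /=.
  by apply: filterS2 (ev_add (M i j) (- N i j)) (ev_opp (N i j)) => x -> ->.
by apply: filterS => x e; apply/matrixP => i j; rewrite !mxE (e (i, j)).
Qed.

Lemma evmx1 n : in_general_position (fun x => evmx (1%:M : 'M[K]_n) x = 1%:M).
Proof.
apply: filterS2 ev_zero ev_one => x e0 e1; apply/matrixP => i j; rewrite !mxE.
by case: (i == j).
Qed.

Lemma evmx_scalar n (u : K) : in_general_position (fun x => evmx (u%:M : 'M[K]_n) x = (ev u x)%:M).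
Proof.
apply: filterS ev_zero => x e0; apply/matrixP => i j; rewrite !mxE.
by case: (i == j).
Qed.

Lemma evmx_tr (a b : nat) (M : 'M[K]_(a, b)) x : evmx M^T x = (evmx M x)^T.
Proof. by apply/matrixP => i j; rewrite !mxE. Qed.

Lemma evmx_unit n (M : 'M[K]_n) : M \in unitmx ->
  in_general_position (fun x => evmx M x \in unitmx /\ evmx (invmx M) x = invmx (evmx M x)).
Proof.
move=> uM; have := evmx_mul M (invmx M); rewrite mulmxV // => e.
apply: filterS2 e (evmx1 n) => x -> /esym e1.
have [uMx _] := mulmx1_unit (esym e1); split=> //.
by rewrite -[LHS](mulKmx uMx) -e1 mulmx1.
Qed.

Definition germ_mx (a b : nat) (f : X -> 'M[k]_(a, b)) : 'M[K]_(a, b) :=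
  \matrix_(i, j) germ (fun x => f x i j).

Lemma ev_germ_mx (a b : nat) (f : X -> 'M[k]_(a, b)) :
  (forall i j, rational (fun x => f x i j)) ->
  in_general_position (fun x => evmx (germ_mx f) x = f x).
Proof.
move=> rf; have : in_general_position (fun x => forall ij : 'I_a * 'I_b,
    evmx (germ_mx f) x ij.1 ij.2 = f x ij.1 ij.2).
  apply: general_position_forall => -[i j] /=.
  by apply: filterS (ev_germ (rf i j)) => x; rewrite !mxE.
by apply: filterS => x e; apply/matrixP => i j; exact: (e (i, j)).
Qed.

End FunctionField.

(** * Central simple algebras and involutions *)

Section CentralSimple.
Variables (k : fieldType) (A : algType k).

Lemma center0 : @center k A 0.
Proof. by move=> a; rewrite mul0r mulr0. Qed.

Lemma center1 : @center k A 1.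
Proof. by move=> a; rewrite mul1r mulr1. Qed.

Lemma centerD (x y : A) : center x -> center y -> center (x + y).
Proof. by move=> cx cy a; rewrite mulrDl mulrDr cx cy. Qed.

(* The image of [a] under the element [sum u (x) v] of the enveloping algebra. *)
Definition enveloping (t : seq (A * A)) (a : A) : A := \sum_(uv <- t) uv.1 * a * uv.2.

Lemma envelopingD t a b : enveloping t (a + b) = enveloping t a + enveloping t b.
Proof. by rewrite -big_split; apply: eq_bigr => uv _; rewrite mulrDr mulrDl. Qed.

Lemma enveloping_center t z a : center z -> enveloping t (z * a) = z * enveloping t a.
Proof.
by move=> cz; rewrite mulr_sumr; apply: eq_bigr => uv _; rewrite mulrA -cz !mulrA.
Qed.

Lemma enveloping0 t : enveloping t 0 = 0.
Proof. by apply: big1 => uv _; rewrite mulr0 mul0r. Qed.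

Lemma enveloping_cat t1 t2 a : enveloping (t1 ++ t2) a = enveloping t1 a + enveloping t2 a.
Proof. exact: big_cat. Qed.

Definition enveloping_mul (u v : A) (t : seq (A * A)) := [seq (u * p.1, p.2 * v) | p <- t].

Lemma enveloping_mulE u v t a : enveloping (enveloping_mul u v t) a = u * enveloping t a * v.
Proof.
rewrite /enveloping big_map mulr_sumr mulr_suml; apply: eq_bigr => p _ /=.
by rewrite !mulrA.
Qed.

Definition enveloping_comp (t1 t2 : seq (A * A)) := flatten [seq enveloping_mul uv.1 uv.2 t2 | uv <- t1].

Lemma enveloping_compE t1 t2 a : enveloping (enveloping_comp t1 t2) a = enveloping t1 (enveloping t2 a).
Proof.
elim: t1 => [|uv t1 IH]; first by rewrite /enveloping !big_nil.
rewrite /enveloping_comp /= enveloping_cat enveloping_mulE -/(enveloping_comp t1 t2) IH.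
by rewrite [in RHS]/enveloping big_cons.
Qed.

Fixpoint center_span (s : seq A) (a : A) : Prop :=
  if s is b :: s' then exists2 z, center z & center_span s' (a - z * b) else a = 0.

Lemma center_span_enveloping t s a :
  (forall b, b \in s -> enveloping t b = 0) -> center_span s a -> enveloping t a = 0.
Proof.
elim: s a => [|b s IH] a /= ts => [->|[z cz sa]]; first exact: enveloping0.
have /IH /(_ sa) : forall c, c \in s -> enveloping t c = 0.
  by move=> c cs; apply: ts; rewrite inE cs orbT.
move=> e; rewrite -[a](subrK (z * b)) envelopingD e.
by rewrite enveloping_center // ts ?mem_head // mulr0 addr0.
Qed.

Hypothesis simpA : simple A.

(** The elements [enveloping t c] form the two-sided ideal generated by [c]. *)
Lemma simple_enveloping1 c : c != 0 -> exists t, enveloping t c = 1.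
Proof.
move=> c0; pose I : set A := [set a | exists t, enveloping t c = a].
case: (simpA (I := I)).
- by exists [::]; rewrite /enveloping big_nil.
- move=> _ _ [t <-] [t' <-]; exists (t ++ enveloping_mul (-1) 1 t').
  by rewrite enveloping_cat enveloping_mulE mulN1r mulr1.
- move=> _ b [t <-]; split; [exists (enveloping_mul b 1 t)|exists (enveloping_mul 1 b t)];
    by rewrite enveloping_mulE ?mulr1 ?mul1r.
- move=> I0; have : I c by exists [:: (1, 1)]; rewrite /enveloping big_seq1 mul1r mulr1.
  by rewrite I0 => /eqP; rewrite (negPf c0).
- by move=> IT; have : I 1 by rewrite IT.
Qed.

(* The Artin-Whaples theorem. *)
Lemma simple_separating s b0 : ~ center_span s b0 ->
  exists t, enveloping t b0 = 1 /\ forall b, b \in s -> enveloping t b = 0.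
Proof.
have normalize (s' : seq A) b t : enveloping t b != 0 -> (forall c, c \in s' -> enveloping t c = 0) ->
    exists t, enveloping t b = 1 /\ forall c, c \in s' -> enveloping t c = 0.
  move=> /simple_enveloping1[t' t'1] ts; exists (enveloping_comp t' t).
  by split=> [|c cs]; rewrite enveloping_compE // ts // enveloping0.
elim: s b0 => [|b s IH] b0.
  move=> /= /eqP b00; apply: (@normalize _ _ [:: (1, 1)]) => //.
  by rewrite /enveloping big_seq1 mul1r mulr1.
move=> nb0; have [sb|nsb] := pselect (center_span s b).
  have [|t [t1 ts]] := IH b0.
    by move=> sb0; apply: nb0; exists 0; [exact: center0|rewrite mul0r subr0].
  exists t; split=> // c; rewrite inE => /predU1P[->|/ts //].
  exact: center_span_enveloping sb.
have [t1 [t1b t1s]] := IH _ nsb; pose c := enveloping t1 b0.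
(* If [c] is central, [t2] is chosen for [b0 - c * b] and corrected to x |-> t2(x) - t2(b) t1(x).
   This kills [b], and its value at [b0] is 1 because [c] commutes with t2(b). *)
have [cc|ncc] := pselect (center c).
  have [|t2 [t2b t2s]] := IH (b0 - c * b); first by move=> sc; apply: nb0; exists c.
  exists (t2 ++ enveloping_mul (- enveloping t2 b) 1 t1).
  split=> [|a]; rewrite ?inE enveloping_cat enveloping_mulE.
    have -> : enveloping t2 b0 = 1 + c * enveloping t2 b.
      by rewrite -enveloping_center // -t2b -envelopingD subrK.
    by rewrite mulr1 -/c mulNr -cc addrK.
  move=> /predU1P[->|ha].
    by rewrite t1b !mulr1 subrr.
  by rewrite t1s // t2s // mulr0 mul0r addr0.
(* If [c] is not central, x |-> a t1(x) - t1(x) a kills [b], where t1 is 1, and [s], where t1 is 0,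
   but not [b0]. *)
have [a ca] : exists a, c * a <> a * c.
  by apply: contrapT => na; apply: ncc => a; apply: contrapT => ca; apply: na; exists a.
apply: (@normalize _ _ (enveloping_mul a 1 t1 ++ enveloping_mul (-1) a t1)).
  rewrite enveloping_cat !enveloping_mulE mulr1 mulN1r mulNr subr_eq0 eq_sym.
  exact/eqP.
move=> e; rewrite inE enveloping_cat !enveloping_mulE mulr1 mulN1r mulNr.
move=> /predU1P[->|/t1s ->]; first by rewrite t1b mulr1 mul1r subrr.
by rewrite mulr0 mul0r subrr.
Qed.

Definition center_basis (d : nat) (b : 'I_d -> A) : Prop :=
  forall a, exists! z : {ffun 'I_d -> A},
    (forall i, center (z i)) /\ a = \sum_(i < d) z i * b i.

Section Basis.
Variables (d : nat) (b : 'I_d -> A).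
Hypothesis basis_b : center_basis b.

Lemma center_span_coordinates (s : seq 'I_d) a : center_span (map b s) a ->
  exists z : {ffun 'I_d -> A}, [/\ forall i, center (z i),
    forall i, i \notin s -> z i = 0 & a = \sum_(i < d) z i * b i].
Proof.
elim: s a => [|j s IH] a /= => [->|[z cz /IH[z' [cz' z's aE]]]].
  exists [ffun=> 0]; split=> [i|i _|]; rewrite ?ffunE //; first exact: center0.
  by rewrite big1 // => i _; rewrite ffunE mul0r.
exists [ffun i => z' i + (if i == j then z else 0)]; split=> [i|i|].
- by rewrite ffunE; apply: centerD => //; case: eqP => // _; exact: center0.
- by rewrite inE negb_or ffunE => /andP[/negPf -> /z's ->]; rewrite addr0.
- under eq_bigr do rewrite ffunE mulrDl; rewrite big_split /= -aE.
  rewrite (bigD1 j) //= eqxx big1 ?addr0 ?subrK // => i /negPf ->.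
  by rewrite mul0r.
Qed.

(** Were [b i] in the span of the other basis elements, it would have two coordinate vectors; so
    Artin-Whaples applies and yields a family dual to the basis inside the enveloping algebra. *)
Lemma basis_separating i : exists t, forall j, enveloping t (b j) = (i == j)%:R.
Proof.
have [|t [ti tj]] := @simple_separating (map b [seq j <- enum 'I_d | j != i]) (b i).
  move=> /center_span_coordinates[z [cz zi bE]].
  have [z0 [_ uz]] := basis_b (b i).
  have e1 := uz _ (conj cz bE).
  have e2 := uz [ffun j => (i == j)%:R].
  have /(congr1 (fun f : {ffun 'I_d -> A} => f i)) : z = [ffun j => (i == j)%:R].
    rewrite -e1 e2 //; split=> [j|].
      by rewrite ffunE; case: eqP => _; [exact: center1|exact: center0].
    rewrite (bigD1 i) //= big1 ?ffunE ?eqxx ?mul1r ?addr0 // => j.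
    by rewrite ffunE eq_sym => /negPf ->; rewrite mul0r.
  rewrite ffunE eqxx zi ?mem_filter ?eqxx // => /eqP.
  by rewrite eq_sym oner_eq0.
exists t => j; case: eqP => [<- //|/eqP ij]; apply: tj; apply: map_f.
by rewrite mem_filter mem_enum eq_sym ij.
Qed.

End Basis.

End CentralSimple.

Section MatrixAlgebra.
Variables (L : fieldType) (n : nat).

Lemma commuting_scalar (C : 'M[L]_n) : (forall m, C *m m = m *m C) -> is_scalar_mx C.
Proof.
move=> cC; case: n C cC => [|n'] C cC; first by apply/is_scalar_mxP; exists 0; rewrite [LHS]flatmx0 [RHS]flatmx0.
have E i j a b : C a i * (b == j)%:R = (a == i)%:R * C j b.
  have /matrixP/(_ a b) := cC (delta_mx i j); rewrite !mxE.
  rewrite (bigD1 i) //= big1 => [|l /negPf li]; last by rewrite mxE li mulr0.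
  rewrite (bigD1 j) //= [in RHS]big1 => [|l /negPf lj]; last by rewrite mxE lj andbF mul0r.
  by rewrite !mxE !eqxx /= !addr0 andbT.
apply/is_scalar_mxP; exists (C ord0 ord0); apply/matrixP => a b; rewrite !mxE.
have := E b b a b; rewrite eqxx mulr1 => ->; case: eqP => [_|_]; last by rewrite mul0r mulr0n.
by have := E b ord0 b ord0; rewrite !eqxx mul1r mulr1 mulr1n mul1r => ->.
Qed.

(** Row i of H is row r of theta(E_{0i}), with r such that row r of theta(E_{00}) is nonzero. The
    relation E_{0i} m = \sum_j m_{ij} E_{0j} gives H theta(m) = m H, and u H theta(E_{j0}) = u_j
    times that nonzero row shows that H is injective. *)
Lemma skolem_noether (theta : {linear 'M[L]_n -> 'M[L]_n}) : (0 < n)%N ->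
  theta 1%:M = 1%:M -> (forall m1 m2, theta (m1 *m m2) = theta m1 *m theta m2) ->
  exists2 H, H \in unitmx & forall m, H *m theta m = m *m H.
Proof.
case: n theta => // n' theta _ th1 thM; pose i0 : 'I_n'.+1 := ord0.
have th0 : theta (delta_mx i0 i0) != 0.
  apply/eqP => e; have : (1%:M : 'M[L]_n'.+1) = 0.
    rewrite -th1 mx1_sum_delta linear_sum big1 // => i _.
    have -> : delta_mx i i = delta_mx i i0 *m delta_mx i0 i0 *m delta_mx i0 i :> 'M[L]_n'.+1.
      by rewrite !mul_delta_mx.
    by rewrite !thM e mulmx0 mul0mx.
  by move=> /matrixP/(_ i0 i0)/eqP; rewrite !mxE oner_eq0.
have [r vr] : exists r, row r (theta (delta_mx i0 i0)) != 0.
  apply: contrapT => nr; case/eqP: th0; apply/row_matrixP => r; rewrite row0.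
  by apply/eqP/negPn/negP => r0; apply: nr; exists r.
pose H := \matrix_i row r (theta (delta_mx i0 i)).
have HE m : H *m theta m = m *m H.
  apply/row_matrixP => i; rewrite row_mul rowK -[LHS]row_mul -thM [RHS]row_mul.
  have -> : delta_mx i0 i *m m = \sum_j m i j *: delta_mx i0 j.
    rewrite [m in LHS]matrix_sum_delta mulmx_sumr (bigD1 i) //= [X in _ + X]big1 => [|l li].
      rewrite addr0 mulmx_sumr; apply: eq_bigr => j _.
      by rewrite -scalemxAr mul_delta_mx.
    by rewrite mulmx_sumr big1 // => j _; rewrite -scalemxAr mul_delta_mx_0 1?eq_sym // scaler0.
  rewrite linear_sum linear_sum mulmx_sum_row; apply: eq_bigr => j _.
  by rewrite !linearZ /= rowK mxE.
exists H => //; rewrite -row_free_unit; apply: inj_row_free => u uH.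
apply/rowP => j; rewrite mxE; apply/eqP.
have : u *m H *m theta (delta_mx j i0) = u 0 j *: row r (theta (delta_mx i0 i0)).
  rewrite -mulmxA HE mulmxA; have -> : u *m delta_mx j i0 = u 0 j *: delta_mx 0 i0.
    apply/rowP => a; rewrite !mxE (bigD1 j) //= big1 ?addr0 => [|l lj]; rewrite !mxE ?eqxx //.
    by rewrite (negPf lj) mulr0.
  by rewrite -scalemxAl -rowE rowK.
rewrite uH mul0mx => /esym/eqP; rewrite scaler_eq0 => /orP[] //.
by rewrite (negPf vr).
Qed.

(** The image of E_{ij} is B^-1 E_{ji} B, whose (i,j) entry is (B^-1)_{ij} B_{ij}. *)
Lemma trace_adjoint (B : 'M[L]_n) :
  \tr (lin_mx (mulmxr B \o mulmx (invmx B) \o trmx : 'M[L]_n -> 'M[L]_n)) = \tr (invmx B *m B^T).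
Proof.
rewrite /mxtrace (reindex _ (curry_mxvec_bij n n)) /=.
transitivity (\sum_i \sum_j invmx B i j * B i j).
  rewrite pair_bigA /=; apply: eq_bigr => -[i j] _ /=.
  rewrite -[_ (mxvec_index i j) (mxvec_index i j)]mulr1.
  have := mul_vec_lin (mulmxr B \o mulmx (invmx B) \o trmx : {linear 'M[L]_n -> 'M[L]_n}) (delta_mx i j).
  rewrite mxvec_delta -rowE => /rowP/(_ (mxvec_index i j)); rewrite mxE mulr1 => ->.
  rewrite mxvecE /= trmx_delta mxE (bigD1 i) //= big1 => [|l li].
    rewrite addr0 mxE (bigD1 j) //= big1 => [|l lj]; rewrite mxE ?eqxx ?mulr1 ?addr0 //.
    by rewrite (negPf lj) mulr0.
  rewrite mxE big1 ?mul0r // => l' _; rewrite mxE (negPf li) andbF mulr0 //.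
apply: eq_bigr => i _; rewrite mxE; apply: eq_bigr => j _; by rewrite mxE.
Qed.

End MatrixAlgebra.

Section Splitting.
Variables (k : fieldType) (A : algType k) (n : nat) (b : 'I_(n * n) -> A).
Hypotheses (simpA : simple A) (basis_b : center_basis b) (n_gt0 : (0 < n)%N).

Section SplittingMap.
Variables (L : fieldType) (rho : {rmorphism A -> 'M[L]_n}).

Lemma splitting_inj : injective rho.
Proof.
move=> x y exy; apply/eqP; rewrite -subr_eq0; apply/eqP.
pose I : set A := [set a | rho a = 0].
have Ixy : I (x - y) by rewrite /I /= rmorphB /= exy subrr.
case: (simpA (I := I)); [exact: rmorph0| | |by move=> I0; move: Ixy; rewrite I0|].
- by move=> a c /= a0 c0; rewrite /I /= rmorphB /= a0 c0 subrr.
- by move=> a c /= a0; split; rewrite /I /= rmorphM /= a0 ?mulr0 ?mul0r.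
- move=> IT; have : I 1 by rewrite IT.
  rewrite /I /= rmorph1 => /matrixP/(_ (Ordinal n_gt0) (Ordinal n_gt0))/eqP.
  by rewrite !mxE eqxx oner_eq0.
Qed.

Definition splitting_basis_mx : 'M[L]_(n * n) := \matrix_i mxvec (rho (b i)).

(** A relation \sum_j c_j rho(b_j) = 0 over L is hit with the image under [rho] of the enveloping
    element dual to b_i; what remains is c_i 1 = 0. There are n * n vectors, the dimension of the
    matrix algebra. *)
Lemma splitting_basis_unit : splitting_basis_mx \in unitmx.
Proof.
rewrite -row_free_unit; apply: inj_row_free => c; rewrite mulmx_sum_row => c0.
have {}c0 : \sum_i c 0 i *: rho (b i) = 0.
  apply: (can_inj mxvecK); rewrite linear0 -c0 linear_sum; apply: eq_bigr => i _.
  by rewrite linearZ /= rowK.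
apply/rowP => i; rewrite [RHS]mxE.
have [t tE] := basis_separating simpA basis_b i.
have : \sum_(uv <- t) rho uv.1 *m (\sum_j c 0 j *: rho (b j)) *m rho uv.2 = c 0 i *: 1%:M.
  transitivity (\sum_j c 0 j *: rho (enveloping t (b j))).
    rewrite (eq_bigr (fun uv => \sum_j c 0 j *: rho (uv.1 * b j * uv.2))) => [|uv _].
      by rewrite exchange_big; apply: eq_bigr => j _; rewrite rmorph_sum scaler_sumr.
    rewrite mulmx_sumr mulmx_suml; apply: eq_bigr => j _.
    by rewrite -scalemxAr -scalemxAl !rmorphM.
  rewrite (bigD1 i) //= big1 ?addr0 => [|j ji]; rewrite tE ?eqxx ?rmorph1 //.
  by rewrite eq_sym (negPf ji) rmorph0 scaler0.
rewrite c0 big1 => [|uv _]; last by rewrite mulmx0 mul0mx.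
move=> /matrixP/(_ (Ordinal n_gt0) (Ordinal n_gt0)).
by rewrite !mxE eqxx mulr1 => <-.
Qed.

Lemma splitting_span (m : 'M[L]_n) : exists c : 'I_(n * n) -> L, m = \sum_i c i *: rho (b i).
Proof.
exists (fun i => (mxvec m *m invmx splitting_basis_mx) 0 i).
apply: (can_inj mxvecK); rewrite -[LHS](mulmxKV splitting_basis_unit) mulmx_sum_row.
by rewrite linear_sum; apply: eq_bigr => i _; rewrite linearZ /= rowK.
Qed.

Lemma splitting_center_scalar z : center z -> is_scalar_mx (rho z).
Proof.
move=> cz; apply: commuting_scalar => m; have [c ->] := splitting_span m.
rewrite mulmx_sumr mulmx_suml; apply: eq_bigr => i _.
rewrite -scalemxAr -scalemxAl; congr (_ *: _).
by rewrite -[LHS]rmorphM -[RHS]rmorphM cz.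
Qed.

Lemma splittingP : splitting rho.
Proof.
split; first exact: splitting_center_scalar.
by move=> m; have [c mE] := splitting_span m; exists (n * n)%N, c, b.
Qed.

End SplittingMap.

Variable sigma : {linear A -> A}.
Hypotheses (sigma_inv : involution sigma) (sigma_first : first_kind sigma).

(* The trace of [sigma] as a linear map over the center; it distinguishes the
   two types without reference to a splitting field. *)
Lemma first_kind_trace : exists s : A, forall (L : fieldType)
    (rho : {rmorphism A -> 'M[L]_n}) (B : 'M[L]_n) (eps : L),
  B \in unitmx -> B^T = eps *: B ->
  (forall a, rho (sigma a) = invmx B *m (rho a)^T *m B) -> rho s = (eps * n%:R)%:M.
Proof.
have [z zP] : {z : 'I_(n * n) -> {ffun 'I_(n * n) -> A} & forall i,
    (forall j, center (z i j)) /\ sigma (b i) = \sum_j z i j * b j}.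
  apply: (@choice _ _ (fun i (z : {ffun 'I_(n * n) -> A}) =>
    (forall j, center (z j)) /\ sigma (b i) = \sum_j z j * b j)) => i.
  by have [z [zP _]] := basis_b (sigma (b i)); exists z.
(* The trace of the matrix of [sigma] in the basis [b], with entries in the center. *)
exists (\sum_i z i i) => L rho B eps uB BT adj.
pose P := splitting_basis_mx rho; have uP : P \in unitmx := splitting_basis_unit rho.
have [l lE] : {l : 'M[L]_(n * n) & forall i j, rho (z i j) = (l i j)%:M}.
  have E ij : exists c, rho (z ij.1 ij.2) = c%:M.
    by apply/is_scalar_mxP/splitting_center_scalar; case: (zP ij.1).
  have [l lE] := choice E.
  by exists (\matrix_(i, j) l (i, j)) => i j; rewrite mxE (lE (i, j)).
pose f : {linear 'M[L]_n -> 'M[L]_n} := mulmxr B \o mulmx (invmx B) \o trmx.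
(* In the basis [rho (b i)] the adjoint map [f] has matrix [l], the image of the central matrix [z];
   so [l] and [lin_mx f] are similar. *)
have PE : P *m lin_mx f = l *m P.
  apply/row_matrixP => i; rewrite !row_mul rowK mul_vec_lin [f _]/= -adj.
  rewrite (zP i).2 rmorph_sum linear_sum mulmx_sum_row; apply: eq_bigr => j _.
  by rewrite !mxE rmorphM /= lE -[X in mxvec X]/(_ *m _) mul_scalar_mx linearZ /= rowK.
have trl : \tr l = eps * n%:R.
  have -> : l = P *m (lin_mx f *m invmx P) by rewrite mulmxA PE mulmxK.
  rewrite mxtrace_mulC mulmxKV // trace_adjoint BT -scalemxAr mulVmx // linearZ /=.
  by rewrite mxtrace1.
rewrite rmorph_sum -trl /mxtrace raddf_sum; apply: eq_bigr => i _; exact: lE.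
Qed.

Section AdjointForm.
Variables (L : fieldType) (rho : {rmorphism A -> 'M[L]_n}).

Lemma first_kind_adjoint : exists (B : 'M[L]_n) (eps : L),
  [/\ B \in unitmx, B^T = eps *: B, eps = 1 \/ eps = -1 &
      forall a, rho (sigma a) = invmx B *m (rho a)^T *m B].
Proof.
have [sigmaM sigmaK] := sigma_inv.
have [f fb] : exists f : {linear 'M[L]_n -> 'M[L]_n},
    forall i, f (rho (b i)) = rho (sigma (b i)).
  pose P := splitting_basis_mx rho; have uP : P \in unitmx := splitting_basis_unit rho.
  pose Q : 'M[L]_(n * n) := \matrix_i mxvec (rho (sigma (b i))).
  (* The rows of [P] and [Q] are the vectorised [rho (b i)] and [rho (sigma (b i))], so right
     multiplication by [invmx P *m Q] carries the former to the latter. *)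
  exists (vec_mx \o mulmxr (invmx P *m Q) \o mxvec) => i /=.
  have -> : mxvec (rho (b i)) = row i P by rewrite rowK.
  by rewrite mulmxA rowE -(mulmxA _ P) mulmxV // mulmx1 -rowE rowK mxvecK.
have fZ (c : 'I_(n * n) -> L) : f (\sum_i c i *: rho (b i)) = \sum_i c i *: rho (sigma (b i)).
  by rewrite linear_sum; apply: eq_bigr => i _; rewrite linearZ fb.
(* The first kind enters here: [sigma] fixes the central coordinates of [a], hence agrees with the
   L-linear [f]. *)
have frho a : f (rho a) = rho (sigma a).
  have [z [[cz ->] _]] := basis_b a.
  rewrite (linear_sum sigma) !rmorph_sum linear_sum; apply: eq_bigr => i _.
  have /is_scalar_mxP[c cE] := splitting_center_scalar rho (cz i).
  have rZ x : rho (z i * x) = c *: rho x by rewrite rmorphM cE -mul_scalar_mx.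
  by rewrite sigmaM (sigma_first (cz i)) -cz !rZ linearZ fb.
have f1 : f 1%:M = 1%:M.
  rewrite -[1%:M]/(1 : 'M[L]_n) -(rmorph1 rho) frho; congr (rho _).
  by have := sigmaM (sigma 1) 1; rewrite mulr1 sigmaK mulr1 => /esym.
have fM m1 m2 : f (m1 *m m2) = f m2 *m f m1.
  have [c1 e1] := splitting_span rho m1; have [c2 e2] := splitting_span rho m2.
  rewrite {1}e1 mulmx_suml linear_sum [in RHS]e1 linear_sum mulmx_sumr; apply: eq_bigr => i _.
  rewrite -scalemxAl !linearZ_LR /=; congr (_ *: _).
  rewrite e2 mulmx_sumr !linear_sum mulmx_suml; apply: eq_bigr => j _.
  rewrite -scalemxAr !linearZ_LR -scalemxAl /=; congr (_ *: _).
  by rewrite -[X in f X]rmorphM !frho sigmaM rmorphM.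
have fK m : f (f m) = m.
  have [c ->] := splitting_span rho m; rewrite fZ linear_sum; apply: eq_bigr => i _.
  by rewrite linearZ frho sigmaK.
pose theta : {linear 'M[L]_n -> 'M[L]_n} := trmx \o f.
have [||H uH HE] := @skolem_noether _ _ theta n_gt0.
- by rewrite /= f1 trmx1.
- by move=> m1 m2; rewrite /= fM trmx_mul.
pose B := invmx H^T.
have uB : B \in unitmx by rewrite unitmx_inv unitmx_tr.
have fE m : f m = invmx B *m m^T *m B.
  have : theta m = invmx H *m m *m H by rewrite -mulmxA -HE mulKmx.
  move=> /(congr1 trmx); rewrite /= trmxK => ->.
  by rewrite !trmx_mul trmx_inv /B invmxK mulmxA.
clearbody B.
(* Expanding [f (f m) = m] shows that [invmx B *m B^T] commutes with every matrix. *)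
have [c cE] : exists c, invmx B *m B^T = c%:M.
  apply/is_scalar_mxP/commuting_scalar => m.
  rewrite -{2}(fK m) !fE !trmx_mul trmxK trmx_inv !mulmxA mulmxK //.
  by rewrite mulmxKV ?unitmx_tr.
have BT : B^T = c *: B by rewrite -mul_mx_scalar -cE mulKVmx.
exists B, c; split=> //; last by move=> a; rewrite -fE frho.
have /matrixP/(_ (Ordinal n_gt0) (Ordinal n_gt0)) : (c * c)%:M = 1%:M :> 'M[L]_n.
  have BB : (c * c) *: B = B by rewrite -{2}[B]trmxK BT linearZ /= BT scalerA.
  by rewrite -[LHS]mulmx1 mul_scalar_mx -{1}(mulmxV uB) scalemxAl BB mulmxV.
rewrite !mxE eqxx => /eqP; rewrite -expr2 sqrf_eq1 => /orP[]/eqP ->; by [left|right].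
Qed.

End AdjointForm.

End Splitting.

(** * Descent, and congruence of bilinear forms *)

Section Descent.
Variables (K : fieldType) (G : Type) (act : G -> {rmorphism K -> K}).

Definition fixed (c : K) : Prop := forall g, act g c = c.

Local Notation supp v := [set i | v ord0 i != 0]%SET.

(* A subspace stable under a group of semilinear maps is spanned by its fixed
   vectors: a vector of minimal support with an entry equal to 1 is fixed. *)
Lemma stable_subspace_fixed (d : nat) (W : set 'rV[K]_d) (phi : 'rV[K]_d -> K) :
  (forall c v w, phi (v + c *: w) = phi v + c * phi w) ->
  (forall c v w, W v -> W w -> W (v + c *: w)) ->
  (forall g v, W v -> W (map_mx (act g) v)) ->
  (forall v, W v -> (forall i, fixed (v ord0 i)) -> phi v = 0) ->
  forall w, W w -> phi w = 0.
Proof.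
move=> phiD WD Wact phi0 w; have phi00 : phi 0 = 0.
  by have := phiD (-1) 0 0; rewrite scaler0 addr0 mulN1r subrr.
move: {2}#|_| (leqnn #|supp w|) => m.
elim: m w => [|m IH] w sw Ww.
  suff -> : w = 0 by [].
  apply/rowP => i; rewrite mxE; apply/eqP/negPn/negP => wi.
  by move: sw; rewrite leqn0 cards_eq0 => /eqP/setP/(_ i); rewrite !inE wi.
have [->//|w0] := eqVneq w 0.
pose P j := `[< exists v, [/\ W v, v != 0, supp v \subset supp w & #|supp v| = j] >].
have exP : exists j, P j by exists #|supp w|; apply/asboolP; exists w.
case: (ex_minnP exP) => j /asboolP[v [Wv v0 svw svj]] minj.
have [i vi] : exists i, v ord0 i != 0.
  apply: contrapT => nv; case/eqP: v0; apply/rowP => i; rewrite mxE.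
  by apply/eqP/negPn/negP => vi; apply: nv; exists i.
have W0 : W 0.
  by have := WD (-1) _ _ Wv Wv; rewrite scaleN1r subrr.
pose u := (v ord0 i)^-1 *: v.
have Wu : W u by have := WD (v ord0 i)^-1 _ _ W0 Wv; rewrite add0r.
have ui : u ord0 i = 1 by rewrite mxE mulVf.
have suv : supp u = supp v.
  by apply/setP => l; rewrite !inE mxE mulf_eq0 invr_eq0 (negPf vi).
have iw : i \in supp w by apply: (fintype.subsetP svw); rewrite inE.
have fix_u l : fixed (u ord0 l).
  move=> g; apply/eqP; rewrite -subr_eq0; apply/negPn/negP => nz.
  pose y := map_mx (act g) u + -1 *: u.
  have Wy : W y by apply: WD => //; exact: Wact.
  have yE a : y ord0 a = act g (u ord0 a) - u ord0 a by rewrite !mxE mulN1r.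
  have syv : supp y \subset supp v :\ i.
    apply/fintype.subsetP => a; rewrite !inE yE => ya; apply/andP; split.
      by apply: contraNneq ya => ->; rewrite ui rmorph1 subrr.
    have : a \in supp v; last by rewrite inE.
    rewrite -suv inE; apply: contraNneq ya => ->; by rewrite rmorph0 subrr.
  have y0 : y != 0.
    by apply: contraNneq nz => y0; rewrite -yE y0 mxE.
  have /minj : P #|supp y|.
    apply/asboolP; exists y; split=> //.
    exact: fintype.subset_trans syv (fintype.subset_trans (subsetDl _ _) svw).
  rewrite -svj (cardsD1 i (supp v)) inE vi add1n ltnNge.
  by rewrite subset_leq_card.
(* [phi u] is 0 since [u] is fixed. The other summand vanishes at [i] and has no support outside
   that of [w], so the induction hypothesis applies to it. *)
have -> : w = (w + - w ord0 i *: u) + w ord0 i *: u by rewrite scaleNr subrK.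
rewrite phiD (phi0 u) // mulr0 addr0.
apply: IH; last exact: WD.
rewrite -ltnS; apply: leq_trans sw; rewrite [X in (_ < X)%N](cardsD1 i) iw add1n ltnS.
apply: subset_leq_card; apply/fintype.subsetP => a; rewrite !inE !mxE => wa.
apply/andP; split.
  apply: contraNneq wa => ->; have := ui; rewrite mxE => ->.
  by rewrite mulr1 addrN.
apply: contraNneq wa => wa0.
have : a \notin supp v by apply/negP => /(fintype.subsetP svw); rewrite inE wa0 eqxx.
by rewrite inE negbK => /eqP ->; rewrite !mulr0 wa0 addr0.
Qed.

Hypothesis act_div : forall g h, exists g', forall u, act g u = act h (act g' u).

(** For fixed [w], [w'] and [e], the coefficient vectors (p, q) satisfying the relation at every g
    form a stable subspace. If the denominator vanished on all of its fixed vectors it would vanish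
    on the whole subspace, against the given pair. *)
Lemma descend_fraction (r s : nat) (w : 'I_r -> K) (w' : 'I_s -> K) (e : K)
    (p : 'I_r -> K) (q : 'I_s -> K) (g1 : G) :
  (forall u, act g1 u = u) ->
  (forall g, \sum_i p i * act g (w i) = act g e * \sum_j q j * act g (w' j)) ->
  \sum_j q j * w' j != 0 ->
  exists (p' : 'I_r -> K) (q' : 'I_s -> K), [/\ forall i, fixed (p' i),
    forall j, fixed (q' j), \sum_i p' i * w i = e * \sum_j q' j * w' j &
    \sum_j q' j * w' j != 0].
Proof.
move=> g1E pq q0.
pose W : set 'rV[K]_(r + s) := [set v | forall g,
  \sum_i v ord0 (lshift s i) * act g (w i) =
  act g e * \sum_j v ord0 (rshift r j) * act g (w' j)].
pose phi (v : 'rV[K]_(r + s)) := \sum_j v ord0 (rshift r j) * w' j.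
apply: contrapT => none; case/eqP: q0.
suff : phi (row_mx (\row_i p i) (\row_j q j)) = 0.
  move=> phi0; rewrite -[RHS]phi0; apply: eq_bigr => j _.
  by rewrite row_mxEr mxE.
apply: (@stable_subspace_fixed _ W).
- move=> c v1 v2; rewrite /phi mulr_sumr -big_split; apply: eq_bigr => j _.
  by rewrite !mxE mulrDl mulrA.
- move=> c v1 v2 W1 W2 g.
  transitivity (\sum_i v1 ord0 (lshift s i) * act g (w i) +
      c * \sum_i v2 ord0 (lshift s i) * act g (w i)).
    rewrite mulr_sumr -big_split; apply: eq_bigr => j _.
    by rewrite !mxE mulrDl mulrA.
  rewrite W1 W2 mulrCA -mulrDr; congr (_ * _).
  rewrite mulr_sumr -big_split; apply: eq_bigr => j _.
  by rewrite !mxE mulrDl mulrA.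
- move=> h v Wv g; have [g' g'E] := act_div g h.
  have := congr1 (act h) (Wv g'); rewrite rmorphM -g'E !rmorph_sum /= => e1.
  rewrite (eq_bigr (fun i => act h (v ord0 (lshift s i) * act g' (w i)))) => [|i _].
    rewrite e1; congr (_ * _); apply: eq_bigr => j _.
    by rewrite rmorphM -g'E mxE.
  by rewrite rmorphM -g'E mxE.
- move=> v Wv fv; apply/eqP/negPn/negP => nz; apply: none.
  exists (fun i => v ord0 (lshift s i)), (fun j => v ord0 (rshift r j)); split=> //.
  have := Wv g1; rewrite g1E.
  by under eq_bigr do rewrite g1E; under [in RHS]eq_bigr do rewrite g1E.
- move=> g; have := pq g.
  rewrite (eq_bigr (fun i => row_mx (\row_i p i) (\row_j q j) ord0 (lshift s i) * act g (w i))) => [->|i _].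
    congr (_ * _); apply: eq_bigr => j _; by rewrite row_mxEr mxE.
  by rewrite row_mxEl mxE.
Qed.

End Descent.

Section GramMatrices.
Variables (k : closedFieldType) (n : nat) (S : 'M[k]_n).
Hypotheses (two_neq0 : (2%:R : k) != 0) (uS : S \in unitmx).

Lemma left_kernel_neq0 (j : nat) (B : 'M[k]_(n, j)) : (j < n)%N ->
  exists2 u : 'rV[k]_n, u != 0 & u *m B = 0.
Proof.
move=> jn; have : kermx B != 0.
  by rewrite -mxrank_eq0 mxrank_ker subn_eq0 -ltnNge (leq_ltn_trans (rank_leq_col B)).
move=> /rowV0Pn[u /sub_kermxP uB u0]; by exists u.
Qed.

Lemma mx11_eq0 (x : 'M[k]_1) : x + x^T = 0 -> x = 0.
Proof.
move=> /matrixP/(_ 0 0); rewrite !mxE -mulr2n -mulr_natl => /eqP.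
rewrite mulf_eq0 (negPf two_neq0) /= => /eqP x0.
by apply/matrixP => i j; rewrite !ord1 x0 mxE.
Qed.

(** Orthonormal rows are added one at a time. If every vector orthogonal to the rows so far were
    isotropic, polarisation would make [u0] orthogonal to the whole space, against invertibility of
    S. A square root in k normalises the new vector. *)
Lemma symmetric_congruent1 : S^T = S -> exists E : 'M[k]_n, E *m S *m E^T = 1%:M.
Proof.
move=> symS; suff : forall j, (j <= n)%N -> exists E : 'M[k]_(j, n), E *m S *m E^T = 1%:M.
  by apply.
elim=> [|j IH] jn; first by exists 0; rewrite [LHS]flatmx0 [RHS]flatmx0.
have [E E1] := IH (ltnW jn).
have [u0 u0n0 u0E] := left_kernel_neq0 (S *m E^T) jn.
have [u [uE un0]] : exists u : 'rV_n, u *m S *m E^T = 0 /\ u *m S *m u^T != 0.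
  apply: contrapT => none.
  have iso (u : 'rV_n) : u *m S *m E^T = 0 -> u *m S *m u^T = 0.
    by move=> uE; apply/eqP/negPn/negP => un0; apply: none; exists u.
  have polar (u v : 'rV_n) : u *m S *m E^T = 0 -> v *m S *m E^T = 0 -> u *m S *m v^T = 0.
    move=> uE vE; apply: mx11_eq0.
    have := iso (u + v); rewrite !mulmxDl uE vE addr0 => /(_ erefl).
    rewrite linearD /= !mulmxDr (iso _ uE) (iso _ vE) add0r addr0 => e.
    by rewrite !trmx_mul trmxK symS mulmxA.
  have u0S (x : 'rV_n) : u0 *m S *m x^T = 0.
    (* Orthogonal projection: x S E^T E lies in the span of the rows of E, to which [u0] is
       orthogonal, and the difference is orthogonal to E because E S E^T = 1. *)
    rewrite -[x](subrK (x *m S *m E^T *m E)) linearD /= mulmxDr.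
    rewrite [X in _ + X](_ : _ = 0) ?addr0; last first.
      by rewrite trmx_mul mulmxA -(mulmxA u0) u0E mul0mx.
    apply: polar; first by rewrite -mulmxA.
    by rewrite !mulmxBl -!(mulmxA (x *m S *m E^T)) E1 mulmx1 subrr.
  case/eqP: u0n0; apply: (can_inj (mulmxK uS)); rewrite mul0mx.
  apply/rowP => i; have /matrixP/(_ 0 0) := u0S (delta_mx 0 i).
  by rewrite trmx_delta -colE !mxE.
pose c := (u *m S *m u^T) 0 0.
have cE : u *m S *m u^T = c%:M by rewrite [LHS]mx11_scalar.
have c0 : c != 0 by apply: contraNneq un0 => c0; rewrite cE c0 raddf0.
have [s sE] : exists s : k, s * s = c.
  have [|s] := closed_rootP ('X^2 - c%:P : {poly k}) _; first by rewrite size_XnsubC.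
  rewrite rootE !hornerE subr_eq0 => /eqP sc; by exists s; rewrite -sc.
have s0 : s != 0 by apply: contraNneq c0 => s0; rewrite -sE s0 mul0r.
rewrite -addn1; exists (col_mx E (s^-1 *: u)).
rewrite mul_col_mx tr_col_mx mul_col_row E1 linearZ /= -!scalemxAl -!scalemxAr cE uE.
have -> : E *m S *m u^T = 0.
  by apply: trmx_inj; rewrite !trmx_mul trmxK symS mulmxA uE trmx0.
rewrite !scaler0 scalerA scale_scalar_mx -sE -invfM mulVf ?mulf_neq0 //.
by rewrite scalar_mx_block.
Qed.

(** The rows of E and F are j mutually orthogonal hyperbolic pairs for the form S. *)
Definition hyperbolic (j : nat) : Prop := exists E F : 'M[k]_(j, n),
  [/\ E *m S *m E^T = 0, F *m S *m F^T = 0 & E *m S *m F^T = 1%:M].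

Lemma hyperbolic_bound j : S^T = - S -> hyperbolic j -> (j + j <= n)%N.
Proof.
move=> skewS [E [F [EE FF EF]]].
have FE : F *m S *m E^T = - 1%:M.
  by apply: trmx_inj; rewrite !trmx_mul trmxK skewS mulNmx mulmxN mulmxA EF linearN /= trmx1.
have : row_free (col_mx E F).
  apply/row_freeP; exists (S *m (col_mx E F)^T *m block_mx 0 (- 1%:M) 1%:M 0).
  rewrite !mulmxA mul_col_mx tr_col_mx mul_col_row EE FF EF FE mulmx_block.
  by rewrite !mul0mx !mulmx0 !mul1mx mulNmx mul1mx opprK !add0r !addr0 scalar_mx_block.
by move=> /eqP <-; exact: rank_leq_col.
Qed.

Lemma skew_hyperbolic : S^T = - S -> exists m, (m + m)%N = n /\ hyperbolic m.
Proof.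
move=> skewS.
have tr_form (a b : nat) (P : 'M_(a, n)) (Q : 'M_(b, n)) : (P *m S *m Q^T)^T = - (Q *m S *m P^T).
  by rewrite !trmx_mul trmxK skewS mulNmx mulmxN mulmxA.
have iso (u : 'rV_n) : u *m S *m u^T = 0.
  by apply: mx11_eq0; rewrite tr_form addrN.
have flip (a b : nat) (P : 'M_(a, n)) (Q : 'M_(b, n)) : P *m S *m Q^T = 0 -> Q *m S *m P^T = 0.
  by move=> e; rewrite -[LHS]opprK -tr_form e trmx0 oppr0.
(* Size n + 1 is impossible by the bound on dimensions, so the enlargement of hyperbolic families
   stops at one that fills the space. *)
suff /(_ n.+1)[|//] : forall j, hyperbolic j \/ exists m, (m + m)%N = n /\ hyperbolic m.
  by move=> /(hyperbolic_bound skewS); rewrite addSn leqNgt ltnS leq_addr.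
elim=> [|j [[E [F [EE FF EF]]]|]]; last by right.
  left; exists 0, 0; split; apply/matrixP => [[]] //.
have hj : hyperbolic j by exists E, F.
have := hyperbolic_bound skewS hj; rewrite leq_eqVlt => /predU1P[jn|jn].
  by right; exists j.
left; have [u u0 uK] := left_kernel_neq0 (S *m (col_mx E F)^T) jn.
move: uK; rewrite mulmxA tr_col_mx mul_mx_row => /eqP; rewrite row_mx_eq0 => /andP[/eqP uE /eqP uF].
have [w0 uw0] : exists w0 : 'rV_n, u *m S *m w0^T = 1%:M.
  have [i ui] : exists i, (u *m S) 0 i != 0.
    apply: contrapT => none; case/eqP: u0; apply: (can_inj (mulmxK uS)).
    rewrite mul0mx; apply/rowP => i; rewrite [RHS]mxE.
    by apply/eqP/negPn/negP => ui; apply: none; exists i.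
  move: (u *m S) ui => y yi; exists ((y 0 i)^-1 *: delta_mx 0 i); rewrite linearZ /= trmx_delta -scalemxAr -colE.
  by rewrite [LHS]mx11_scalar !mxE mulVf.
(* [w0] is corrected by combinations of E and F so as to be orthogonal to both; its pairing with [u]
   is unchanged, as [u] is orthogonal to them. *)
pose w := w0 - w0 *m S *m F^T *m E + w0 *m S *m E^T *m F.
have FE : F *m S *m E^T = - 1%:M by rewrite -[LHS]opprK -tr_form EF trmx1.
have wE : w *m S *m E^T = 0.
  rewrite !(mulmxDl, mulNmx) -!(mulmxA (w0 *m S *m _)) EE FE.
  by rewrite mulmx0 subr0 mulmxN mulmx1 subrr.
have wF : w *m S *m F^T = 0.
  rewrite !(mulmxDl, mulNmx) -!(mulmxA (w0 *m S *m _)) FF EF.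
  by rewrite mulmx0 addr0 mulmx1 subrr.
have uw : u *m S *m w^T = 1%:M.
  have -> : w^T = w0^T - E^T *m (w0 *m S *m F^T)^T + F^T *m (w0 *m S *m E^T)^T.
    by rewrite linearD linearB /= [(_ *m E)^T]trmx_mul [(_ *m F)^T]trmx_mul.
  by rewrite !mulmxDr mulmxN uw0 !(mulmxA (u *m S)) uE uF !mul0mx subr0 addr0.
rewrite -addn1; exists (col_mx E u), (col_mx F w).
split; rewrite mul_col_mx tr_col_mx mul_col_row.
- by rewrite EE uE (flip _ _ _ _ uE) iso block_mx0.
- by rewrite FF wF (flip _ _ _ _ wF) iso block_mx0.
- by rewrite EF uF (flip _ _ _ _ wE) uw scalar_mx_block.
Qed.

Lemma skew_congruent_g0 : S^T = - S ->
  exists m (e : (m + m)%N = n) (E : 'M[k]_n), E *m S *m E^T = g0_mx k e.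
Proof.
move=> skewS; have [m [e [E [F [EE FF EF]]]]] := skew_hyperbolic skewS.
subst n.
exists m, erefl, (col_mx E F); rewrite /g0_mx castmx_id mul_col_mx tr_col_mx mul_col_row.
rewrite EE FF EF; congr block_mx.
by apply: trmx_inj; rewrite !trmx_mul trmxK skewS mulNmx mulmxN mulmxA EF linearN /= trmx1.
Qed.

End GramMatrices.

(** * Invariants and equivariant matrices *)

Section RationalAction.
Variables (k : closedFieldType) (n : nat) (X : funspace k) (act : Ptau k n -> X -> X).
Hypothesis actP : irreducible_Ptau_variety act.

Let varX : variety X := Ptau_variety actP.
Let irrX : irreducible X := Ptau_irreducible actP.
Local Notation K := (function_field (Ptau_variety actP) (Ptau_irreducible actP)).

Definition Kact (g : Ptau k n) (u : K) : K :=
  germ (Ptau_variety actP) (Ptau_irreducible actP) (fun x => ev u (act g x)).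

Lemma ev_Kact g u : in_general_position (fun x => ev (Kact g u) x = ev u (act g x)).
Proof. apply/ev_germ/(rational_act actP); exact: ev_rational. Qed.

Fact Kact_is_zmod_morphism g : zmod_morphism (Kact g).
Proof.
move=> u v; apply: ev_inj; near=> x.
rewrite (near (ev_Kact g (u - v)) x) // (near (ev_add (Kact g u) (- Kact g v)) x) //.
rewrite (near (ev_opp (Kact g v)) x) // (near (ev_Kact g u) x) // (near (ev_Kact g v) x) //.
rewrite (near (general_position_act actP g (ev_add u (- v))) x) //.
by rewrite (near (general_position_act actP g (ev_opp v)) x).
Unshelve. all: end_near. Qed.

Fact Kact_is_monoid_morphism g : monoid_morphism (Kact g).
Proof.
split=> [|u v]; apply: ev_inj; near=> x.
  rewrite (near (ev_Kact g 1) x) // (near (ev_one varX irrX) x) //.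
  by rewrite (near (general_position_act actP g (ev_one varX irrX)) x).
rewrite (near (ev_Kact g (u * v)) x) // (near (ev_mul (Kact g u) (Kact g v)) x) //.
rewrite (near (ev_Kact g u) x) // (near (ev_Kact g v) x) //.
by rewrite (near (general_position_act actP g (ev_mul u v)) x).
Unshelve. all: end_near. Qed.

HB.instance Definition _ g := GRing.isZmodMorphism.Build K K (Kact g) (Kact_is_zmod_morphism g).
HB.instance Definition _ g := GRing.isMonoidMorphism.Build K K (Kact g) (Kact_is_monoid_morphism g).

Lemma Kact1 u : Kact 1%g u = u.
Proof. by apply: ev_inj; apply: filterS (ev_Kact 1%g u) => x ->; rewrite (Ptau_act1 actP). Qed.

Lemma KactM g h u : Kact (g * h)%g u = Kact h (Kact g u).
Proof.
apply: ev_inj; near=> x.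
rewrite (near (ev_Kact (g * h)%g u) x) // (near (ev_Kact h (Kact g u)) x) //.
rewrite (near (general_position_act actP h (ev_Kact g u)) x) //.
by rewrite (Ptau_actM actP).
Unshelve. all: end_near. Qed.

Definition PGL_invariant (c : K) : Prop := forall h, Kact (Ptau_of_PGL h) c = c.

(** Invariance is a generic identity for each fixed h; regularity at both ends makes it hold at x
    itself, so h may depend on x. *)
Lemma PGL_invariant_ev c (h : PGL k n) x : PGL_invariant c ->
  reg_at x (ev c) -> reg_at (act (Ptau_of_PGL h) x) (ev c) ->
  ev c (act (Ptau_of_PGL h) x) = ev c x.
Proof.
move=> cG rx rhx; apply: (reg_at_eq varX (act_reg_at actP rhx) rx).
by apply: filterS (ev_Kact (Ptau_of_PGL h) c) => y; rewrite cG.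
Qed.

End RationalAction.

Section EquivariantMatrices.
Variables (k : closedFieldType) (n : nat) (X : funspace k) (act : Ptau k n -> X -> X).
Hypothesis actP : irreducible_Ptau_variety act.
Variables (A : algType k) (sigma : {linear A -> A}) (phi : A -> X -> 'M[k]_n).
Hypothesis phiP : isomorphic_to_kn sigma act phi.

Local Notation varX := (Ptau_variety actP).
Local Notation irrX := (Ptau_irreducible actP).
Local Notation K := (function_field varX irrX).

Definition phi_regular (a : A) (x : X) : Prop := forall i j, reg_at x (fun y => phi a y i j).

Lemma phi_regularP a : in_general_position (phi_regular a).
Proof. by have [/(rational_map_entries varX)] := iso_kn phiP a. Qed.

Lemma phi_equivariant a (g : GL k n) x : phi_regular a x ->
  phi_regular a (act (Ptau_of_PGL (to_PGL g)) x) ->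
  phi a (act (Ptau_of_PGL (to_PGL g)) x) = g *m phi a x *m invmx g.
Proof.
move=> rx rgx; apply/matrixP => i j; have vX := varX.
apply: (@reg_at_eq _ _ varX x (fun y => phi a (act (Ptau_of_PGL (to_PGL g)) y) i j)
  (fun y => (g *m phi a y *m invmx g) i j)).
- exact: (act_reg_at actP (f := fun y => phi a y i j)).
- under eq_fun do rewrite mxE; apply: reg_at_sum => // l.
  apply: reg_atM => //; last exact: reg_at_cst.
  under eq_fun do rewrite mxE; apply: reg_at_sum => // l'.
  by apply: reg_atM => //; exact: reg_at_cst.
- by have [_ /(_ g)] := iso_kn phiP a; apply: filterS => y ->.
Qed.

Definition rho_fun (a : A) : 'M[K]_n := germ_mx varX irrX (phi a).

Lemma ev_rho_fun a : in_general_position (fun x => evmx (rho_fun a) x = phi a x).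
Proof.
by apply: ev_germ_mx => i j; apply: filterS (phi_regularP a) => x; exact.
Qed.

Fact rho_is_zmod_morphism : zmod_morphism rho_fun.
Proof.
move=> a c; apply: evmx_inj; near=> x.
rewrite (near (ev_rho_fun (a - c)) x) // (near (evmx_sub (rho_fun a) (rho_fun c)) x) //.
rewrite (near (ev_rho_fun a) x) // (near (ev_rho_fun c) x) //.
rewrite (near (iso_add phiP a (- c)) x) // -scaleN1r.
by rewrite (near (iso_scale phiP (-1) c) x) // scaleN1r.
Unshelve. all: end_near. Qed.

Fact rho_is_monoid_morphism : monoid_morphism rho_fun.
Proof.
split=> [|a c]; apply: evmx_inj; near=> x.
  by rewrite (near (ev_rho_fun 1) x) // (near (iso_one phiP) x) // (near (evmx1 varX irrX n) x).
rewrite (near (ev_rho_fun (a * c)) x) // (near (evmx_mul (rho_fun a) (rho_fun c)) x) //.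
by rewrite (near (ev_rho_fun a) x) // (near (ev_rho_fun c) x) // (near (iso_mul phiP a c) x).
Unshelve. all: end_near. Qed.

HB.instance Definition _ := GRing.isZmodMorphism.Build A 'M[K]_n rho_fun rho_is_zmod_morphism.
HB.instance Definition _ := GRing.isMonoidMorphism.Build A 'M[K]_n rho_fun rho_is_monoid_morphism.

Definition rho : {rmorphism A -> 'M[K]_n} := rho_fun.

Lemma ev_rho a : in_general_position (fun x => evmx (rho a) x = phi a x).
Proof. exact: ev_rho_fun. Qed.

Lemma rho_inj : injective rho.
Proof.
move=> a c e; apply: (iso_inj phiP); apply: filterS2 (ev_rho a) (ev_rho c) => x <- <-.
by rewrite e.
Qed.

Lemma ev_rho_sigma a :
  in_general_position (fun x => phi (sigma a) x = (phi a (act (tau k n) x))^T).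
Proof. exact: (iso_sigma phiP a). Qed.

(** The scalar map x |-> c(x) I is equivariant when c is invariant, hence belongs to k_n(X), where
    it is central. *)
Lemma PGL_invariant_center c : (0 < n)%N -> PGL_invariant c ->
  exists2 z, center z & rho z = c%:M.
Proof.
move=> n0 cG; pose f x : 'M[k]_n := (ev c x)%:M; have vX := varX.
have [|a af] := iso_surj phiP (f := f).
  split.
    apply: rational_map_of_entries => //; apply: filterS (ev_rational c) => x rx i j.
    under eq_fun do rewrite mxE; case: (i == j) => //=.
    exact: (reg_at_cst vX).
  move=> g; have := ev_Kact (Ptau_of_PGL (to_PGL g)) c; rewrite cG.
  apply: filterS => x e; rewrite /f -e scalar_mxC -mulmxA mulmxV ?mulmx1 //.
  exact: Defs.GL_unit.
have aE : rho a = c%:M.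
  apply: evmx_inj; near=> x.
  rewrite (near (ev_rho a) x) // (near (evmx_scalar n c) x) //.
  exact: (near af x).
exists a => // a'; apply: rho_inj; rewrite !rmorphM /= aE.
by rewrite -[LHS]/(_ *m _) -[RHS]/(_ *m _) scalar_mxC.
Unshelve. all: end_near. Qed.

Lemma center_PGL_invariant z c : (0 < n)%N -> rho z = c%:M -> PGL_invariant c.
Proof.
move=> n0 zc h; apply: ev_inj; pose i0 := Ordinal n0; rewrite -[h]to_PGLK.
have ec : in_general_position (fun x => phi z x = (ev c x)%:M).
  by apply: filterS2 (ev_rho z) (evmx_scalar n c) => x <-; rewrite zc.
have ech := general_position_act actP (Ptau_of_PGL (to_PGL (repr h))) ec.
have [_ /(_ (repr h)) eqh] := iso_kn phiP z.
near=> x; rewrite (near (ev_Kact (Ptau_of_PGL (to_PGL (repr h))) c) x) //.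
suff /matrixP/(_ i0 i0) : (ev c (act (Ptau_of_PGL (to_PGL (repr h))) x))%:M =
    (ev c x)%:M :> 'M[k]_n by rewrite !mxE eqxx.
rewrite -(near ech x) // (near eqh x) // (near ec x) // scalar_mxC -mulmxA mulmxV ?mulmx1 //.
exact: Defs.GL_unit.
Unshelve. all: end_near. Qed.

End EquivariantMatrices.

(** * Generation of the function field by invariants and the entries of a basis *)

Section Generation.
Variables (k : closedFieldType) (n : nat) (X : funspace k) (act : Ptau k n -> X -> X).
Hypothesis actP : irreducible_Ptau_variety act.
Variables (A : algType k) (sigma : {linear A -> A}) (phi : A -> X -> 'M[k]_n).
Hypothesis phiP : isomorphic_to_kn sigma act phi.
Variable b : 'I_(n * n) -> A.
Hypotheses (simpA : simple A) (basis_b : center_basis b) (n_gt0 : (0 < n)%N).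
Hypothesis sigma_first : first_kind sigma.

Local Notation varX := (Ptau_variety actP).
Local Notation irrX := (Ptau_irreducible actP).
Local Notation K := (function_field varX irrX).
Local Notation rho := (rho actP phiP).
Local Notation actPGL h := (act (Ptau_of_PGL h)).
Local Notation KactPGL h := (Kact (Ptau_of_PGL h)).

(* [y = h tau x], and the elements of [A] take the same values at [x] and [y];
   the aim is that generically [y = x]. *)
Definition twins (x y : X) : Prop :=
  (exists h : PGL k n, y = actPGL h (act (tau k n) x)) /\
  forall i, phi (b i) y = phi (b i) x.

(** Both points are required to lie in [O], since values of [u] are meaningful only in general
    position. In this form the condition is stable under the field operations. *)
Definition twin_invariant (u : K) : Prop := exists O : X -> Prop,
  in_general_position O /\ forall x y, O x -> O y -> twins x y -> ev u x = ev u y.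

Lemma twin_invariant2 (u v w : K) (op : k -> k -> k) :
  in_general_position (fun x => ev w x = op (ev u x) (ev v x)) ->
  twin_invariant u -> twin_invariant v -> twin_invariant w.
Proof.
move=> e [O [gO Ou]] [O' [gO' Ov]].
exists (fun x => [/\ O x, O' x & ev w x = op (ev u x) (ev v x)]).
split=> [|x y [Ox O'x ->] [Oy O'y ->] xy]; last by rewrite (Ou x y) // (Ov x y).
by apply: filterS3 gO gO' e => x.
Qed.

Lemma twin_invariantD u v : twin_invariant u -> twin_invariant v -> twin_invariant (u + v).
Proof. exact/twin_invariant2/ev_add. Qed.

Lemma twin_invariantM u v : twin_invariant u -> twin_invariant v -> twin_invariant (u * v).
Proof. exact/twin_invariant2/ev_mul. Qed.

Lemma twin_invariantV u : twin_invariant u -> twin_invariant u^-1.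
Proof.
by move=> ru; apply: (@twin_invariant2 u u _ (fun x _ => x^-1)) => //; exact: ev_inv.
Qed.

Lemma twin_invariant0 : twin_invariant 0.
Proof.
exists (fun x => ev (0 : K) x = 0); split; first exact: ev_zero.
by move=> x y -> ->.
Qed.

Lemma twin_invariant1 : twin_invariant 1.
Proof.
exists (fun x => ev (1 : K) x = 1); split; first exact: ev_one.
by move=> x y -> ->.
Qed.

Lemma twin_invariant_sum (I : Type) (r : seq I) (P : pred I) (u : I -> K) :
  (forall i, twin_invariant (u i)) -> twin_invariant (\sum_(i <- r | P i) u i).
Proof.
move=> ru; apply: big_ind => //; [exact: twin_invariant0|exact: twin_invariantD].
Qed.

(** For the central z that is the scalar c, [sigma z = z] evaluated at x reads c(tau x) = c(x),
    scalar matrices being symmetric. *)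
Lemma tau_invariant (c : K) : PGL_invariant c -> Kact (tau k n) c = c.
Proof.
move=> /(PGL_invariant_center phiP n_gt0)[z cz zc].
apply: ev_inj; pose i0 := Ordinal n_gt0.
have ec : in_general_position (fun x => phi z x = (ev c x)%:M).
  by apply: filterS2 (ev_rho actP phiP z) (evmx_scalar n c) => y <-; rewrite zc.
have ect := general_position_act actP (tau k n) ec.
near=> x.
rewrite (near (ev_Kact (tau k n) c) x) //.
suff /matrixP/(_ i0 i0) : (ev c (act (tau k n) x))%:M = (ev c x)%:M :> 'M[k]_n.
  by rewrite !mxE eqxx.
rewrite -[LHS]tr_scalar_mx -(near ect x) // -(near ec x) //.
by rewrite -(near (ev_rho_sigma phiP z) x) // sigma_first.
Unshelve. all: end_near. Qed.

(** The orbit clause of [twins] serves here: c(h tau x) = c(tau x) = c(x). *)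
Lemma twin_invariant_PGL (c : K) : PGL_invariant c -> twin_invariant c.
Proof.
move=> cG; exists (fun x => [/\ reg_at x (ev c), reg_at (act (tau k n) x) (ev c) &
  ev c (act (tau k n) x) = ev c x]); split.
  have rc := ev_rational c; have rct := general_position_act actP (tau k n) rc.
  have := ev_Kact (tau k n) c; rewrite tau_invariant // => ec.
  by apply: filterS3 rc rct ec => x r1 r2 ->.
move=> x y [rx rtx e] [ry _ _] [[h yE] _].
by rewrite yE (PGL_invariant_ev cG) // -?yE.
Qed.

Lemma twin_invariant_entry l i j : twin_invariant (rho (b l) i j).
Proof.
exists (fun x => evmx (rho (b l)) x = phi (b l) x); split; first exact: ev_rho.
move=> x y /matrixP/(_ i j) ex /matrixP/(_ i j) ey [_ /(_ l)/matrixP/(_ i j) e].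
by move: ex ey; rewrite !mxE e => -> ->.
Qed.

(** The coefficients are arbitrary elements of K that do not move with h; only the translated
    functions are known to be twin invariant. Descent later replaces the coefficients by
    invariants. *)
Definition orbit_polynomial (T : PGL k n -> K) : Prop := exists s : seq (K * K),
  (forall pw, pw \in s -> twin_invariant pw.2) /\
  forall h, T h = \sum_(pw <- s) pw.1 * KactPGL h pw.2.

Lemma orbit_polynomial_cst c : orbit_polynomial (fun _ => c).
Proof.
exists [:: (c, 1)]; split=> [pw|h]; last by rewrite big_seq1 rmorph1 mulr1.
by rewrite inE => /eqP ->; exact: twin_invariant1.
Qed.

Lemma orbit_polynomial_orbit w : twin_invariant w -> orbit_polynomial (fun h => KactPGL h w).
Proof.
move=> tw; exists [:: (1, w)]; split=> [pw|h]; last by rewrite big_seq1 mul1r.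
by rewrite inE => /eqP ->.
Qed.

Lemma orbit_polynomialD T U : orbit_polynomial T -> orbit_polynomial U ->
  orbit_polynomial (fun h => T h + U h).
Proof.
move=> [s [ts sE]] [t [tt tE]]; exists (s ++ t); split=> [pw|h].
  by rewrite mem_cat => /orP[/ts|/tt].
by rewrite big_cat /= sE tE.
Qed.

Lemma orbit_polynomialM T U : orbit_polynomial T -> orbit_polynomial U ->
  orbit_polynomial (fun h => T h * U h).
Proof.
move=> [s [ts sE]] [t [tt tE]].
exists [seq (x.1 * y.1, x.2 * y.2) | x <- s, y <- t]; split=> [pw|h].
  by move=> /allpairsP[[x y] [/ts tx /tt ty ->]]; exact: twin_invariantM.
rewrite sE tE big_allpairs_dep big_distrlr /=; apply: eq_bigr => x _; apply: eq_bigr => y _.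
by rewrite rmorphM /= mulrACA.
Qed.

Lemma orbit_polynomial_sum (I : Type) (r : seq I) (P : pred I) (T : I -> PGL k n -> K) :
  (forall i, orbit_polynomial (T i)) -> orbit_polynomial (fun h => \sum_(i <- r | P i) T i h).
Proof.
move=> oT; elim: r => [|i r IH].
  by under eq_fun do rewrite big_nil; exact: orbit_polynomial_cst.
under eq_fun do rewrite big_cons; case: (P i) => //.
exact: orbit_polynomialD.
Qed.

Let i0 : 'I_n := Ordinal n_gt0.

Lemma unit_coordinates : exists beta : 'I_n -> 'I_(n * n) -> K,
  forall i, delta_mx i i0 = \sum_l beta i l *: rho (b l).
Proof.
have [beta betaE] := choice (fun i => splitting_span simpA basis_b n_gt0 rho (delta_mx i i0)).
by exists beta.
Qed.

Section OrbitMatrix.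
Variable beta : 'I_n -> 'I_(n * n) -> K.
Hypothesis betaE : forall i, delta_mx i i0 = \sum_l beta i l *: rho (b l).

Definition orbit_mx (h : PGL k n) : 'M[K]_n :=
  \matrix_(a, i) \sum_l beta i l * KactPGL h (rho (b l) a i0).

(* On the orbit of [x] the element [h] is recovered, up to a scalar, as a linear
   function of the values at [h x]: column [i] of the matrix below is the column
   [i0] of [h E_{i i0} h^-1]. *)
Lemma ev_orbit_mx h : in_general_position (fun x =>
  evmx (orbit_mx h) x = invmx (GL_mx (repr h)) i0 i0 *: GL_mx (repr h)).
Proof.
pose g := repr h; have hE : to_PGL g = h by exact: to_PGLK.
have C1 : in_general_position (fun x => forall l,
    phi (b l) (actPGL h x) = g *m phi (b l) x *m invmx g).
  apply: general_position_forall => l; have [_ /(_ g)] := iso_kn phiP (b l).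
  by rewrite hE.
have C2 : in_general_position (fun x => forall l, evmx (rho (b l)) x = phi (b l) x).
  by apply: general_position_forall => l; exact: ev_rho.
have C3 := general_position_act actP (Ptau_of_PGL h) C2.
have C4 : in_general_position (fun x => forall l a,
    ev (KactPGL h (rho (b l) a i0)) x = ev (rho (b l) a i0) (actPGL h x)).
  by apply: general_position_forall => l; apply: general_position_forall => a; exact: ev_Kact.
have C5 : in_general_position (fun x => forall a i, ev (orbit_mx h a i) x =
    \sum_l ev (beta i l) x * ev (KactPGL h (rho (b l) a i0)) x).
  apply: general_position_forall => a; apply: general_position_forall => i.
  rewrite mxE; pose t l := beta i l * KactPGL h (rho (b l) a i0).
  have e1 := ev_sum (index_enum 'I_(n * n)) xpredT t.
  have e2 : in_general_position (fun x => forall l,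
      ev (t l) x = ev (beta i l) x * ev (KactPGL h (rho (b l) a i0)) x).
    by apply: general_position_forall => l; exact: ev_mul.
  by apply: filterS2 e1 e2 => x -> e; apply: eq_bigr => l _.
have C6 : in_general_position (fun x => forall i r s,
    (delta_mx i i0 : 'M[k]_n) r s = \sum_l ev (beta i l) x * ev (rho (b l) r s) x).
  apply: general_position_forall => i; apply: general_position_forall => r.
  apply: general_position_forall => s.
  have /matrixP/(_ r s) := betaE i; rewrite summxE => e.
  have e1 := ev_sum (index_enum 'I_(n * n)) xpredT (fun l => (beta i l *: rho (b l)) r s).
  rewrite -e in e1.
  have e2 : in_general_position (fun x => forall l,
      ev ((beta i l *: rho (b l)) r s) x = ev (beta i l) x * ev (rho (b l) r s) x).
    by apply: general_position_forall => l; rewrite mxE; exact: ev_mul.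
  have e3 := ev_zero varX irrX; have e4 := ev_one varX irrX.
  have e34 : in_general_position (fun x =>
      ev ((delta_mx i i0 : 'M[K]_n) r s) x = (delta_mx i i0 : 'M[k]_n) r s).
    by apply: filterS2 e3 e4 => x; rewrite !mxE; case: (_ && _).
  apply: filterS3 e1 e2 e34 => x E1 E2 <-; rewrite E1; exact: eq_bigr.
have C123 : in_general_position (fun x => forall l, evmx (rho (b l)) (actPGL h x) = g *m evmx (rho (b l)) x *m invmx g).
  by apply: filterS3 C1 C2 C3 => x E1 E2 E3 l; rewrite E3 E1 E2.
have C7 : in_general_position (fun x => forall i a,
    \sum_l ev (beta i l) x * evmx (rho (b l)) (actPGL h x) a i0 =
    (GL_mx g *m delta_mx i i0 *m invmx g) a i0).
  apply: filterS2 C123 C6 => x E E6 i a.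
  have -> : delta_mx i i0 = \sum_l ev (beta i l) x *: evmx (rho (b l)) x.
    by apply/matrixP => r s; rewrite E6 summxE; apply: eq_bigr => l _; rewrite !mxE.
  rewrite mulmx_sumr mulmx_suml summxE; apply: eq_bigr => l _.
  by rewrite -scalemxAr -scalemxAl E [RHS]mxE.
apply: filterS3 C4 C5 C7 => x E4 E5 E7; apply/matrixP => a i.
rewrite [LHS]mxE E5 [RHS]mxE.
transitivity ((GL_mx g *m delta_mx i i0 *m invmx g) a i0).
  by rewrite -E7; apply: eq_bigr => l _; congr (_ * _); rewrite E4 [RHS]mxE.
(* Factoring E_{i i0} as a column times a row gives g_{ai} (g^-1)_{i0 i0} for this entry. *)
rewrite -(mul_delta_mx (0 : 'I_1)) mulmxA -colE -mulmxA -rowE !mxE big_ord1 !mxE.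
exact: mulrC.
Qed.

(** Substituting the orbit matrix for the matrix variable: its entries are combinations of
    translates of the twin invariant entries of [rho (b l)], while the functions of x alone are
    constant in h. *)
Lemma joint_orbit_polynomial x0 (f : 'M[k]_n * X -> k) : joint_function x0 f ->
  (forall h, rational (fun x => f (evmx (orbit_mx h) x, x))) /\
  orbit_polynomial (fun h => germ varX irrX (fun x => f (evmx (orbit_mx h) x, x))).
Proof.
have vX := varX; have iX := irrX.
have germ_op (op : k -> k -> k) (opK : K -> K -> K) (f1 f2 : PGL k n -> X -> k) :
    (forall u v, in_general_position (fun x => ev (opK u v) x = op (ev u x) (ev v x))) ->
    (forall h, rational (f1 h)) -> (forall h, rational (f2 h)) ->
    (forall h, rational (fun x => op (f1 h x) (f2 h x))) ->
    (fun h => germ varX irrX (fun x => op (f1 h x) (f2 h x))) =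
    (fun h => opK (germ varX irrX (f1 h)) (germ varX irrX (f2 h))).
  move=> opE r1 r2 r12; apply/funext => h; apply: ev_germ_inj => //.
  have := opE (germ varX irrX (f1 h)) (germ varX irrX (f2 h)).
  by apply: filterS3 (ev_germ varX irrX (r1 h)) (ev_germ varX irrX (r2 h)) => x -> -> ->.
elim=> [r s|v rv|f1 f2 _ [r1 o1] _ [r2 o2]|f1 f2 _ [r1 o1] _ [r2 o2]] /=.
- have E h : (fun x => evmx (orbit_mx h) x r s) = ev (orbit_mx h r s).
    by apply/funext => x; rewrite mxE.
  split=> [h|]; first by rewrite E; exact: ev_rational.
  have -> : (fun h => germ varX irrX (fun x => evmx (orbit_mx h) x r s)) = fun h => orbit_mx h r s.
    apply/funext => h; rewrite E; apply: ev_germ_inj; first exact: ev_rational.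
    exact: filterE.
  under eq_fun do rewrite mxE; apply: orbit_polynomial_sum => l.
  apply: orbit_polynomialM; first exact: orbit_polynomial_cst.
  by apply: orbit_polynomial_orbit; exact: twin_invariant_entry.
- split=> [_|]; last exact: orbit_polynomial_cst.
  have := reg_at_near rv; rewrite /prop_near1 nbhsE => -[W [oW Wx] Wr].
  apply: filterS Wr _; apply: general_position_open => //; by exists x0.
- split=> [h|]; first exact: rationalD.
  rewrite (germ_op +%R +%R) //; [exact: orbit_polynomialD|exact: ev_add|].
  by move=> h; exact: rationalD.
- split=> [h|]; first exact: rationalM.
  rewrite (germ_op *%R *%R) //; [exact: orbit_polynomialM|exact: ev_mul|].
  by move=> h; exact: rationalM.
Qed.

End OrbitMatrix.

Lemma to_PGL_insubdZ (h : PGL k n) c :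
  c *: GL_mx (repr h) \in unitmx -> to_PGL (insubd (GL_one k n) (c *: GL_mx (repr h))) = h.
Proof.
move=> u; rewrite -[RHS]to_PGLK; apply/to_PGLP; exists c; last by rewrite insubd_GL.
by apply: contraTneq u => ->; rewrite unitmxE detZ expr0n (gtn_eqF n_gt0) mul0r unitr0.
Qed.

(* Every rational function [u] becomes, along the orbits of [PGL_n], a fraction
   in the entries of the basis whose coefficients descend to invariants. *)
Lemma twin_invariant_all (u : K) : twin_invariant u.
Proof.
have vX := varX; have iX := irrX.
have [beta betaE] := unit_coordinates.
have [x0 rx0] := general_position_ex irrX.1 (ev_rational u).
have e1 : (to_PGL (insubd (GL_one k n) 1%:M), false) = 1%g :> Ptau k n.
  congr (_, _); apply: congr1; apply: val_inj; rewrite /= insubd_GL //; exact: unitmx1.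
have [|P [R [CP CR R0 fR]]] := act_regular_fraction actP (m0 := 1%:M) (b := false)
    (x0 := x0) (f := ev u) (unitmx1 _ _).
  by rewrite e1 (Ptau_act1 actP).
have algC := joint_algebra n x0 vX.
(* The determinant makes D vanish at singular matrices, in particular at the orbit matrix of an h
   whose scalar factor is 0. *)
pose D (i : 'M[k]_n * X) := R i * \det i.1; pose N (i : 'M[k]_n * X) := P i * \det i.1.
have Cdet : joint_function x0 (fun i : 'M[k]_n * X => \det i.1).
  by apply: (fun_alg_det algC) => r s; exact: joint_entry.
have CD : joint_function x0 D by exact: joint_mul.
have CN : joint_function x0 N by exact: joint_mul.
have D0 : D (1%:M, x0) != 0 by rewrite /D /= det1 mulr1.
have DE m x : D (m, x) != 0 -> m \in unitmx /\
    ev u (act (to_PGL (insubd (GL_one k n) m), false) x) * D (m, x) = N (m, x).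
  rewrite /D /N /= mulf_eq0 negb_or => /andP[Rx dm]; split; first by rewrite unitmxE unitfE.
  by rewrite mulrA (fR (m, x)).
have [rD oD] := joint_orbit_polynomial beta CD.
have [rN oN] := joint_orbit_polynomial beta CN.
set TD := fun h => germ _ _ _ in oD; set TN := fun h => germ _ _ _ in oN.
(* The extra factor [TD h] makes both sides 0 where D vanishes; elsewhere the orbit matrix
   represents h and the fraction describes u at h x. *)
have rel h : TN h * TD h = KactPGL h u * (TD h * TD h).
  apply: ev_inj; near=> x.
  rewrite (near (ev_mul (TN h) (TD h)) x) // (near (ev_mul (KactPGL h u) (TD h * TD h)) x) //.
  rewrite (near (ev_mul (TD h) (TD h)) x) // (near (ev_germ varX irrX (rD h)) x) //.
  rewrite (near (ev_germ varX irrX (rN h)) x) // (near (ev_Kact (Ptau_of_PGL h) u) x) //.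
  rewrite (near (ev_orbit_mx betaE h) x) //.
  set M := _ *: _; have [->|DM] := eqVneq (D (M, x)) 0; first by rewrite !mulr0.
  have [uM <-] := DE _ _ DM; rewrite to_PGL_insubdZ // -!mulrA; congr (_ * _).
(* At h = 1 the scalar factor cancels the chosen representative of 1 and the orbit matrix is the
   identity, where D is nonzero at [x0]. *)
have TD1 : TD 1%g * TD 1%g != 0.
  suff TD1 : TD 1%g != 0 by rewrite mulf_neq0.
  apply: contraNneq D0 => TD1; apply/eqP.
  apply: (reg_at_eq0 vX (joint_reg_at vX 1%:M CD)).
  have [c c0 reprE] := to_PGL_repr (GL_one k n).
  near=> x; rewrite -[RHS](near (ev_zero varX irrX) x) // -TD1.
  rewrite (near (ev_germ varX irrX (rD 1%g)) x) //.
  rewrite (near (ev_orbit_mx betaE 1%g) x) // reprE /=.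
  rewrite invmxZ ?unitmxZ ?unitfE ?unitmx1 // invmx1 !mxE eqxx mulr1.
  by rewrite scalerA mulVf // scale1r.
have [s [ts sE]] := orbit_polynomialM oN oD; have [t [tt tE]] := orbit_polynomialM oD oD.
pose z : K * K := (0, 0).
have sE' h : TN h * TD h = \sum_(i < size s) (nth z s i).1 * KactPGL h (nth z s i).2.
  by rewrite sE (big_nth z) big_mkord.
have tE' h : TD h * TD h = \sum_(i < size t) (nth z t i).1 * KactPGL h (nth z t i).2.
  by rewrite tE (big_nth z) big_mkord.
have Kact_id (v : K) : KactPGL 1%g v = v by exact: Kact1.
have [|||p' [q' [fp fq pq q0]]] := @descend_fraction K (PGL k n) (fun h => KactPGL h) _ _ _
    (fun i : 'I_(size s) => (nth z s i).2) (fun i : 'I_(size t) => (nth z t i).2) u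
    (fun i => (nth z s i).1) (fun i => (nth z t i).1) 1%g Kact_id.
- move=> g h; exists (g * h^-1)%g => v.
  transitivity (KactPGL h (KactPGL (g * h^-1)%g v)) => //; rewrite -KactM.
  by congr (Kact _ _); rewrite -[RHS]/(Ptau_of_PGL (g * h^-1 * h)%g) mulgVK.
- by move=> h; rewrite -sE' rel tE'.
- by move: TD1; rewrite tE'; under eq_bigr do rewrite Kact_id.
have tinv c : PGL_invariant c -> twin_invariant c by exact: twin_invariant_PGL.
have -> : u = (\sum_i p' i * (nth z s i).2) * (\sum_j q' j * (nth z t j).2)^-1.
  by rewrite pq mulfK.
apply: twin_invariantM; last apply: twin_invariantV.
- apply: twin_invariant_sum => i; apply: twin_invariantM; first exact: tinv (fp i).
  by apply: ts; exact: mem_nth.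
- apply: twin_invariant_sum => i; apply: twin_invariantM; first exact: tinv (fq i).
  by apply: tt; exact: mem_nth.
Unshelve. all: end_near. Qed.

End Generation.

(** * The stabilizer in general position *)

Lemma invmx_mul (F : fieldType) n (P Q : 'M[F]_n) : P \in unitmx -> Q \in unitmx ->
  invmx (P *m Q) = invmx Q *m invmx P.
Proof.
move=> uP uQ; have uPQ : P *m Q \in unitmx by rewrite unitmx_mul uP.
by apply: (can_inj (mulKmx uPQ)); rewrite mulmxV // mulmxA mulmxK // mulmxV.
Qed.

Lemma tau_mul (k : fieldType) n (h : PGL k n) :
  (tau k n * Ptau_of_PGL h = Ptau_of_PGL (PGL_tau h) * tau k n)%g.
Proof. by rewrite -tau_conj mulgVK. Qed.

Lemma Ptau_of_PGLM (k : fieldType) n (g h : PGL k n) :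
  Ptau_of_PGL (g * h)%g = (Ptau_of_PGL g * Ptau_of_PGL h)%g.
Proof. by []. Qed.

Lemma Ptau_tauE (k : fieldType) n (h : PGL k n) : (h, true) = (Ptau_of_PGL h * tau k n)%g.
Proof. by congr (_, _); rewrite -[RHS]/(h * 1)%g mulg1. Qed.

Section GenericStabilizer.
Variables (k : closedFieldType) (n : nat) (X : funspace k) (act : Ptau k n -> X -> X).
Hypothesis actP : irreducible_Ptau_variety act.
Variables (A : algType k) (sigma : {linear A -> A}) (phi : A -> X -> 'M[k]_n).
Hypothesis phiP : isomorphic_to_kn sigma act phi.
Variable b : 'I_(n * n) -> A.
Hypotheses (simpA : simple A) (basis_b : center_basis b) (n_gt0 : (0 < n)%N).

Local Notation varX := (Ptau_variety actP).
Local Notation irrX := (Ptau_irreducible actP).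
Local Notation K := (function_field varX irrX).
Local Notation rho := (rho actP phiP).
Local Notation actPGL h := (act (Ptau_of_PGL h)).

Lemma second_kind_stabilizer : second_kind sigma ->
  in_general_position (fun x => forall h : PGL k n, act (h, true) x <> x).
Proof.
move=> /existsNP[z /not_implyP[cz sz]].
have /is_scalar_mxP[c zc] := splitting_center_scalar simpA basis_b n_gt0 rho cz.
have cG := center_PGL_invariant n_gt0 zc.
pose i0 := Ordinal n_gt0.
have ez : in_general_position (fun x => phi z x = (ev c x)%:M).
  by apply: filterS2 (ev_rho actP phiP z) (evmx_scalar n c) => y <-; rewrite zc.
have ezt := general_position_act actP (tau k n) ez.
have ct : Kact (tau k n) c - c != 0.
  rewrite subr_eq0; apply/eqP => ctc; apply: sz; apply: (rho_inj (actP := actP) (phiP := phiP)).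
  apply: evmx_inj; near=> x.
  rewrite (near (ev_rho actP phiP z) x) // (near (ev_rho actP phiP (sigma z)) x) //.
  rewrite (near (ev_rho_sigma phiP z) x) // (near ezt x) // (near ez x) // tr_scalar_mx.
  by rewrite -(near (ev_Kact (tau k n) c) x) // ctc.
have rc := ev_rational c; have rct := general_position_act actP (tau k n) rc.
have e1 := ev_add (Kact (tau k n) c) (- c); have e2 := ev_opp c.
near=> x => h hx.
have : ev (Kact (tau k n) c - c) x != 0 by exact: (near (ev_neq0 ct) x).
rewrite (near e1 x) // (near e2 x) // (near (ev_Kact (tau k n) c) x) // subr_eq0 eq_sym.
case/eqP.
have hE : act (h, true) x = actPGL h (act (tau k n) x).
  by rewrite -(Ptau_actM actP) Ptau_tauE.
rewrite -{1}hx hE; apply: (PGL_invariant_ev cG); first exact: (near rct x).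
by rewrite -hE hx; exact: (near rc x).
Unshelve. all: end_near. Qed.

Hypothesis sigma_first : first_kind sigma.

Section Adjoint.
Variables (B : 'M[K]_n) (uB : B \in unitmx).
Hypothesis adj : forall a, rho (sigma a) = invmx B *m (rho a)^T *m B.

Lemma ev_adjoint a : in_general_position (fun x =>
  phi a (act (tau k n) x) = (evmx B x)^T *m phi a x *m invmx (evmx B x)^T).
Proof.
have uBx := evmx_unit uB.
have e1 := ev_rho actP phiP (sigma a); have e2 := ev_rho actP phiP a.
have e3 := evmx_mul (invmx B *m (rho a)^T) B; rewrite -adj in e3.
have e4 := evmx_mul (invmx B) (rho a)^T; have e5 := ev_rho_sigma phiP a.
near=> x; apply: trmx_inj; rewrite -(near e5 x) // -(near e1 x) // (near e3 x) //.
rewrite (near e4 x) // evmx_tr (near e2 x) //.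
have [|ux ->] := near uBx x; first by [].
by rewrite !trmx_mul -trmx_inv !trmxK mulmxA.
Unshelve. all: end_near. Qed.

Lemma first_kind_stabilizer : in_general_position (fun x =>
  exists S : GL k n, GL_mx S = invmx (evmx B x)^T /\ act (to_PGL S, true) x = x).
Proof.
have [x0 _] := irrX.1; have vX := varX.
have [U [N [c [oU Ux0 rc sep]]]] := separating_chart vX x0.
have gU : in_general_position U by apply: general_position_open => //; [exact: irrX|exists x0].
have rat i : rational (c i) by apply: filterS gU => x Ux; exact: rc.
have [O' O'P] : {O' : 'I_N -> X -> Prop & forall i, in_general_position (O' i) /\
    forall x y, O' i x -> O' i y -> twins act phi b x y ->
      ev (germ varX irrX (c i)) x = ev (germ varX irrX (c i)) y}.
  apply: (@choice _ _ (fun i O => in_general_position O /\ forall x y, O x -> O y ->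
    twins act phi b x y -> ev (germ varX irrX (c i)) x = ev (germ varX irrX (c i)) y)) => i.
  exact: (twin_invariant_all phiP simpA basis_b n_gt0 sigma_first).
have gO' : in_general_position (fun x => forall i, O' i x).
  by apply: general_position_forall => i; case: (O'P i).
have gc : in_general_position (fun x => forall i, ev (germ varX irrX (c i)) x = c i x).
  by apply: general_position_forall => i; exact: ev_germ.
have gphi : in_general_position (fun x => forall i, phi_regular phi (b i) x).
  by apply: general_position_forall => i; exact: (phi_regularP actP phiP).
have /general_position_openP[O [oO gO OP]] : in_general_position (fun x =>
    [/\ U x, forall i, O' i x, forall i, ev (germ varX irrX (c i)) x = c i x &
        forall i, phi_regular phi (b i) x]).
  by near=> x; split; [exact: (near gU x)|exact: (near gO' x)|exact: (near gc x)|exact: (near gphi x)].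
have gOt := general_position_act actP (tau k n) gO.
have gadj : in_general_position (fun x => forall i, phi (b i) (act (tau k n) x) =
    (evmx B x)^T *m phi (b i) x *m invmx (evmx B x)^T).
  by apply: general_position_forall => i; exact: ev_adjoint.
have uBx := evmx_unit uB.
near=> x; have [|ux _] := near uBx x; first by [].
have Ox : O x by exact: (near gO x).
have Otx : O (act (tau k n) x) by exact: (near gOt x).
have adjx i := near gadj x _ i.
have uh : (evmx B x)^T \in unitmx by rewrite unitmx_tr.
pose h : GL k n := MkGL uh; pose S := GL_inv h; exists S; split=> //.
have SE : act (to_PGL S, true) x = actPGL (to_PGL S) (act (tau k n) x).
  by rewrite -(Ptau_actM actP) Ptau_tauE.
rewrite SE; set y := actPGL _ _.
have hS : (to_PGL h * to_PGL S)%g = 1%g.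
  rewrite -[LHS]/(PGL_mul _ _) to_PGL_mul; congr to_PGL; apply: val_inj.
  by rewrite /= mulmxV.
(* Here h y = tau x lies in [O], so the orbit of y meets [O], as does that of x; one g then brings
   both points into [O]. *)
have Ohy : O (actPGL (to_PGL h) y).
  rewrite /y -(Ptau_actM actP) -[(_ * _)%g]/(Ptau_of_PGL (to_PGL h * to_PGL S)%g) hS.
  by rewrite (Ptau_act1 actP).
have Ox1 : O (actPGL 1%g x) by rewrite (Ptau_act1 actP).
have [g0 [Ogx Ogy]] := orbits_meet actP oO Ox1 Ohy.
pose g := repr g0; have gE : to_PGL g = g0 by exact: to_PGLK.
rewrite -gE in Ogx Ogy.
suff e : actPGL (to_PGL g) y = actPGL (to_PGL g) x.
  by rewrite -[y](actK actP (Ptau_of_PGL (to_PGL g))) e actK.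
have [Ugx O'gx cgx rgx] := OP _ Ogx; have [Ugy O'gy cgy rgy] := OP _ Ogy.
have [_ _ _ rx] := OP _ Ox; have [_ _ _ rtx] := OP _ Otx.
apply: sep => // i; rewrite -cgx -cgy; symmetry; apply: (O'P i).2 => //; split.
  exists (to_PGL g * to_PGL S * (PGL_tau (to_PGL g))^-1)%g.
  rewrite /y -!(Ptau_actM actP) -[(_ * tau k n * _)%g]mulgA tau_mul !mulgA -!Ptau_of_PGLM -(mulgA (to_PGL g * _)%g).
  by rewrite mulVg mulg1.
move=> l; rewrite [RHS](phi_equivariant actP phiP) //.
(* Since g y = (g S) tau x, equivariance is applied from tau x, where [b] is regular, instead of
   from y, where regularity is not known. *)
have yE : actPGL (to_PGL g) y = actPGL (to_PGL (GL_mul g S)) (act (tau k n) x).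
  rewrite /y -(Ptau_actM actP) -[(_ * _)%g]/(Ptau_of_PGL (to_PGL g * to_PGL S)%g).
  by rewrite -[(_ * _)%g]/(PGL_mul _ _) to_PGL_mul.
have rgy' := rgy l; rewrite yE in rgy' *.
rewrite (phi_equivariant actP phiP) // adjx //=.
have uS : invmx (evmx B x)^T \in unitmx by rewrite unitmx_inv.
rewrite invmx_mul ?(Defs.GL_unit g) // invmxK !mulmxA mulmxKV //.
by rewrite mulmxKV.
Unshelve. all: end_near. Qed.

End Adjoint.

End GenericStabilizer.

(** * Conjugacy classes of the elements S tau *)

Section Types.
Variables (k : closedFieldType) (n : nat).
(* [(to_PGL S, true)] is [S tau], which has order two iff [S^T = S] or [S^T = -S]. *)
Definition of_type (eps : k) (t : Ptau k n) : Prop :=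
  t.2 /\ exists S : GL k n, t.1 = to_PGL S /\ (GL_mx S)^T = eps *: GL_mx S.

(** As tau H^-1 = H^T tau, conjugation by H is congruence of Gram matrices, M |-> H M H^T.
    Classification of these elements up to conjugacy thus becomes that of bilinear forms. *)
Lemma conj_tau (H M : GL k n) :
  (Ptau_of_PGL (to_PGL H) * (to_PGL M, true) * (Ptau_of_PGL (to_PGL H))^-1)%g =
  (to_PGL (GL_mul (GL_mul H M) (GL_tr H)), true) :> Ptau k n.
Proof.
rewrite Ptau_tauE -!mulgA.
have -> : (tau k n * (Ptau_of_PGL (to_PGL H))^-1 =
    Ptau_of_PGL (to_PGL (GL_tr H)) * tau k n)%g.
  rewrite -[((Ptau_of_PGL _)^-1)%g]/(Ptau_of_PGL (PGL_inv (to_PGL H))) tau_mul.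
  rewrite to_PGL_inv to_PGL_tau; congr (Ptau_of_PGL (to_PGL _) * _)%g.
  by apply: val_inj; rewrite /= invmxK.
by rewrite Ptau_tauE !mulgA -!Ptau_of_PGLM -2!to_PGL_mul.
Qed.

Lemma of_type_conj eps g t : eps = 1 \/ eps = -1 -> of_type eps t ->
  of_type eps (g * t * g^-1)%g.
Proof.
move=> epsE; have conjP h s : of_type eps s ->
    of_type eps (Ptau_of_PGL h * s * (Ptau_of_PGL h)^-1)%g.
  case: s => s1 s2 [/= -> [S [-> Seps]]]; rewrite -[h]to_PGLK conj_tau; split=> //.
  eexists; split; first by reflexivity.
  by rewrite /= !trmx_mul trmxK Seps -scalemxAl -scalemxAr mulmxA.
case: g => h [] ot; last exact: conjP.
(* Conjugation by h tau is conjugation by tau followed by h; the former replaces S by its inverse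
   transpose, of the same symmetry because eps^-1 = eps. *)
have -> : (((h, true) : Ptau k n) * t * ((h, true) : Ptau k n)^-1 =
    Ptau_of_PGL h * (tau k n * t * (tau k n)^-1) * (Ptau_of_PGL h)^-1)%g.
  by rewrite Ptau_tauE invgM !mulgA.
apply: conjP; case: t ot => t1 t2 [/= -> [S [-> Seps]]].
rewrite Ptau_tauE mulgA tau_mul mulgK -Ptau_tauE to_PGL_tau; split=> //.
eexists; split; first by reflexivity.
have eps0 : eps != 0 by case: epsE => ->; rewrite ?oppr_eq0 oner_eq0.
rewrite /= trmxK trmx_inv Seps invmxZ ?unitmxZ ?unitfE ?(Defs.GL_unit S) //.
by rewrite scalerA mulfV // scale1r.
Qed.

Lemma of_type_tau : of_type 1 (tau k n).
Proof. by split=> //; exists (GL_one k n); rewrite /= trmx1 scale1r. Qed.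

(** The matrix of [g0] is orthogonal, hence equal to its inverse transpose, so [g0] commutes with
    tau. *)
Lemma tau_g0E m (e : (m + m)%N = n) :
  (tau k n * Ptau_of_PGL (g0 k e))%g = (g0 k e, true) :> Ptau k n.
Proof.
rewrite tau_mul [RHS]Ptau_tauE /g0 to_PGL_tau; congr (Ptau_of_PGL (to_PGL _) * _)%g.
apply: val_inj; rewrite /= /g0_mx; subst n; rewrite castmx_id.
set J := block_mx _ _ _ _; have JJ : J *m J^T = 1%:M.
  rewrite /J tr_block_mx mulmx_block !trmx0 linearN /= trmx1.
  rewrite !(mul0mx, mulmx0, mul1mx, mulmx1, mulmxN, mulNmx, opprK, add0r, addr0).
  by rewrite scalar_mx_block.
have [uJ _] := mulmx1_unit JJ.
by rewrite -[in LHS](mulmx1 (invmx J)) -JJ mulKmx // trmxK.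
Qed.

Lemma of_type_tau_g0 m (e : (m + m)%N = n) :
  of_type (-1) (tau k n * Ptau_of_PGL (g0 k e))%g.
Proof.
rewrite tau_g0E; split=> //; eexists; split; first by reflexivity.
rewrite /= /g0_mx; subst n; rewrite castmx_id tr_block_mx !trmx0 linearN /= trmx1.
by rewrite scaleN1r opp_block_mx !oppr0 opprK.
Qed.

Lemma conjugate_sets_sym (S T : set (Ptau k n)) : conjugate_sets S T -> conjugate_sets T S.
Proof.
move=> [g ->]; exists (g^-1)%g; apply/seteqP; split=> [s Ss|_ [_ [s Ss <-] <-]].
  by exists (g * s * g^-1)%g; [exists s|rewrite invgK !mulgA mulVg mul1g mulgVK].
by rewrite invgK !mulgA mulVg mul1g mulgVK.
Qed.

Lemma conjugate_sets_trans (S T U : set (Ptau k n)) :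
  conjugate_sets S T -> conjugate_sets T U -> conjugate_sets S U.
Proof.
move=> [g ->] [h ->]; exists (h * g)%g; apply/seteqP; split.
  by move=> _ [_ [s Ss <-] <-]; exists s; rewrite // invgM !mulgA.
by move=> _ [s Ss <-]; exists (g * s * g^-1)%g; [exists s|rewrite invgM !mulgA].
Qed.

Lemma conjugate_sets_pair (g t : Ptau k n) :
  conjugate_sets [set 1%g; t] [set 1%g; (g * t * g^-1)%g].
Proof.
exists g; apply/seteqP; split=> [s [->|->]|_ [s [->|->] <-]].
- by exists 1%g; [left|rewrite mulg1 mulgV].
- by exists t; [right|].
- by left; rewrite mulg1 mulgV.
- by right.
Qed.

Lemma conjugate_sets1 (S : set (Ptau k n)) : conjugate_sets [set 1%g] S -> S = [set 1%g].
Proof.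
move=> [g ->]; apply/seteqP; split=> [_ [s -> <-]|s ->]; first by rewrite mulg1 mulgV.
by exists 1%g; rewrite // mulg1 mulgV.
Qed.

Lemma of_type_conjugate eps s t : eps = 1 \/ eps = -1 -> of_type eps s -> t != 1%g ->
  conjugate_sets [set 1%g; s] [set 1%g; t] -> of_type eps t.
Proof.
move=> epsE os t1 [g E].
have : [set 1%g; t] t by right.
rewrite E => -[u [->|->] e]; last by rewrite -e; exact: of_type_conj.
by move: t1; rewrite -e mulg1 mulgV eqxx.
Qed.

Lemma of_type_neq1 eps t : of_type eps t -> t != 1%g.
Proof. by move=> [t2 _]; apply: contraTneq t2 => ->. Qed.

Hypotheses (two_neq0 : (2%:R : k) != 0) (n_gt0 : (0 < n)%N).

Lemma of_type_excl t : of_type 1 t -> of_type (-1) t -> False.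
Proof.
move=> [_ [S [tS symS]]] [_ [S' [+ skewS]]]; rewrite tS => /to_PGLP[c c0 SE].
have S0 : GL_mx S = 0.
  have : GL_mx S + GL_mx S = 0.
    by rewrite -{1}[GL_mx S]scale1r -symS SE linearZ /= skewS scaleN1r scalerN addNr.
  by rewrite -mulr2n -scaler_nat => /eqP; rewrite scaler_eq0 (negPf two_neq0) => /eqP.
by have := Defs.GL_unit S; rewrite S0 unitmxE -(scale0r 1%:M) detZ expr0n (gtn_eqF n_gt0) mul0r unitr0.
Qed.

Lemma of_type1_conj t : of_type 1 t -> exists g, t = (g * tau k n * g^-1)%g.
Proof.
case: t => t1 t2 [/= -> [S [-> symS]]]; rewrite scale1r in symS.
have [E EE] := symmetric_congruent1 two_neq0 (Defs.GL_unit S) symS.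
have [uES _] := mulmx1_unit EE; move: uES; rewrite unitmx_mul => /andP[uE _].
exists ((Ptau_of_PGL (to_PGL (MkGL uE)))^-1)%g.
have -> : tau k n = (Ptau_of_PGL (to_PGL (MkGL uE)) * (to_PGL S, true) * (Ptau_of_PGL (to_PGL (MkGL uE)))^-1)%g.
  rewrite conj_tau; congr (_, _); congr to_PGL; exact: val_inj.
by rewrite invgK !mulgA mulVg mul1g mulgVK.
Qed.

Lemma of_typeN1_conj t : of_type (-1) t ->
  exists m (e : (m + m)%N = n) g, t = (g * (tau k n * Ptau_of_PGL (g0 k e)) * g^-1)%g.
Proof.
case: t => t1 t2 [/= -> [S [-> skewS]]]; rewrite scaleN1r in skewS.
have [m [e [E EE]]] := skew_congruent_g0 two_neq0 (Defs.GL_unit S) skewS.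
have uE : E \in unitmx.
  have := g0_unit k e; rewrite -EE !unitmx_mul => /andP[/andP[]] //.
exists m, e, ((Ptau_of_PGL (to_PGL (MkGL uE)))^-1)%g; rewrite tau_g0E.
have -> : (g0 k e, true) = (Ptau_of_PGL (to_PGL (MkGL uE)) * (to_PGL S, true) * (Ptau_of_PGL (to_PGL (MkGL uE)))^-1)%g.
  rewrite conj_tau; congr (_, _); congr to_PGL; exact: val_inj.
by rewrite invgK !mulgA mulVg mul1g mulgVK.
Qed.

Lemma same_type_conjugate eps t u : eps = 1 \/ eps = -1 ->
  of_type eps t -> of_type eps u -> conjugate_sets [set 1%g; t] [set 1%g; u].
Proof.
case=> -> ot ou.
  have [g ->] := of_type1_conj ot; have [h ->] := of_type1_conj ou.
  apply: conjugate_sets_trans (conjugate_sets_pair h _).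
  exact: conjugate_sets_sym (conjugate_sets_pair g _).
have [m [e [g ->]]] := of_typeN1_conj ot; have [m' [e' [h ->]]] := of_typeN1_conj ou.
have mE : m = m' by apply: double_inj; rewrite -!addnn e e'.
subst m'; rewrite (eq_irrelevance e' e).
apply: conjugate_sets_trans (conjugate_sets_pair h _).
exact: conjugate_sets_sym (conjugate_sets_pair g _).
Qed.

End Types.

(** * The generic stabilizer according to kind and type *)

Section FirstKindType.
Variables (k : closedFieldType) (n : nat) (X : funspace k) (act : Ptau k n -> X -> X).
Hypothesis actP : irreducible_Ptau_variety act.
Variables (A : algType k) (sigma : {linear A -> A}) (phi : A -> X -> 'M[k]_n).
Hypothesis phiP : isomorphic_to_kn sigma act phi.
Variable b : 'I_(n * n) -> A.
Hypotheses (simpA : simple A) (basis_b : center_basis b) (n_gt0 : (0 < n)%N).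
Hypothesis free : in_general_position (fun x : X =>
  @PGL_in_Ptau k n `&` stabilizer act x = [set 1%g]).

Local Notation varX := (Ptau_variety actP).
Local Notation irrX := (Ptau_irreducible actP).
Local Notation K := (function_field varX irrX).
Local Notation rho := (rho actP phiP).

Lemma second_kind_trivial_stabilizer : second_kind sigma ->
  in_general_position (fun x => stabilizer act x = [set 1%g]).
Proof.
move=> /(second_kind_stabilizer actP phiP simpA basis_b n_gt0) => s2.
apply: filterS2 free s2 => x fx nx; apply/seteqP; split=> [[h []] hx|_ ->].
- by case: (nx h hx).
- suff : [set 1%g] ((h, false) : Ptau k n) by [].
  by rewrite -fx; split=> //; exists h.
- exact: (Ptau_act1 actP).
Qed.

(** If h tau and t1 tau both fix x, their quotient h t1^-1 lies in PGL_n and fixes x, so it is 1.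
    The sign is a boolean exponent because it is read in the function field for B and in [k] for
    t. *)
Lemma first_kind_type (s : bool) (B : 'M[K]_n) : first_kind sigma ->
  B \in unitmx -> B^T = (-1) ^+ s *: B ->
  (forall a, rho (sigma a) = invmx B *m (rho a)^T *m B) ->
  in_general_position (fun x => exists t, of_type ((-1) ^+ s) t /\
    stabilizer act x = [set 1%g; t]).
Proof.
move=> sigma_first uB BT adj.
have e1 := first_kind_stabilizer simpA basis_b n_gt0 sigma_first uB adj.
have e2 : in_general_position (fun x => (evmx B x)^T = (-1) ^+ s *: evmx B x).
  case: s BT => BT; last by apply: filterE => x; rewrite -evmx_tr BT !scale1r.
  have es := evmx_sub 0 B; have e0 := ev_zero varX irrX.
  apply: filterS2 e0 es => x E0 E; rewrite -evmx_tr BT scaleN1r -[- B]sub0r E !scaleN1r.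
  by apply/matrixP => i j; rewrite !mxE E0 add0r.
have e12 : in_general_position (fun x => exists t, of_type ((-1) ^+ s) t /\ act t x = x).
  apply: filterS3 e1 e2 (evmx_unit uB) => x [S [SE Sx]] sx [ux _].
  exists (to_PGL S, true); split=> //; split=> //; exists S; split=> //.
  rewrite SE trmx_inv trmxK sx invmxZ ?unitmxZ ?unitfE ?signr_eq0 //.
  by rewrite scalerA mulfV ?signr_eq0 // scale1r.
apply: filterS2 free e12 => x fx [t [ot tx]]; exists t; split=> //.
have f1 h : act (h, false) x = x -> (h, false) = 1%g :> Ptau k n.
  move=> hx; suff : [set 1%g] ((h, false) : Ptau k n) by [].
  by rewrite -fx; split=> //; exists h.
case: t ot tx => t1 t2 [/= t2T _]; rewrite t2T => tx {t2 t2T}.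
apply/seteqP; split=> [[h []] hx|_ [->|->] //]; last exact: (Ptau_act1 actP).
- right; have /f1 : act (h * t1^-1, false)%g x = x.
    have -> : (h * t1^-1, false)%g = (((h, true) : Ptau k n) * ((t1, true) : Ptau k n)^-1)%g.
      by rewrite !Ptau_tauE invgM !mulgA mulgK.
    by rewrite (Ptau_actM actP) -{1}tx actK.
  move=> /(congr1 fst) /= e; congr (_, _); rewrite -[h](mulgVK t1) e.
  exact: mul1g.
- by left; exact: f1.
Qed.

End FirstKindType.

(** The trace of [sigma] would map to n under one splitting and to -n under the other; both maps are
    injective, so 2n = 0 in A, excluded in characteristic zero. *)
Lemma sign_unique (k : fieldType) (A : algType k) (n : nat) (sigma : {linear A -> A})
    (b : 'I_(n * n) -> A) (L1 L2 : fieldType)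
    (rho1 : {rmorphism A -> 'M[L1]_n}) (rho2 : {rmorphism A -> 'M[L2]_n}) B1 B2 :
  [pchar k] =i pred0 -> simple A -> center_basis b -> (0 < n)%N ->
  B1 \in unitmx -> B1^T = B1 -> (forall a, rho1 (sigma a) = invmx B1 *m (rho1 a)^T *m B1) ->
  B2 \in unitmx -> B2^T = - B2 -> (forall a, rho2 (sigma a) = invmx B2 *m (rho2 a)^T *m B2) ->
  False.
Proof.
move=> char0 simpA basis_b n0 u1 T1 adj1 u2 T2 adj2.
have [s sE] := first_kind_trace simpA basis_b n0 sigma.
have s1 : s = n%:R.
  apply: (splitting_inj simpA n0 (rho := rho1)).
  by rewrite (sE _ rho1 B1 1) ?scale1r // mul1r rmorph_nat raddfMn.
have s2 : s = - n%:R.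
  apply: (splitting_inj simpA n0 (rho := rho2)).
  by rewrite (sE _ rho2 B2 (-1)) ?scaleN1r // mulN1r -scalemx1 scaleNr scaler_nat rmorphN rmorph_nat.
have : ((n + n)%:R : k) *: (1 : A) == 0.
  by rewrite scaler_nat mulrnDr -{1}s1 s2 addNr.
rewrite scaler_eq0 oner_eq0 orbF (proj1 (pcharf0P k) char0) addn_eq0.
by rewrite (gtn_eqF n0).
Qed.

Lemma alternating_skew (L : fieldType) (n : nat) (B : 'M[L]_n) :
  (forall v : 'rV[L]_n, v *m B *m v^T = 0) -> B^T = - B.
Proof.
move=> alt; apply/matrixP => i j; rewrite !mxE; apply/eqP; rewrite -addr_eq0; apply/eqP.
have E (a c : 'I_n) : (delta_mx 0 a : 'rV[L]_n) *m B *m (delta_mx 0 c)^T = (B a c)%:M.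
  by rewrite -rowE trmx_delta -colE; apply/matrixP => p q; rewrite !ord1 !mxE.
have := alt (delta_mx 0 i + delta_mx 0 j).
rewrite linearD /= !mulmxDl !mulmxDr !E.
have := alt (delta_mx 0 i); have := alt (delta_mx 0 j); rewrite !E => -> ->.
by rewrite add0r addr0 => /matrixP/(_ 0 0); rewrite !mxE addrC.
Qed.

Lemma skew_alternating (L : fieldType) (n : nat) (B : 'M[L]_n) : (2%:R : L) != 0 ->
  B^T = - B -> forall v : 'rV[L]_n, v *m B *m v^T = 0.
Proof.
move=> two skewB v; set x := v *m B *m v^T.
have : x^T = - x by rewrite !trmx_mul trmxK skewB mulNmx mulmxN mulmxA.
move=> /matrixP/(_ 0 0); rewrite !mxE => /eqP; rewrite -addr_eq0 -mulr2n -mulr_natl.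
rewrite mulf_eq0 (negPf two) /= => /eqP x0.
by apply/matrixP => i j; rewrite !ord1 [RHS]mxE -x0 mxE.
Qed.

Theorem theorem1p2 (k : closedFieldType) (char_k : [pchar k] =i pred0)
    (n : nat) (n_ge2 : (2 <= n)%N)
    (A : algType k) (sigma : {linear A -> A})
    (A_csa : central_simple A n) (sigma_inv : involution sigma)
    (X : funspace k) (act : Ptau k n -> X -> X)
    (X_assoc : associated_variety sigma act) :
  (exists S : set (Ptau k n), stabilizer_in_general_position act S) /\
  forall S : set (Ptau k n), stabilizer_in_general_position act S ->
    [/\ first_kind sigma <-> S <> [set 1%g],
        (second_kind sigma <-> S = [set 1%g]) /\
        (S = [set 1%g] <-> generically_free act setT),
        orthogonal_involution sigma n <-> conjugate_sets [set 1%g; tau k n] S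
      & symplectic_involution sigma n <->
          exists (m : nat) (e : (m + m)%N = n),
            conjugate_sets
              [set 1%g; (tau k n * Ptau_of_PGL (g0 k e))%g] S].
Proof.
have [actP free [phi phiP]] := X_assoc.
have [simpA [b0 basis0] _] := A_csa.
have [b basis_b] : exists b : 'I_(n * n) -> A, center_basis b by exists b0.
have n_gt0 : (0 < n)%N := ltnW n_ge2.
have two_neq0 : (2%:R : k) != 0 by rewrite (proj1 (pcharf0P k) char_k).
have nonempty : exists x : X, True := (Ptau_irreducible actP).1.
set rhoK := rho actP phiP.
(* The nonvanishing of 2 passes from k to A and from there to the function field through the
   injective [rhoK]. *)
have two_neq0K : (2%:R : function_field (Ptau_variety actP) (Ptau_irreducible actP)) != 0.
  apply/eqP => e2; have : (2%:R : A) == 0.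
    apply/eqP/(splitting_inj simpA n_gt0 (rho := rhoK)).
    by rewrite rmorph_nat rmorph0 -[2%:R]/(2%:R : 'M_n) -[1]/(1%:M) -scaler_nat e2 scale0r.
  by rewrite -scaler_nat scaler_eq0 oner_eq0 orbF (negPf two_neq0).
have t1T : tau k n != 1%g := of_type_neq1 (of_type_tau k n).
have tg m (e : (m + m)%N = n) := of_type_tau_g0 k e.
have pair_neq1 (t : Ptau k n) : t != 1%g -> [set 1%g; t] <> [set 1%g].
  by move=> t1 E; have : [set 1%g; t] t by [right]; rewrite E => /eqP; rewrite (negPf t1).
have [first|second] := pselect (first_kind sigma); last first.
  have gen := second_kind_trivial_stabilizer actP phiP simpA basis_b n_gt0 free second.
  split.
    exists [set 1%g]; split.
      by split=> // g h -> ->; rewrite mulgV.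
    apply: filterS gen => x ->; exists 1%g; apply/seteqP; split=> [s ->|_ [s -> <-]].
      by exists 1%g; rewrite // mulg1 mulgV.
    by rewrite mulg1 mulgV.
  move=> S [_ gS]; have S1 : S = [set 1%g].
    have [x [Sx x1]] := general_position_ex2 nonempty gS gen.
    by apply: conjugate_sets1; rewrite -x1; exact: conjugate_sets_sym.
  split.
  - by split=> // /(_ S1).
  - split; first by [].
    by split=> // _; apply: filterS gen => x ->; rewrite setTI.
  - split=> [[]//|]; rewrite S1 => /conjugate_sets_sym/conjugate_sets1/esym.
    by move=> E; case: (pair_neq1 _ t1T).
  - split=> [[]//|[m [e]]]; rewrite S1 => /conjugate_sets_sym/conjugate_sets1 E.
    by case: (pair_neq1 _ (of_type_neq1 (tg m e))).
have [B [eps [uB BT epsE adj]]] :=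
  first_kind_adjoint simpA basis_b n_gt0 sigma_inv first rhoK.
have [s sE] : exists s : bool, eps = (-1) ^+ s by case: epsE => ->; [exists false|exists true].
rewrite {eps}sE in BT epsE.
have gen := first_kind_type simpA basis_b n_gt0 free first uB BT adj.
have sgnE : ((-1) ^+ s : k) = 1 \/ ((-1) ^+ s : k) = -1 by case: s {BT epsE gen}; [right|left].
have [x0 [t0 [ot0 stab0]]] := general_position_ex nonempty gen.
(* The type is defined through some splitting field; comparing it with the form B over the function
   field by [sign_unique] determines [s]. *)
have type1 : s = false <-> orthogonal_involution sigma n.
  split=> [s0|[_ [L [rho' [B' [_ uB' symB' adj']]]]]].
    split=> //; exists _, rhoK, B; split=> //; first exact: (splittingP simpA basis_b n_gt0 rhoK).
    by rewrite BT s0 scale1r.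
  case: s BT {epsE gen sgnE ot0} => // BT.
  by case: (sign_unique char_k simpA basis_b n_gt0 uB' symB' adj' uB _ adj); rewrite BT scaleN1r.
have typeN1 : s = true <-> symplectic_involution sigma n.
  split=> [s1|[_ [L [rho' [B' [_ uB' altB' adj']]]]]].
    split=> //; exists _, rhoK, B; split=> //; first exact: (splittingP simpA basis_b n_gt0 rhoK).
    by apply: skew_alternating => //; rewrite BT s1 scaleN1r.
  case: s BT {epsE gen sgnE ot0 type1} => // BT.
  have skewB' := alternating_skew altB'.
  by case: (sign_unique char_k simpA basis_b n_gt0 uB _ adj uB' skewB' adj'); rewrite BT scale1r.
have conj_of_type t : of_type ((-1) ^+ s) t -> conjugate_sets [set 1%g; t0] [set 1%g; t].
  exact: same_type_conjugate.
split.
  exists [set 1%g; t0]; split.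
    rewrite -stab0 /stabilizer; split=> [|g h gx hx]; first exact: (Ptau_act1 actP).
    by rewrite /= (Ptau_actM actP) -{1}hx actK.
  by apply: filterS gen => x [t [ot ->]]; exact: conj_of_type.
move=> S [_ gS].
(* A single point serves both descriptions: the stabilizer there is conjugate to S and equals {1, t}
   with t of the sign of B. *)
have [x [Sx [t [ot stabx]]]] := general_position_ex2 nonempty gS gen.
rewrite stabx in Sx.
have t_neq1 := of_type_neq1 ot.
have S_neq1 : S <> [set 1%g].
  move=> S1; rewrite S1 in Sx; exact: pair_neq1 t_neq1 (conjugate_sets1 Sx).
have type_eq u eps : of_type eps u -> eps = 1 \/ eps = -1 -> conjugate_sets [set 1%g; u] S ->
    of_type eps t.
  move=> ou eps1 uS; apply: (of_type_conjugate eps1 ou t_neq1).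
  exact: conjugate_sets_trans uS Sx.
split.
- by [].
- split; first by split=> // S1; case: S_neq1.
  split=> [S1|gf]; first by case: S_neq1.
  have [y [y1 [u [ou stabu]]]] := general_position_ex2 nonempty gf gen.
  rewrite setTI stabu in y1; case: (pair_neq1 _ (of_type_neq1 ou) y1).
- rewrite -type1; split=> [s0|tS].
    rewrite s0 in ot; have [g tE] := of_type1_conj two_neq0 ot.
    apply: conjugate_sets_trans (conjugate_sets_sym Sx); rewrite tE.
    exact: conjugate_sets_pair.
  have ot1 := type_eq _ _ (of_type_tau k n) (or_introl erefl) tS.
  by case: s ot {BT epsE gen sgnE ot0 type1 typeN1 conj_of_type} => // /(of_type_excl two_neq0 n_gt0 ot1).
- rewrite -typeN1; split=> [s1|[m [e tS]]].
    rewrite s1 in ot; have [m [e [g tE]]] := of_typeN1_conj two_neq0 ot.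
    exists m, e; apply: conjugate_sets_trans (conjugate_sets_sym Sx); rewrite tE.
    exact: conjugate_sets_pair.
  have otN1 := type_eq _ _ (tg m e) (or_intror erefl) tS.
  by case: s ot {BT epsE gen sgnE ot0 type1 typeN1 conj_of_type} => // /of_type_excl/(_ otN1) [].
Qed.
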